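(* Let $X_1,\dots,X_n$ be i.i.d. with law $P$ on $(\mathcal X,\mathcal A)$, and let $\mathcal F$ be a class of measurable functions $f:\mathcal X\to\mathbb R$ with $\sup_{f\in\mathcal F}\|f\|_\infty\le 1$. (1) Fix $p\ge 1$, write $q:=p\wedge 2$, and suppose $\sup_{f\in\mathcal F}\|f\|_{L_p(P)}\le\sigma$. Suppose there exists some $\alpha>0$ (with $\alpha\neq q$) such that for all $\epsilon>0$, $\log\mathcal N_{[\,]}(\epsilon,\mathcal F,L_p(P))\le L\epsilon^{-\alpha}$. Then $$\mathbb E\sup_{f\in\mathcal F}|\mathbb G_n(f)|\ \lesssim_{\alpha,p}\ \inf_{0\le\gamma\le\sigma/2}\Big\{\big(\sigma\mathbf 1_{\alpha<q}+\gamma\mathbf 1_{\alpha>q}\big)^{(q-\alpha)/2}+n^{-1/2}\sigma^{-\alpha}+\sqrt n\,\gamma\Big\}$$ $$\asymp\begin{cases}\sigma^{(q-\alpha)/2}+n^{-1/2}\sigma^{-\alpha},&\alpha<q;\\ n^{\frac{\alpha-q}{2(\alpha+2-q)}}+\sigma^{-\frac{\alpha-q}{2}}+n^{-1/2}\sigma^{-\alpha},&\alpha>q.\end{cases}$$ (2) Suppose that the following entropy estimate holds for some $\alpha>0$, for all $\epsilon>0$: $\log\mathcal N_{[\,]}(\epsilon^2,\mathcal F,L_1(P))\le L\epsilon^{-2\alpha}$ if $\alpha>1$, and $\log\mathcal N_{[\,]}(\epsilon,\mathcal F,L_2(P))\le L\epsilon^{-2\alpha}$ if $0<\alpha<1$.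 Then for $\sigma^2\gtrsim n^{-1/(\alpha+1)}$, $\alpha\ne1$, we have $$\mathbb E\sup_{f\in\mathcal F(\sigma)}|\mathbb G_n(f)|\lesssim_\alpha\max\big\{\sigma^{1-\alpha},\,n^{(\alpha-1)/(2(\alpha+1))}\big\}.$$ (3) If, in addition to the entropy estimate in (2), it holds that $\log\mathcal N(\epsilon/2,\mathcal F(\epsilon),L_2(P))\ge L^{-1}\epsilon^{-2\alpha}$ for all $\epsilon>0$, then for $\sigma^2\gtrsim n^{-1/(\alpha+1)}$, $\alpha\ne1$, we have $$\mathbb E\sup_{f\in\mathcal F(\sigma)}|\mathbb G_n(f)|\gtrsim_\alpha\max\big\{\sigma^{1-\alpha},\,n^{(\alpha-1)/(2(\alpha+1))}\big\}.$$
   Context: $\mathbb G_n(f)=\sqrt n(\mathbb P_n-P)(f)=n^{-1/2}\sum_{i=1}^n(f(X_i)-Pf)$, where $\mathbb P_n$ is the empirical measure of $X_1,\dots,X_n$ and $Pf=\int f\,dP$. $\mathcal F(\sigma)=\{f\in\mathcal F:Pf^2\le\sigma^2\}$. $\mathcal N(\epsilon,\mathcal F,\|\cdot\|)$ is the minimum number of balls $\{g:\|g-f\|<\epsilon\}$ needed to cover $\mathcal F$. $\mathcal N_{[\,]}(\epsilon,\mathcal F,\|\cdot\|)$ is the minimum number of brackets $[\ell,u]=\{f:\ell\le f\le u\}$ with $\|u-\ell\|<\epsilon$ needed to cover $\mathcal F$. $\|f\|_{L_p(P)}=(P|f|^p)^{1/p}$, $\|f\|_\infty=\sup_x|f(x)|$.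 Notational convention: $\log(x)$ stands for $\log(e\vee x)$. $a\wedge b=\min\{a,b\}$, $a\vee b=\max\{a,b\}$. $a\lesssim_x b$ means $a\le C_x b$ with $C_x$ depending only on $x$; $\gtrsim_x$ is the reverse; $\asymp$ means both; without subscript the constant is absolute. $L$ is a large enough absolute constant, the dependence on which is not explicitly stated.
   Formalization: In (3), σ ≤ 1 is assumed when α < 1 (the bound fails as σ → ∞); the constant in the ≍ of (1) depends on α and p (an absolute one is impossible, e.g. n = σ = 1, α large); the upper entropy bounds use the plain logarithm, since the truncated one cannot satisfy them for all ε. *)

(* Defs.v *)
From HB Require Import structures.
From mathcomp Require Export all_boot all_order all_algebra.
From mathcomp Require Export all_classical all_reals all_analysis.
From mathcomp Require Export measurable_realfun.
Export numFieldNormedType.Exports.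

Set Implicit Arguments.
Unset Strict Implicit.
Unset Printing Implicit Defensive.

Import Order.TTheory GRing.Theory Num.Theory.

Local Open Scope classical_set_scope.
Local Open Scope ring_scope.

Section FunctionClasses.
Context d (T : measurableType d) (R : realType).

Definition sup_norm (f : T -> R) : \bar R :=
  ereal_sup (range (fun x => `|f x|%:E)).

Definition unit_bounded_class (F : set (T -> R)) : Prop :=
  forall f, F f -> measurable_fun setT f /\ (sup_norm f <= 1)%E.

Definition Lp_norm (P : probability T R) (p : R) (f : T -> R) : \bar R :=
  'N[P]_(p%:E)[EFin \o f].

Definition local_class (P : probability T R) (F : set (T -> R)) (sigma : R) :
    set (T -> R) :=
  [set f | F f /\ (\int[P]_x (f x ^+ 2)%:E <= (sigma ^+ 2)%:E)%E].

(* The two numbers below are +oo when no finite cover exists. *)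

(* The centers need not belong to the class. *)
Definition covering_number (eps : R) (F : set (T -> R))
    (norm : (T -> R) -> \bar R) : \bar R :=
  ereal_inf [set (k%:R)%:E | k in [set k : nat |
    exists c : 'I_k -> T -> R,
      (forall i, measurable_fun setT (c i)) /\
      (forall g, F g -> exists i, (norm (g \- c i)%R < eps%:E)%E)]].

(* The endpoints of the brackets need not belong to the class. *)
Definition bracketing_number (eps : R) (F : set (T -> R))
    (norm : (T -> R) -> \bar R) : \bar R :=
  ereal_inf [set (k%:R)%:E | k in [set k : nat |
    exists l u : 'I_k -> T -> R,
      [/\ forall i, measurable_fun setT (l i) /\ measurable_fun setT (u i),
          forall i, (norm (u i \- l i)%R < eps%:E)%E &
          forall f, F f -> exists i, forall x, l i x <= f x <= u i x]]].

(* The plain logarithm is used here: log (max e N) >= 1 cannot be bounded by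
   L * eps^(-a) for every eps > 0, so the truncated logarithm would make these
   conditions unsatisfiable. *)
Definition bracketing_entropy_ub (P : probability T R) (F : set (T -> R))
    (p alpha L : R) : Prop :=
  forall eps : R, 0 < eps ->
    (lne (bracketing_number eps F (Lp_norm P p)) <=
       (L * eps `^ (- alpha))%:E)%E.

Definition local_bracketing_entropy_ub (P : probability T R) (F : set (T -> R))
    (alpha L : R) : Prop :=
  (1 < alpha -> forall eps : R, 0 < eps ->
    (lne (bracketing_number (eps ^+ 2) F (Lp_norm P 1)) <=
       (L * eps `^ (- (2 * alpha)))%:E)%E) /\
  (alpha < 1 -> forall eps : R, 0 < eps ->
    (lne (bracketing_number eps F (Lp_norm P 2)) <=
       (L * eps `^ (- (2 * alpha)))%:E)%E).

(* The truncated logarithm log (max e N) is used here: the covering number is 1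
   for large eps, where the plain logarithm vanishes and the condition could
   not hold. *)
Definition local_covering_entropy_lb (P : probability T R) (F : set (T -> R))
    (alpha L : R) : Prop :=
  forall eps : R, 0 < eps ->
    ((L^-1 * eps `^ (- (2 * alpha)))%:E <=
       lne (Order.max (expR 1)%:E
         (covering_number (eps / 2) (local_class P F eps) (Lp_norm P 2))))%E.

End FunctionClasses.

Section EmpiricalProcess.
Context d d' (T : measurableType d) (Omega : measurableType d') (R : realType).
Variables (Pr : probability Omega R) (P : probability T R).

(* The supremum of an uncountable class need not be measurable, so expectations
   of suprema are outer expectations. The majorants are nonnegative, so the
   supremum over the empty class counts as 0. *)
Definition outer_expectation (H : Omega -> \bar R) : \bar R :=
  ereal_inf [set (\int[Pr]_w U w)%E | U in [set U : Omega -> \bar R |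
    [/\ measurable_fun setT U, forall w, (0 <= U w)%E &
        forall w, (H w <= U w)%E]]].

Variable n : nat.

Definition iid_sample (X : 'I_n -> {RV Pr >-> T}) : Prop :=
  (forall i A, measurable A -> distribution Pr (X i) A = P A) /\
  (forall (J : {set 'I_n}) (A : 'I_n -> set T), (forall i, measurable (A i)) ->
     Pr (\bigcap_(i in [set` J]) (X i @^-1` A i)) =
       (\prod_(i in J) Pr (X i @^-1` A i))%E).

Definition empirical_process (X : 'I_n -> {RV Pr >-> T}) (f : T -> R)
    (w : Omega) : R :=
  (Num.sqrt n%:R)^-1 * \sum_(i < n) (f (X i w) - \int[P]_x f x).

Definition expected_sup (X : 'I_n -> {RV Pr >-> T}) (F : set (T -> R)) :
    \bar R :=
  outer_expectation (fun w =>
    ereal_sup [set `|empirical_process X f w|%:E | f in F]).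

End EmpiricalProcess.

Section Rates.
Context (R : realType).
Implicit Types alpha q sigma gamma : R.

(* Unlike powR, a negative power of 0 is +oo. *)
Definition epowR (x r : R) : \bar R :=
  if (x == 0) && (r < 0) then +oo%E else (x `^ r)%:E.

Definition bracketing_bound (n : nat) alpha q sigma : \bar R :=
  ereal_inf [set
    (epowR (sigma * (alpha < q)%R%:R + gamma * (q < alpha)%R%:R)
           ((q - alpha) / 2)
     + (n%:R `^ (- (1 / 2)) * sigma `^ (- alpha)
        + Num.sqrt n%:R * gamma)%:E)%E
    | gamma in [set gamma | 0 <= gamma <= sigma / 2]].

Definition bracketing_rate (n : nat) alpha q sigma : R :=
  if alpha < q then
    sigma `^ ((q - alpha) / 2) + n%:R `^ (- (1 / 2)) * sigma `^ (- alpha)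
  else
    n%:R `^ ((alpha - q) / (2 * (alpha + 2 - q)))
    + sigma `^ (- ((alpha - q) / 2))
    + n%:R `^ (- (1 / 2)) * sigma `^ (- alpha).

Definition local_rate (n : nat) alpha sigma : R :=
  Num.max (sigma `^ (1 - alpha))
          (n%:R `^ ((alpha - 1) / (2 * (alpha + 1)))).

End Rates.

(* Main.v *)
(** Upper bounds: chaining along intersections of brackets of geometrically
    decreasing size.  A link is cut off where the width of its bracket exceeds
    the threshold at which the two terms of Bernstein's inequality balance; the
    part cut off is controlled by Chebyshev's inequality.  The chain stops at the
    level where the L1 size of the brackets, multiplied by the square root of n,
    matches the sum of the links.

    Lower bound: the covering numbers give M functions f_j whose differences have
    large variance.  Let P_j have density 1 + lam * (f_j - P f_j) with respect
    to P.  If the centred empirical process were small under P_j, the statistics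
    G_n(f_k) would identify j with probability more than 1/2; but the decoding
    events are disjoint, so one of them has P-probability at most 1/M, hence
    P_j-probability at most 1/2, the chi-square distance between the two product
    laws being moderate.  The expected supremum under P_j is compared with that
    under P by writing P as the average of the laws with densities
    1 + lam * (f_j - P f_j) and 1 - lam * (f_j - P f_j), conditioning on the
    component from which each X_i is drawn and using Jensen's inequality. *)

Require Import Defs.
From mathcomp Require Import ring lra.

Set Implicit Arguments.
Unset Strict Implicit.
Unset Printing Implicit Defensive.

Import Order.TTheory GRing.Theory Num.Theory.
Local Open Scope classical_set_scope.
Local Open Scope ring_scope.

(** * Random walks on a finite alphabet *)

(** Product measures are avoided. A finite family of functions is rounded to a finite alphabet; the
    sample then acts through finite weights, and a mean over the sample becomes the recursive
    [walk], where exponential moments, tilting and the chi-square estimate are inductions on n.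
    Suprema need not be measurable, so upper bounds exhibit an explicit bounded measurable majorant,
    and lower bounds a function of the rounded sample lying below every majorant.

    One chaining estimate serves all upper bounds. Its parameters [a] and [u] say that a bracket of
    L2 size e has L1 size at most e^u and that the entropy is of order e^(-2a): the pair is alpha/q,
    2/q for L_p brackets, and alpha, 1 or alpha, 2 in the two regimes of the local class. Balancing
    the links g^(1-a) against the remainder sqrt n * g^u gives the exponent (a-1)/(2(a-1+u)).

    In the lower bound the functions have to be separated in variance, not merely in L2, and the
    tilting argument needs n above an absolute constant; for smaller n, two separated functions and
    a second moment suffice. *)

Section Walk.
Context (R : realType) (V : zmodType).

(* [walk n w v phi y] is the expectation of [phi (y + v x_1 + ... + v x_n)]
   when the letters [x_i] are independent with weights [w]. *)
Fixpoint walk (A : finType) n (w : A -> R) (v : A -> V) (phi : V -> R) (y : V) : R :=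
  if n is m.+1 then \sum_b w b * walk m w v phi (y + v b) else phi y.

Lemma eq_walk (A : finType) n (w : A -> R) v phi psi y : phi =1 psi -> walk n w v phi y = walk n w v psi y.
Proof.
move=> e; elim: n y => [|n IH] y /=; first exact: e.
by apply: eq_bigr => b _; rewrite IH.
Qed.

Section Basic.
Context (A : finType) (w : A -> R) (v : A -> V).

Lemma walk_translate c n phi y :
  walk n w v phi (y + c) = walk n w v (fun u => phi (u + c)) y.
Proof.
by elim: n y => [|n IH] y //=; apply: eq_bigr => b _; rewrite -IH addrAC.
Qed.

(** Serves to pass from a tilted walk with steps [v] to its centred version: the accumulated drift
    moves into the observable. *)
Lemma walk_recenter (c : V) n phi y :
  walk n w v phi y = walk n w (fun b => v b - c) (fun u => phi (u + c *+ n)) y.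
Proof.
elim: n phi y => [|n IH] phi y /=; first by rewrite addr0.
apply: eq_bigr => b _; congr (_ * _).
rewrite -(subrK c (v b)) addrA walk_translate IH subrK.
by apply: eq_walk => u; rewrite mulrS addrA addrAC.
Qed.

Hypothesis w_ge0 : forall b, 0 <= w b.

Lemma walk_le n phi psi y : (forall u, phi u <= psi u) ->
  walk n w v phi y <= walk n w v psi y.
Proof.
move=> le; elim: n y => [|n IH] y //=.
by apply: ler_sum => b _; apply: ler_wpM2l.
Qed.

Hypothesis w_sum1 : \sum_b w b = 1.

Lemma walk_affine n phi c d y :
  walk n w v (fun u => c + d * phi u) y = c + d * walk n w v phi y.
Proof.
elim: n y => [|n IH] y //=; under eq_bigr do rewrite IH mulrDr.
rewrite big_split/= -mulr_suml w_sum1 mul1r mulr_sumr; congr (_ + _).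
by apply: eq_bigr => b _; rewrite mulrCA.
Qed.

End Basic.

Lemma walk_sum (A : finType) (w : A -> R) v (J : finType) n (phi : J -> V -> R) y :
  walk n w v (fun u => \sum_j phi j u) y = \sum_j walk n w v (phi j) y.
Proof.
elim: n y => [|n IH] y //=; under eq_bigr do rewrite IH mulr_sumr.
by rewrite exchange_big.
Qed.

End Walk.

(** * Jensen's inequality for finitely supported noise *)

Section Jensen.
Context (R : realType) (M : nat).
Implicit Types phi : {ffun 'I_M -> R} -> R.

(** Convexity in the only form needed: adding independent centred noise with finitely many values
    does not decrease the mean. In this form it passes to [walk] by exchanging two finite sums. *)
Definition jensen phi := forall (B : finType) (q : B -> R) (z : B -> {ffun 'I_M -> R}) y,
  (forall b, 0 <= q b) -> \sum_b q b = 1 -> (forall k, \sum_b q b * z b k = 0) ->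
  phi y <= \sum_b q b * phi (y + z b).

Lemma jensen_walk (A : finType) (w : A -> R) (v : A -> {ffun 'I_M -> R}) n phi :
  (forall b, 0 <= w b) -> jensen phi -> jensen (walk n w v phi).
Proof.
move=> w0 J; elim: n => [//|n IH] B q z y q0 q1 qz /=.
under [leRHS]eq_bigr do rewrite mulr_sumr.
rewrite exchange_big/=; apply: ler_sum => c _.
under eq_bigr do rewrite mulrCA.
rewrite -mulr_sumr ler_wpM2l//.
under eq_bigr do rewrite addrAC.
exact: IH.
Qed.

End Jensen.

Section MaxNorm.
Context (R : realType) (M : nat).
Implicit Types y z : {ffun 'I_M -> R}.

Definition maxabs y : R := \big[Num.max/0]_k `|y k|.

Lemma maxabs_ge0 y : 0 <= maxabs y.
Proof. exact: bigmax_ge_id. Qed.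

Lemma le_maxabs y k : `|y k| <= maxabs y.
Proof. exact: (le_bigmax _ (fun k => `|y k|)). Qed.

Lemma maxabs_le y c : 0 <= c -> (forall k, `|y k| <= c) -> maxabs y <= c.
Proof. by move=> c0 yc; apply: bigmax_le => // i _. Qed.

Lemma maxabsD y z : maxabs (y + z) <= maxabs y + maxabs z.
Proof.
apply: maxabs_le => [|k]; first by rewrite addr_ge0 ?maxabs_ge0.
by rewrite ffunE (le_trans (ler_normD _ _))// lerD ?le_maxabs.
Qed.

Lemma jensen_maxabs : jensen maxabs.
Proof.
move=> B q z y q0 q1 qz; apply: maxabs_le => [|k].
  by apply: sumr_ge0 => b _; rewrite mulr_ge0 ?maxabs_ge0.
have -> : y k = \sum_b q b * (y + z b) k.
  under eq_bigr do rewrite ffunE mulrDr.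
  by rewrite big_split/= -mulr_suml q1 mul1r qz addr0.
rewrite (le_trans (ler_norm_sum _ _ _))//; apply: ler_sum => b _.
by rewrite normrM (ger0_norm (q0 b)) ler_wpM2l// le_maxabs.
Qed.

End MaxNorm.

(* Tilting the letter law [p] by [1 + lam * v_j] makes the j-th coordinate of the
   walk drift; the tilted walks can be told apart unless the centred walk is
   large, while their chi-square distance to the original one is small. *)
Section Tilt.
Context (R : realType) (A : finType) (M : nat).
Context (p : A -> R) (v : A -> {ffun 'I_M -> R}) (lam K : R).
Hypothesis p_ge0 : forall b, 0 <= p b.
Hypothesis p_sum1 : \sum_b p b = 1.
Hypothesis v_centered : forall k, \sum_b p b * v b k = 0.
Hypothesis v_le2 : forall b k, `|v b k| <= 2.
Hypothesis v_var : forall k, \sum_b p b * v b k ^+ 2 <= K.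
Hypothesis lam_gt0 : 0 < lam.
Hypothesis lam_le : lam <= 4^-1.

Let cov j k := \sum_b p b * (v b j * v b k).
Let covv j : {ffun 'I_M -> R} := [ffun k => cov j k].
(** Under [tilt j] the mean of [v] is [lam *: covv j], so [h j] below is the centred step. The
    weights [p] are the average of [tilt j] and [untilt j]. *)
Let tilt j b := p b * (1 + lam * v b j).
Let untilt j b := p b * (1 - lam * v b j).
Let h j b := v b - lam *: covv j.

Lemma tilt_factor b j : 2^-1 <= 1 + lam * v b j /\ 2^-1 <= 1 - lam * v b j.
Proof.
have /ler_normlP[? ?] : `|lam * v b j| <= 2^-1.
  rewrite normrM (gtr0_norm lam_gt0).
  have -> : 2^-1 = 4^-1 * 2 :> R by field.
  by rewrite ler_pM// ltW.
by split; lra.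
Qed.

Lemma tilt_ge0 j b : 0 <= tilt j b.
Proof. by have [? _] := tilt_factor b j; rewrite mulr_ge0//; lra. Qed.

Lemma untilt_ge0 j b : 0 <= untilt j b.
Proof. by have [_ ?] := tilt_factor b j; rewrite mulr_ge0//; lra. Qed.

Lemma tilt_sum j (g : A -> R) :
  \sum_b tilt j b * g b = \sum_b p b * g b + lam * \sum_b p b * (v b j * g b).
Proof.
rewrite mulr_sumr -big_split/=; apply: eq_bigr => b _; rewrite /tilt; ring.
Qed.

Lemma untilt_sum j (g : A -> R) :
  \sum_b untilt j b * g b = \sum_b p b * g b - lam * \sum_b p b * (v b j * g b).
Proof.
rewrite mulr_sumr -sumrB; apply: eq_bigr => b _; rewrite /untilt; ring.
Qed.

Lemma tilt_sum1 j : \sum_b tilt j b = 1.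
Proof.
have := tilt_sum j (fun=> 1); under eq_bigr do rewrite mulr1.
move=> ->; under eq_bigr do rewrite mulr1.
by under [X in _ + _ * X]eq_bigr do rewrite mulr1; rewrite p_sum1 v_centered mulr0 addr0.
Qed.

Lemma untilt_sum1 j : \sum_b untilt j b = 1.
Proof.
have := untilt_sum j (fun=> 1); under eq_bigr do rewrite mulr1.
move=> ->; under eq_bigr do rewrite mulr1.
by under [X in _ - _ * X]eq_bigr do rewrite mulr1; rewrite p_sum1 v_centered mulr0 subr0.
Qed.

Lemma K_ge0 (j : 'I_M) : 0 <= K.
Proof.
by apply: le_trans (v_var j); apply: sumr_ge0 => b _; rewrite mulr_ge0 ?sqr_ge0.
Qed.

Lemma cov_le j k : `|cov j k| <= K.
Proof.
rewrite /cov (le_trans (ler_norm_sum _ _ _))//.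
have -> : K = (K + K) / 2 by field.
rewrite ler_pdivlMr// mulr_suml (le_trans _ (lerD (v_var j) (v_var k)))//.
rewrite -big_split/=; apply: ler_sum => b _.
rewrite normrM (ger0_norm (p_ge0 b)) -mulrDr -mulrA ler_wpM2l//.
rewrite normrM -(real_normK (num_real (v b j))) -(real_normK (num_real (v b k))).
have := sqr_ge0 (`|v b j| - `|v b k|); nra.
Qed.

Let W n := walk n p v (@maxabs R M).
Let E j n := walk n (tilt j) (h j) (@maxabs R M).

(* The walk with law [E] in which each letter is kept with probability 1/2. *)
Let U j n := walk n (fun bs : A * bool => 2^-1 * tilt j bs.1)
   (fun bs => if bs.2 then h j bs.1 else 0) (@maxabs R M).

Lemma USE j n y :
  U j n.+1 y = 2^-1 * (\sum_b tilt j b * U j n (y + h j b)) + 2^-1 * U j n y.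
Proof.
rewrite /U /=; pose G b (s : bool) := 2^-1 * tilt j b * U j n (y + if s then h j b else 0).
rewrite (eq_bigr (fun bs => G bs.1 bs.2)); last by case.
rewrite -(pair_bigA _ G)/=.
under eq_bigr do rewrite big_bool/= /G addr0 -!(mulrA 2^-1).
rewrite big_split/= -!mulr_sumr; congr (_ + _ * _).
by rewrite -mulr_suml tilt_sum1 mul1r.
Qed.

Lemma jensen_U j n : jensen (U j n).
Proof.
apply: jensen_walk; last exact: jensen_maxabs.
by move=> [b s]; rewrite mulr_ge0 ?tilt_ge0// invr_ge0.
Qed.

(** Fair coins split the letters into two groups; the sum over each group has the law of the walk
    [U], and [maxabs] is subadditive. *)
Lemma E_le_U j n y z : E j n (y + z) <= U j n y + U j n z.
Proof.
elim: n y z => [|n IH] y z; first exact: maxabsD.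
rewrite !USE /E/= -/(E j n).
have -> : 2^-1 * (\sum_b tilt j b * U j n (y + h j b)) + 2^-1 * U j n y +
  (2^-1 * (\sum_b tilt j b * U j n (z + h j b)) + 2^-1 * U j n z) =
  \sum_b tilt j b * (2^-1 * (U j n (y + h j b) + U j n z) + 2^-1 * (U j n y + U j n (z + h j b))).
  rewrite -[in LHS](mul1r (2^-1 * U j n y)) -[in LHS](mul1r (2^-1 * U j n z)) -(tilt_sum1 j).
  rewrite !mulr_sumr !mulr_suml -!big_split/=; apply: eq_bigr => b _; ring.
apply: ler_sum => b _; rewrite ler_wpM2l ?tilt_ge0//.
have := IH y (z + h j b); have := IH (y + h j b) z.
rewrite (addrAC y (h j b)) (addrA y z); move: (E _ _ _) => e.
move: (U _ _ _) (U _ _ _) (U _ _ _) (U _ _ _) => *; lra.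
Qed.

(** By Jensen, a letter that was dropped may be replaced by a draw from [untilt j] with its centred
    step [hm]. The coin then chooses between [tilt j] and [untilt j], so the letter has law [p], and
    its step differs from [v b] by [lam *: covv j] with the sign of the coin. The imbalance [z] of
    these signs performs a simple symmetric walk; [|z|] is bounded by [(r + z ^+ 2 / r) / 2],
    because the mean of the square can be followed exactly. *)
Lemma U_le_W j n r y z : 0 < r ->
  U j n y <= W n (y + (z * lam) *: covv j) + lam * K / 2 * (r + (z ^+ 2 + n%:R) / r).
Proof.
move=> r0; have K0 := K_ge0 j; elim: n y z => [|n IH] y z.
  rewrite /U /W/= addr0.
  rewrite -[X in maxabs X](addrK ((z * lam) *: covv j)).
  rewrite (le_trans (maxabsD _ _))// lerD2l.
  apply: maxabs_le => [|k].
    have l0 := ltW lam_gt0; have r0' := ltW r0.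
    apply: mulr_ge0; first by rewrite divr_ge0// mulr_ge0.
    by apply: addr_ge0 => //; apply: divr_ge0 => //; rewrite sqr_ge0.
  rewrite !ffunE normrN !normrM (gtr0_norm lam_gt0).
  have : `|z| <= (r + z ^+ 2 / r) / 2.
    rewrite ler_pdivlMr// -(ler_pM2r r0) mulrDl mulfVK ?gt_eqF//.
    rewrite -(real_normK (num_real z)); have := sqr_ge0 (r - `|z|); nra.
  have := cov_le j k; move: (normr_ge0 z) (normr_ge0 (cov j k)) lam_gt0.
  move: `|z| `|cov j k| (r + _) => a c d a0 c0 l0 cK ad.
  have : a * lam * c <= d / 2 * lam * K by rewrite ler_pM ?mulr_ge0 ?ler_pM// ltW.
  by move/le_trans; apply; rewrite le_eqVlt; apply/orP; left; apply/eqP; ring.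
set D := fun z m => lam * K / 2 * (r + (z ^+ 2 + m%:R) / r).
rewrite USE -/(D z n.+1).
(* The squares of [z + 1] and [z - 1] average to [z ^+ 2 + 1], which turns n into n + 1. *)
have -> : D z n.+1 = 2^-1 * D (z + 1) n + 2^-1 * D (z - 1) n.
  rewrite /D -natr1; field; exact: lt0r_neq0.
set hm := fun b => v b + lam *: covv j.
have Um : U j n y <= \sum_b untilt j b * U j n (y + hm b).
  apply: jensen_U => [b||k]; rewrite ?untilt_ge0 ?untilt_sum1//.
  rewrite untilt_sum /hm; under eq_bigr do rewrite !ffunE mulrDr.
  rewrite big_split/= v_centered -mulr_suml p_sum1 mul1r add0r.
  under eq_bigr do rewrite !ffunE !mulrDr.
  rewrite big_split/= -/(cov j k).
  under eq_bigr do rewrite mulrA.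
  by rewrite -mulr_suml v_centered mul0r addr0 subrr.
have le1 b : U j n (y + h j b) <= W n (y + (z * lam) *: covv j + v b) + D (z + 1) n.
  apply: le_trans (IH _ (z + 1)) _; rewrite /D le_eqVlt; apply/orP; left; apply/eqP.
  congr (W n _ + _); apply/ffunP => k; rewrite !ffunE -![_ *: _]/(_ * _); ring.
have le2 b : U j n (y + hm b) <= W n (y + (z * lam) *: covv j + v b) + D (z - 1) n.
  apply: le_trans (IH _ (z - 1)) _; rewrite /D le_eqVlt; apply/orP; left; apply/eqP.
  congr (W n _ + _); apply/ffunP => k; rewrite !ffunE -![_ *: _]/(_ * _); ring.
have {Um} Um : U j n y <= \sum_b untilt j b * (W n (y + (z * lam) *: covv j + v b) + D (z - 1) n).
  by apply: le_trans Um _; apply: ler_sum => b _; rewrite ler_wpM2l ?untilt_ge0.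
have {}le1 : \sum_b tilt j b * U j n (y + h j b) <=
   \sum_b tilt j b * (W n (y + (z * lam) *: covv j + v b) + D (z + 1) n).
  by apply: ler_sum => b _; rewrite ler_wpM2l ?tilt_ge0.
apply: le_trans (lerD (ler_wpM2l _ le1) (ler_wpM2l _ Um)) _; rewrite ?invr_ge0//.
have sD q c : \sum_b q b = 1 -> \sum_b q b * (W n (y + (z * lam) *: covv j + v b) + c)
    = \sum_b q b * W n (y + (z * lam) *: covv j + v b) + c.
  move=> q1; under eq_bigr do rewrite mulrDr.
  by rewrite big_split/= -mulr_suml q1 mul1r.
rewrite !sD ?tilt_sum1 ?untilt_sum1// tilt_sum untilt_sum /W/=.
by rewrite le_eqVlt; apply/orP; left; apply/eqP; field.
Qed.

(** Taking r to be the square root of n balances [r] and [n / r]; the factor 2 counts the two groups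
    of [E_le_U]. *)
Lemma E_le_W j n : (0 < n)%N ->
  E j n 0 <= 2 * W n 0 + 2 * lam * K * Num.sqrt n%:R.
Proof.
move=> n0; have r0 : 0 < Num.sqrt (n%:R : R) by rewrite sqrtr_gt0 ltr0n.
rewrite -[X in E j n X](addr0 0) (le_trans (E_le_U _ _ _ _))//.
have := @U_le_W j n _ 0 0 r0; rewrite mul0r scale0r addr0 expr0n/= add0r.
rewrite -[X in X / Num.sqrt _](@sqr_sqrtr R n%:R)// expr2 mulfK ?gt_eqF//.
by move: (U _ _ _) (W _ _) => u x; lra.
Qed.

(** Cauchy-Schwarz against the likelihood ratio, in the form 2xy <= t x^2 + y^2 / t. The second
    moment of the ratio is at most [1 + lam ^+ 2 * K] per letter. Keeping [t] free lets the
    induction multiply it by the ratio of the current letter. *)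
Lemma tilt_chi2 j n phi y t : 0 < t -> (forall u, 0 <= phi u) ->
  walk n (tilt j) v phi y <=
  (t * (1 + lam ^+ 2 * K) ^+ n + walk n p v (fun u => phi u ^+ 2) y / t) / 2.
Proof.
move=> t0 phi0; elim: n t t0 y => [|n IH] t t0 y /=.
  rewrite expr0 mulr1 ler_pdivlMr// -(ler_pM2l t0).
  have : phi y ^+ 2 / t * t = phi y ^+ 2 by rewrite mulfVK ?gt_eqF.
  have := sqr_ge0 (t - phi y); move: (phi y ^+ 2 / t) => x; nra.
set rho := 1 + lam ^+ 2 * K; set g := walk n p v _.
have a0 b : 0 < 1 + lam * v b j by have [? _] := tilt_factor b j; lra.
apply: (@le_trans _ _ (\sum_b p b *
    ((t * (1 + lam * v b j) ^+ 2 * rho ^+ n + g (y + v b) / t) / 2))).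
  apply: ler_sum => b _; rewrite /tilt -mulrA ler_wpM2l//.
  rewrite (le_trans (ler_wpM2l (ltW (a0 b)) (IH _ (mulr_gt0 t0 (a0 b)) _)))//.
  rewrite -/rho -/g le_eqVlt; apply/orP; left; apply/eqP.
  by field; rewrite !gt_eqF.
have -> : \sum_b p b * ((t * (1 + lam * v b j) ^+ 2 * rho ^+ n + g (y + v b) / t) / 2) =
   (t * rho ^+ n * (\sum_b p b * (1 + lam * v b j) ^+ 2)
    + (\sum_b p b * g (y + v b)) / t) / 2.
  rewrite [X in (X + _) / 2]mulr_sumr [X in (_ + X) / 2]mulr_suml -big_split mulr_suml/=.
  apply: eq_bigr => b _; field.
  exact: lt0r_neq0.
rewrite ler_pM2r ?invr_gt0// lerD2r exprS [rho * _]mulrC mulrA.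
have rho0 : 0 <= rho ^+ n by rewrite exprn_ge0// addr_ge0// mulr_ge0 ?sqr_ge0// (K_ge0 j).
rewrite ler_wpM2l//; first by rewrite mulr_ge0// ltW.
have -> : \sum_b p b * (1 + lam * v b j) ^+ 2 =
   \sum_b p b + 2 * lam * (\sum_b p b * v b j) + lam ^+ 2 * \sum_b p b * v b j ^+ 2.
  by rewrite !mulr_sumr -!big_split/=; apply: eq_bigr => b _; ring.
by rewrite p_sum1 v_centered mulr0 addr0 lerD2l ler_wpM2l ?sqr_ge0.
Qed.

(** Least squares: up to a term common to all k, the quantity compared measures the distance of the
    data to the drift of the k-th tilt. At the mean of the j-th tilted walk its values at k and j
    differ by [lam * n] times the mean of [(v b j - v b k) ^+ 2]. The strict inequality makes the
    events disjoint. *)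
Let decode n j (y : {ffun 'I_M -> R}) : bool :=
  [forall k, (k != j) ==>
    (lam * n%:R * cov j j - 2 * y j < lam * n%:R * cov k k - 2 * y k)].

Lemma decode_sum_le1 n y : \sum_j (decode n j y)%:R <= 1 :> R.
Proof.
have [/existsP[j dj]|/existsPn nd] := boolP [exists j, decode n j y]; last first.
  by rewrite big1// => j _; rewrite (negbTE (nd j)).
rewrite (bigD1 j)//= dj big1 ?addr0// => k kj.
case: (boolP (decode n k y)) => // dk.
move/forallP/(_ k)/implyP/(_ kj): dj => lt1.
move/forallP/(_ j): dk; rewrite eq_sym kj/= => lt2.
by have := lt_trans lt1 lt2; rewrite ltxx.
Qed.

Lemma fraction_ge1 (X m : R) : 0 < X -> X <= 4 * m -> 1 + - (4 / X) * m <= 0.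
Proof. by move=> X0 le; rewrite mulNr subr_le0 mulrAC ler_pdivlMr// mul1r. Qed.

Lemma fraction_le_half (X e : R) : 0 < X -> 1 - 4 / X * e <= 2^-1 -> X <= 8 * e.
Proof.
move=> X0; rewrite lerBlDl -lerBlDr mulrAC ler_pdivlMr//; lra.
Qed.

(** Put X = lam n tau2. Decoding fails only if the centred walk reaches X / 4, so a failure
    probability of at least 1/2 gives [E] >= X / 8 by Markov's inequality. The loss in [E_le_W] is
    at most X / 16, since 32 K <= sqrt n * tau2; half of what remains is X / 32. *)
Lemma walk_max_ge n tau2 : (0 < n)%N -> (0 < M)%N -> 0 < tau2 ->
  (forall j k, j != k -> tau2 <= \sum_b p b * (v b j - v b k) ^+ 2) ->
  32 * K <= Num.sqrt n%:R * tau2 ->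
  4 * expR (n%:R * lam ^+ 2 * K) <= M%:R ->
  lam * n%:R * tau2 / 32 <= walk n p v (@maxabs R M) 0.
Proof.
move=> n0 M0 tau0 sep Kn Mbig; rewrite leNgt; apply/negP => Wlt.
have r0 : 0 < Num.sqrt (n%:R : R) by rewrite sqrtr_gt0 ltr0n.
have n0' : 0 < n%:R :> R by rewrite ltr0n.
have M0' : 0 < M%:R :> R by rewrite ltr0n.
have lnt : 0 < lam * n%:R * tau2 by rewrite !mulr_gt0.
have : exists j, walk n p v (fun y => (decode n j y)%:R) 0 <= M%:R^-1 :> R.
  apply: contrapT => /forallNP no.
  have : \sum_(j < M) walk n p v (fun y => (decode n j y)%:R) 0 <= 1 :> R.
    rewrite -walk_sum; apply: (@le_trans _ _ (walk n p v (fun u => 1 + 0 * 0) 0)).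
      by apply: walk_le => // u; rewrite mul0r addr0 decode_sum_le1.
    by rewrite (walk_affine v p_sum1 n (fun=> 0) 1 0) mul0r addr0.
  apply/negP; rewrite -ltNge.
  have e1 : \sum_(j < M) M%:R^-1 = 1 :> R.
    by rewrite sumr_const card_ord -[_ *+ M]mulr_natr mulVf ?gt_eqF.
  rewrite -[X in X < _]e1.
  apply: ltr_sum => [|j _]; last by rewrite ltNge; apply/negP/no.
  by apply/hasP; exists (Ordinal M0) => //; rewrite mem_index_enum.
move=> [j dj].
have K0 := K_ge0 j.
set rho := (1 + lam ^+ 2 * K) ^+ n.
have rho1 : 1 <= rho by rewrite exprn_ege1// lerDl mulr_ge0// sqr_ge0.
have rhoM : 4 * rho <= M%:R.
  apply: le_trans Mbig; rewrite ler_pM2l// -mulrA expRM_natl.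
  by rewrite lerXn2r ?nnegrE ?expR_ge0 ?expR_ge1Dx// addr_ge0// mulr_ge0// sqr_ge0.
have up : walk n (tilt j) v (fun y => (decode n j y)%:R) 0 <= 2^-1 :> R.
  (* With this [t] the first term of [tilt_chi2] equals 1/4, and the second is at most rho / M <=
     1/4. *)
  have t0 : 0 < (2 * rho)^-1 by rewrite invr_gt0; lra.
  apply: le_trans (tilt_chi2 j n 0 t0 _) _ => //.
  rewrite -/rho invrK invfM mulfVK; last by rewrite gt_eqF//; lra.
  have : walk n p v (fun u => (decode n j u)%:R ^+ 2) 0 <= M%:R^-1 :> R.
    apply: le_trans dj; apply: walk_le => // u.
    by case: (decode _ _ _); rewrite ?expr1n// expr0n.
  move: (walk _ _ _ _ _) => x xM.
  have : x * (2 * rho) <= M%:R^-1 * (2 * rho) by rewrite ler_wpM2r//; lra.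
  have : M%:R^-1 * (2 * rho) <= 2^-1 by rewrite ler_pdivrMl//; lra.
  lra.
have lo : 1 - 4 / (lam * n%:R * tau2) * E j n 0 <=
    walk n (tilt j) v (fun y => (decode n j y)%:R) 0.
  rewrite (walk_recenter _ _ (lam *: covv j)) -mulNr.
  rewrite -(walk_affine (h j) (tilt_sum1 j) n (@maxabs R M)).
  apply: walk_le => [b|u]; first exact: tilt_ge0.
  case: (boolP (decode _ _ _)) => [_|].
    by rewrite mulNr gerBl mulr_ge0 ?maxabs_ge0// divr_ge0// ltW.
  move=> /forallPn[k]; rewrite negb_imply -leNgt => /andP[kj].
  rewrite -[(lam *: covv j) *+ n]scaler_nat scalerA !ffunE -![_ *: _]/(_ * _).
  have := sep _ _ kj.
  have -> : \sum_b p b * (v b k - v b j) ^+ 2 = cov k k + cov j j - 2 * cov j k.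
    by rewrite /cov mulr_sumr -big_split -sumrB/=; apply: eq_bigr => b _; ring.
  have /ler_normlP[uk1 uk2] := le_maxabs u k; have /ler_normlP[uj1 uj2] := le_maxabs u j.
  move=> sepk dd; apply: fraction_ge1 => //.
  have : lam * n%:R * tau2 <= lam * n%:R * (cov k k + cov j j - 2 * cov j k).
    by rewrite ler_wpM2l// mulr_ge0// ltW.
  move: dd; move: (cov k k) (cov j j) (cov j k) (u k) (u j) uk1 uk2 uj1 uj2 => ckk cjj cjk a b.
  move: (maxabs u) (lam * n%:R * tau2) => m X; lra.
have le2 := E_le_W j n0; have le1 := fraction_le_half lnt (le_trans lo up).
have : 16 * lam * Num.sqrt n%:R * (32 * K) <= 16 * lam * Num.sqrt n%:R * (Num.sqrt n%:R * tau2).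
  by rewrite ler_wpM2l// !mulr_ge0// ltW.
have -> : 16 * lam * Num.sqrt n%:R * (Num.sqrt n%:R * tau2) = 16 * (lam * n%:R * tau2).
  by rewrite -[in RHS](@sqr_sqrtr R n%:R)//; ring.
move: Wlt le1 le2 => {lo up rho rho1 rhoM dj}; rewrite /W; move: (walk _ _ _ _ _) (E _ _ _) (lam * _ * tau2) => x e y *.
lra.
Qed.

End Tilt.

(** * Moments of walks and their expansion over words *)

Section WalkMoments.
Context (R : realType) (V : zmodType) (A : finType) (w : A -> R) (v : A -> V).

Lemma walk_mult n (phi : V -> R) (m : A -> R) y :
  (forall u b, phi (u + v b) = phi u * m b) ->
  walk n w v phi y = phi y * (\sum_b w b * m b) ^+ n.
Proof.
move=> phiD; elim: n y => [|n IH] y /=; first by rewrite expr0 mulr1.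
rewrite exprS mulrA mulr_sumr mulr_suml; apply: eq_bigr => b _.
by rewrite IH phiD; ring.
Qed.

Lemma walk_square n (L : V -> R) y : {morph L : a b / a + b} ->
  \sum_b w b = 1 -> \sum_b w b * L (v b) = 0 ->
  walk n w v (fun u => L u ^+ 2) y = L y ^+ 2 + n%:R * \sum_b w b * L (v b) ^+ 2.
Proof.
move=> LD w1 L0; elim: n y => [|n IH] y /=; first by rewrite mul0r addr0.
have e b : w b * walk n w v (fun u => L u ^+ 2) (y + v b) =
    w b * (L y ^+ 2 + n%:R * \sum_b w b * L (v b) ^+ 2)
    + (w b * L (v b) * (2 * L y) + w b * L (v b) ^+ 2).
  by rewrite IH LD; ring.
under eq_bigr do rewrite e.
rewrite !big_split/= -!mulr_suml w1 L0 -natr1; ring.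
Qed.

Lemma walk_tuple n phi y : walk n w v phi y =
  \sum_(t : n.-tuple A) (\prod_(i < n) w (tnth t i)) * phi (y + \sum_(i < n) v (tnth t i)).
Proof.
elim: n y => [|n IH] y /=.
  rewrite (bigD1 [tuple])//= [X in _ + X]big1 => [|t /negP[]].
    by rewrite !big_ord0 mul1r !addr0.
  by apply/eqP; apply: val_inj; case: t => -[].
under eq_bigr do rewrite IH mulr_sumr.
rewrite pair_bigA/= [RHS](reindex (fun bt : A * n.-tuple A => [tuple of bt.1 :: bt.2]))/=.
  apply: eq_bigr => -[b t] _ /=; rewrite !big_ord_recl !tnth0 mulrA addrA.
  by congr (_ * _ * phi (_ + _)); apply: eq_bigr => i _; rewrite tnthS.
exists (fun t => (thead t, [tuple of behead t])) => [[b t]|t] _ /=.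
  by congr (_, _); apply: val_inj.
by rewrite -tuple_eta.
Qed.

End WalkMoments.

(** * Means and samples *)

Section BoundedMeasurable.
Context d (T : measurableType d) (R : realType).
Implicit Types f g : T -> R.

(** The side condition of all integrals below: stable under the pointwise operations of the proof,
    and sufficient for integrability under any probability. *)
Definition bmf f := measurable_fun setT f /\ exists B, forall x, `|f x| <= B.

Lemma bmf_cst c : bmf (fun=> c).
Proof. by split; [exact: measurable_cst|exists `|c|]. Qed.

Lemma bmfD f g : bmf f -> bmf g -> bmf (fun x => f x + g x).
Proof.
move=> [mf [A fA]] [mg [B gB]]; split; first exact: measurable_funD.
by exists (A + B) => x; rewrite (le_trans (ler_normD _ _))// lerD.
Qed.

Lemma bmfM f g : bmf f -> bmf g -> bmf (fun x => f x * g x).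
Proof.
move=> [mf [A fA]] [mg [B gB]]; split; first exact: measurable_funM.
by exists (A * B) => x; rewrite normrM ler_pM.
Qed.

Lemma bmfZ c f : bmf f -> bmf (fun x => c * f x).
Proof. exact: bmfM (bmf_cst c). Qed.

Lemma bmfN f : bmf f -> bmf (fun x => - f x).
Proof. by move=> /(bmfZ (-1)); congr (bmf _); apply/funext => x; rewrite mulN1r. Qed.

Lemma bmfB f g : bmf f -> bmf g -> bmf (fun x => f x - g x).
Proof. by move=> ? /bmfN; exact: bmfD. Qed.

Lemma bmf_sqr f : bmf f -> bmf (fun x => f x ^+ 2).
Proof. by move=> bf; have := bmfM bf bf. Qed.

Lemma bmf_norm f : bmf f -> bmf (fun x => `|f x|).
Proof.
move=> [mf [B fB]]; split; first exact: measurableT_comp.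
by exists B => x; rewrite normr_id.
Qed.

Lemma bmf_max f g : bmf f -> bmf g -> bmf (fun x => Num.max (f x) (g x)).
Proof.
move=> [mf [A fA]] [mg [B gB]]; split; first exact: measurable_maxr.
exists (Num.max A B) => x; rewrite maxEle; case: ifP => _.
  by rewrite le_max gB orbT.
by rewrite le_max fA.
Qed.

Lemma bmf_min f g : bmf f -> bmf g -> bmf (fun x => Num.min (f x) (g x)).
Proof.
move=> [mf [A fA]] [mg [B gB]]; split; first exact: measurable_minr.
exists (Num.max A B) => x; rewrite minEle; case: ifP => _.
  by rewrite le_max fA.
by rewrite le_max gB orbT.
Qed.

Lemma bmf_bool (b : T -> bool) : measurable_fun setT b -> bmf (fun x => (b x)%:R).
Proof.
move=> mb; split; last by exists 1 => x; case: (b x); rewrite ?normr1 ?normr0.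
apply: (measurableT_comp (T2 := bool) (f := fun c : bool => c%:R : R) _ mb).
by move=> _ Y _.
Qed.

End BoundedMeasurable.

Section Mean.
Context d (T : measurableType d) (R : realType) (P : probability T R).
Implicit Types f g : T -> R.

Lemma bmf_integrable f : bmf f -> P.-integrable setT (EFin \o f).
Proof.
move=> [mf [B fB]]; apply: measurable_bounded_integrable => //.
  exact: le_lt_trans (probability_le1 P measurableT) (ltry _).
exists B; split => [|M BM x _]; first exact: num_real.
by rewrite /= (le_trans (fB x))// ltW.
Qed.

Lemma EFin_mean f : bmf f -> (\int[P]_x (f x)%:E = (\int[P]_x f x)%:E)%E.
Proof.
move=> bf; rewrite /Rintegral fineK//.
exact: integrable_fin_num (bmf_integrable bf).
Qed.

Lemma mean_cst c : \int[P]_x c = c.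
Proof. by rewrite Rintegral_cst// [X in fine X]probability_setT mulr1. Qed.

Lemma meanD f g : bmf f -> bmf g -> \int[P]_x (f x + g x) = \int[P]_x f x + \int[P]_x g x.
Proof. by move=> /bmf_integrable ? /bmf_integrable ?; exact: RintegralD. Qed.

Lemma meanB f g : bmf f -> bmf g -> \int[P]_x (f x - g x) = \int[P]_x f x - \int[P]_x g x.
Proof. by move=> /bmf_integrable ? /bmf_integrable ?; exact: RintegralB. Qed.

Lemma meanZ c f : bmf f -> \int[P]_x (c * f x) = c * \int[P]_x f x.
Proof. by move=> /bmf_integrable ?; exact: RintegralZl. Qed.

Lemma mean_le f g : bmf f -> bmf g -> (forall x, f x <= g x) ->
  \int[P]_x f x <= \int[P]_x g x.
Proof. by move=> /bmf_integrable ? /bmf_integrable ? ?; exact: le_Rintegral. Qed.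

Lemma mean_ge0 f : (forall x, 0 <= f x) -> 0 <= \int[P]_x f x.
Proof. by move=> f0; exact: Rintegral_ge0. Qed.

Lemma mean_norm_le f c : bmf f -> (forall x, `|f x| <= c) -> `|\int[P]_x f x| <= c.
Proof.
move=> bf fc; have bn := bmf_norm bf; apply: le_trans (le_normr_Rintegral _ _) _ => //.
  exact: bmf_integrable.
by rewrite -[leRHS]mean_cst; apply: mean_le => //; exact: bmf_cst.
Qed.

Lemma sqr_mean_le f : bmf f -> (\int[P]_x f x) ^+ 2 <= \int[P]_x f x ^+ 2.
Proof.
move=> bf; set c := \int[P]_x f x.
have : 0 <= \int[P]_x ((f x ^+ 2 - (2 * c) * f x) + c ^+ 2).
  apply: mean_ge0 => x; have := sqr_ge0 (f x - c); nra.
have b1 := bmf_sqr bf; have b2 := bmfZ (2 * c) bf; have b3 := bmf_cst T (c ^+ 2).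
rewrite meanD//; last exact: bmfB.
rewrite meanB// meanZ// mean_cst -/c; lra.
Qed.

End Mean.

Section FiniteMap.
Context d (T : measurableType d) (R : realType) (P : probability T R).
Context (A : finType) (Phi : T -> A).
Hypothesis mPhi : forall a, measurable (Phi @^-1` [set a]).

Definition pmf_of (a : A) : R := fine (P (Phi @^-1` [set a])).

Lemma pmf_ofE a : P (Phi @^-1` [set a]) = (pmf_of a)%:E.
Proof. by rewrite /pmf_of fineK// fin_num_measure. Qed.

Lemma pmf_of_ge0 a : 0 <= pmf_of a.
Proof. by rewrite /pmf_of fine_ge0. Qed.

Lemma finite_map_measurable (g : A -> R) : measurable_fun setT (g \o Phi).
Proof.
move=> _ Y mY; rewrite setTI.
have -> : (g \o Phi) @^-1` Y = \bigcup_(a in [set a | Y (g a)]) (Phi @^-1` [set a]).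
  apply/seteqP; split=> [x Yx|x [a Ya /= ea]]; first by exists (Phi x).
  by rewrite /= ea.
apply: fin_bigcup_measurable => [|a _]; [exact: finite_finset|exact: mPhi].
Qed.

Lemma integral_finite_map (g : A -> R) :
  (\int[P]_x (g (Phi x))%:E = (\sum_a pmf_of a * g a)%:E)%E.
Proof.
have mg := finite_map_measurable g.
transitivity (\int[P]_x (\sum_a (g a)%:E * (\1_(Phi @^-1` [set a]) x)%:E))%E.
  apply: eq_integral => x _; rewrite (bigD1 (Phi x))//= big1 => [|a aP].
    by rewrite adde0 indicE mem_set// mule1.
  rewrite indicE memNset ?mule0// => /= e; by rewrite e eqxx in aP.
rewrite integral_sum//=; last first.
  move=> a; apply: (bmf_integrable P (f := fun x => g a * \1_(Phi @^-1` [set a]) x)).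
  apply: bmfZ; split; first exact: measurable_indic.
  by exists 1 => x; rewrite indicE; case: (_ \in _); rewrite ?normr1 ?normr0.
rewrite -sumEFin; apply: eq_bigr => a _.
rewrite integralZl//; last first.
  apply: (bmf_integrable P (f := \1_(Phi @^-1` [set a]))).
  split; first exact: measurable_indic.
  by exists 1 => x; rewrite indicE; case: (_ \in _); rewrite ?normr1 ?normr0.
by rewrite integral_indic// setIT [X in (_ * X)%E]pmf_ofE -EFinM mulrC.
Qed.

Lemma mean_finite_map (g : A -> R) : \int[P]_x g (Phi x) = \sum_a pmf_of a * g a.
Proof. by rewrite /Rintegral integral_finite_map. Qed.

Lemma sum_pmf_of : \sum_a pmf_of a = 1.
Proof.
have := mean_finite_map (fun=> 1); rewrite mean_cst => ->.
by apply: eq_bigr => a _; rewrite mulr1.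
Qed.

End FiniteMap.

Section Sample.
Context d d' (T : measurableType d) (Omega : measurableType d') (R : realType).
Context (Pr : probability Omega R) (P : probability T R).
Context (n : nat) (X : 'I_n -> {RV Pr >-> T}).
Hypothesis iidX : iid_sample P X.
Context (A : finType) (Phi : T -> A).
Hypothesis mPhi : forall a, measurable (Phi @^-1` [set a]).

Let Psi w : n.-tuple A := [tuple Phi (X i w) | i < n].

Lemma measurable_sample i (B : set T) : measurable B -> measurable (X i @^-1` B).
Proof. by move=> mB; rewrite -[X in measurable X]setTI; exact: measurable_funPT. Qed.

Lemma sample_fiber t :
  Psi @^-1` [set t] = \bigcap_(i in [set` [set: 'I_n]%SET]) (X i @^-1` (Phi @^-1` [set tnth t i])).
Proof.
apply/seteqP; split => [w /= <- i _|w wt]; first by rewrite /= tnth_mktuple.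
by apply/eq_from_tnth => i; rewrite tnth_mktuple; apply: wt; rewrite /= inE.
Qed.

Lemma measurable_sample_fiber t : measurable (Psi @^-1` [set t]).
Proof.
rewrite sample_fiber; apply: fin_bigcap_measurable => [|i _]; first exact: finite_finset.
exact: measurable_sample.
Qed.

Lemma pmf_of_sample t : pmf_of Pr Psi t = \prod_(i < n) pmf_of P Phi (tnth t i).
Proof.
have [distX indX] := iidX.
rewrite /pmf_of sample_fiber [X in fine X]indX// -[RHS]/(fine (_%:E)); congr fine.
rewrite -prodEFin; apply: eq_big => [i|i _]; first by rewrite inE.
by have := distX i _ (mPhi (tnth t i)); rewrite /distribution /= /pushforward => ->; rewrite pmf_ofE.
Qed.

(** The bridge from samples to walks: independence and the common law act on the rest of the proof
    through this identity. *)
Lemma mean_sample (V : zmodType) (v : A -> V) (phi : V -> R) y :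
  \int[Pr]_w phi (y + \sum_(i < n) v (Phi (X i w))) = walk n (pmf_of P Phi) v phi y.
Proof.
rewrite walk_tuple.
under eq_bigr do rewrite -pmf_of_sample.
rewrite -(mean_finite_map _ measurable_sample_fiber).
apply: eq_Rintegral => w _; congr (phi (_ + _)); apply: eq_bigr => i _.
by rewrite tnth_mktuple.
Qed.

End Sample.

(** * Discretization and exponential moments *)

Section Discretize.
Context d (T : measurableType d) (R : realType) (M : nat).
Context (g : 'I_M -> T -> R) (B e : R).
Hypothesis g_meas : forall k, measurable_fun setT (g k).
Hypothesis g_le : forall k x, `|g k x| <= B.
Hypothesis B_ge0 : 0 <= B.
Hypothesis e_gt0 : 0 < e.

Let D := (Num.truncn (2 * B / e)).
Let digit k x := Num.truncn ((g k x + B) / e).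

Definition grid_code x : {ffun 'I_M -> 'I_D.+1} := [ffun k => inord (digit k x)].
Definition grid_val (a : {ffun 'I_M -> 'I_D.+1}) k : R := Num.min (e * (a k)%:R - B) B.

Lemma grid_arg_ge0 k x : 0 <= (g k x + B) / e.
Proof.
have /ler_normlP[? ?] := g_le k x.
by rewrite divr_ge0 ?(ltW e_gt0)//; lra.
Qed.

Lemma digit_lt k x : (digit k x < D.+1)%N.
Proof.
rewrite ltnS; apply: Num.Theory.le_truncn; rewrite ler_pM2r ?invr_gt0//.
by have /ler_normlP[? ?] := g_le k x; lra.
Qed.

Lemma grid_val_near k x : `|grid_val (grid_code x) k - g k x| <= e.
Proof.
rewrite /grid_val /grid_code ffunE inordK ?digit_lt//.
have /andP[lo hi] := Num.Theory.truncn_itv (grid_arg_ge0 k x).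
rewrite -/(digit k x) in lo hi.
move: lo; rewrite ler_pdivlMr// => lo.
move: hi; rewrite ltr_pdivrMr// -natr1 => hi.
have /ler_normlP[? ?] := g_le k x.
rewrite min_l; last by lra.
by rewrite ler_norml; apply/andP; split; lra.
Qed.

Lemma grid_val_le a k : `|grid_val a k| <= B.
Proof.
have ea : 0 <= e * (a k)%:R by rewrite mulr_ge0 ?(ltW e_gt0).
rewrite ler_norml /grid_val ge_min lexx orbT andbT le_min.
by apply/andP; split; [lra|rewrite (le_trans _ B_ge0)// oppr_le0].
Qed.

Lemma measurable_grid_code a : measurable (grid_code @^-1` [set a]).
Proof.
have -> : grid_code @^-1` [set a] =
   \bigcap_(k in [set: 'I_M]) ((fun x => (g k x + B) / e) @^-1` `[(a k)%:R, (a k).+1%:R[).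
  apply/seteqP; split => [x /= <- k _|x xa].
    by rewrite /= in_itv/= /grid_code ffunE inordK ?digit_lt// Num.Theory.truncn_itv// grid_arg_ge0.
  apply/ffunP => k; apply: val_inj; rewrite /= ffunE inordK ?digit_lt//.
  by apply/eqP; rewrite /digit Num.Theory.truncn_eq ?grid_arg_ge0//; have := xa k I; rewrite /= in_itv.
apply: fin_bigcap_measurable => [|k _]; first exact: finite_finset.
rewrite -[X in measurable X]setTI.
apply: (_ : measurable_fun setT (fun x => (g k x + B) / e)) => //.
by apply: measurable_funM => //; apply: measurable_funD.
Qed.

End Discretize.

(** Values are rounded down to a grid of mesh [e]. The bound by [B] is stated for every letter,
    attained or not, because the estimates on walks range over the whole alphabet. *)
Lemma discretize d (T : measurableType d) (R : realType) (M : nat)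
    (g : 'I_M -> T -> R) (B e : R) : (forall k, measurable_fun setT (g k)) ->
  (forall k x, `|g k x| <= B) -> 0 <= B -> 0 < e ->
  exists (A : finType) (Phi : T -> A) (v : A -> 'I_M -> R),
  [/\ forall a, measurable (Phi @^-1` [set a]),
      forall k x, `|v (Phi x) k - g k x| <= e & forall a k, `|v a k| <= B].
Proof.
move=> mg gB B0 e0; exists _, (grid_code g B e), (@grid_val R M B e); split.
- exact: measurable_grid_code.
- exact: grid_val_near.
- exact: grid_val_le.
Qed.

(** Squaring 1 - x/2 <= exp(-x/2) gives exp x <= (1 - x/2)^(-2). Multiplied out, the claim is x^2
    (1/4 - 3x/4 + x^2/4) >= 0, which holds for x <= 1/3. *)
Lemma expR_le_quadratic (R : realType) (x : R) : `|x| <= 3^-1 -> expR x <= 1 + x + x ^+ 2.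
Proof.
move=> /ler_normlP[x1 x2].
have h : 0 < 1 - x / 2 by lra.
have : (1 - x / 2) ^+ 2 <= (expR (- (x / 2))) ^+ 2.
  apply: lerXn2r; rewrite ?nnegrE ?expR_ge0//; [exact: ltW|exact: expR_ge1Dx].
rewrite -expRM_natl (_ : 2%:R * - (x / 2) = - x); last by field.
rewrite expRN => le1.
have {}le1 : expR x <= ((1 - x / 2) ^+ 2)^-1.
  by rewrite -[leLHS]invrK lef_pV2 ?posrE ?invr_gt0 ?expR_gt0 ?exprn_gt0.
apply: le_trans le1 _; rewrite -[leLHS]mul1r ler_pdivrMr ?exprn_gt0//.
have : 0 <= x ^+ 2 * (4^-1 - 3 * x / 4 + x ^+ 2 / 4) by rewrite mulr_ge0 ?sqr_ge0//; nra.
move=> h2; rewrite -subr_ge0; apply: le_trans h2 _.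
by rewrite le_eqVlt; apply/orP; left; apply/eqP; field.
Qed.

Lemma bmf_sum d (T : measurableType d) (R : realType) (I : Type) (r : seq I) (f : I -> T -> R) :
  (forall i, bmf (f i)) -> bmf (fun x => \sum_(i <- r) f i x).
Proof.
move=> bf; elim: r => [|i r IH].
  by under eq_fun do rewrite big_nil; exact: bmf_cst.
by under eq_fun do rewrite big_cons; exact: bmfD.
Qed.

Lemma bmf_expR d (T : measurableType d) (R : realType) (f : T -> R) :
  bmf f -> bmf (fun x => expR (f x)).
Proof.
move=> [mf [B fB]]; split; first exact: measurableT_comp.
exists (expR B) => x; rewrite ger0_norm ?expR_ge0// ler_expR.
exact: le_trans (ler_norm _) (fB x).
Qed.

(** * Exponential moments of the empirical process *)

Section Mgf.
Context d d' (T : measurableType d) (Omega : measurableType d') (R : realType).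
Context (Pr : probability Omega R) (P : probability T R).
Context (n : nat) (X : 'I_n -> {RV Pr >-> T}).
Hypothesis iidX : iid_sample P X.

Lemma bmf_sample (g : T -> R) i : bmf g -> bmf (fun w => g (X i w)).
Proof.
move=> [mg [B gB]]; split; last by exists B.
exact: measurableT_comp.
Qed.

Lemma bmf_centered_sum (g : T -> R) c : bmf g -> bmf (fun w => \sum_(i < n) (g (X i w) - c)).
Proof.
by move=> bg; apply: bmf_sum => i; apply: bmfB; [exact: bmf_sample|exact: bmf_cst].
Qed.

(** Bernstein's bound on the moment generating function, proved for the rounded function. The factor
    2 in the exponent, instead of 1, pays for the rounding. *)
Lemma mgf_le (g : T -> R) (b s2 theta : R) : measurable_fun setT g ->
  (forall x, `|g x| <= b) -> 0 < s2 -> \int[P]_x g x ^+ 2 <= s2 ->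
  theta != 0 -> `|theta| * (2 * b) <= 3^-1 ->
  \int[Pr]_w expR (theta * \sum_(i < n) (g (X i w) - \int[P]_x g x))
    <= expR (2 * (n%:R * theta ^+ 2 * s2)).
Proof.
move=> mg gb s0 gs th0 thb; have bg : bmf g by split => //; exists b.
set t := `|theta| in thb *; have t0 : 0 < t by rewrite normr_gt0.
have b0 : 0 <= b.
  have [x _] : [set: T] !=set0.
    apply/set0P/negP => /eqP T0; have := probability_setT P.
    by rewrite T0 measure0 => /esym/eqP; rewrite onee_eq0.
  exact: le_trans (gb x).
(* Rounding adds [2 * t * e + t ^+ 2 * (2 * b + 1) * e] to the exponent for each observation; the
   second entry of the minimum keeps this below [t ^+ 2 * s2]. *)
pose e := Num.min 1 (t * s2 / (2 + t * (2 * b + 1))).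
have den0 : 0 < 2 + t * (2 * b + 1) by rewrite addr_gt0// mulr_gt0//; lra.
have e0 : 0 < e by rewrite lt_min ltr01/= divr_gt0// mulr_gt0.
have e1 : e <= 1 by rewrite ge_min lexx.
have e2 : e * (2 + t * (2 * b + 1)) <= t * s2 by rewrite -ler_pdivlMr// ge_min lexx orbT.
have [A [Phi [v [mPhi vg vb]]]] :=
  @discretize _ _ R 1 (fun=> g) b e (fun=> mg) (fun=> gb) b0 e0.
pose p := pmf_of P Phi.
have [m' m'def] : exists m', m' = \sum_a p a * v a ord0 by eexists.
have p0 a : 0 <= p a by exact: pmf_of_ge0.
have p1 : \sum_a p a = 1 by exact: sum_pmf_of.
have bv (h : A -> R) : bmf (fun x => h (Phi x)).
  split; first exact: finite_map_measurable.
  exists (\sum_a `|h a|) => x; rewrite (bigD1 (Phi x))//= lerDl.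
  by apply: sumr_ge0.
have m'E : m' = \int[P]_x v (Phi x) ord0 by rewrite m'def (mean_finite_map P mPhi (fun a => v a ord0)).
have mm : `|\int[P]_x g x - m'| <= e.
  rewrite m'E -meanB//; last exact: (bv (fun a => v a ord0)).
  apply: mean_norm_le => [|x]; first exact: bmfB (bv (fun a => v a ord0)).
  by rewrite distrC vg.
set c := n%:R * (2 * t * e).
have step1 w : theta * \sum_(i < n) (g (X i w) - \int[P]_x g x) <=
    theta * (0 + \sum_(i < n) (v (Phi (X i w)) ord0 - m')) + c.
  rewrite add0r -lerBlDl -mulrBr -sumrB; apply: le_trans (ler_norm _) _.
  rewrite normrM -/t (_ : c = t * (n%:R * (2 * e))); last by rewrite /c; ring.
  rewrite ler_wpM2l ?(ltW t0)// (le_trans (ler_norm_sum _ _ _))//.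
  apply: (@le_trans _ _ (\sum_(i < n) 2 * e)); last by rewrite sumr_const card_ord -[_ *+ n]mulr_natl.
  apply: ler_sum => i _; have := vg ord0 (X i w); move: mm; rewrite !ler_norml.
  by move=> /andP[? ?] /andP[? ?]; apply/andP; split; lra.
apply: (@le_trans _ _ (\int[Pr]_w expR (theta * (0 + \sum_(i < n) (v (Phi (X i w)) ord0 - m')) + c))).
  apply: mean_le => [||w]; last by rewrite ler_expR.
    by apply/bmf_expR/bmfZ/bmf_centered_sum.
  apply/bmf_expR/bmfD; last exact: bmf_cst.
  apply/bmfZ; under eq_fun do rewrite add0r.
  exact: (bmf_centered_sum m' (bv (fun a => v a ord0))).
rewrite (mean_sample iidX mPhi (fun a => v a ord0 - m') (fun u => expR (theta * u + c))).
rewrite (@walk_mult _ _ _ _ _ _ _ (fun a => expR (theta * (v a ord0 - m')))); last first.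
  by move=> u a; rewrite -expRD; congr expR; ring.
rewrite mulr0 add0r -/p.
have var : \sum_a p a * expR (theta * (v a ord0 - m')) <= expR (theta ^+ 2 * (s2 + (2 * b + 1) * e)).
  apply: (@le_trans _ _ (\sum_a p a * (1 + theta * (v a ord0 - m') + (theta * (v a ord0 - m')) ^+ 2))).
    apply: ler_sum => a _; apply: ler_wpM2l => //; apply: expR_le_quadratic.
    rewrite normrM -/t; apply: le_trans thb; rewrite ler_wpM2l ?(ltW t0)//.
    apply: le_trans (ler_normB _ _) _; rewrite mulr2n mulrDl mul1r lerD ?vb//.
    rewrite m'def; apply: le_trans (ler_norm_sum _ _ _) _.
    rewrite -[leRHS]mul1r -p1 mulr_suml; apply: ler_sum => a' _.
    by rewrite normrM ger0_norm// ler_wpM2l.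
  have -> : \sum_a p a * (1 + theta * (v a ord0 - m') + (theta * (v a ord0 - m')) ^+ 2)
     = \sum_a p a + (theta - 2 * theta ^+ 2 * m') * (\sum_a p a * v a ord0) + (theta ^+ 2 * m' ^+ 2 - theta * m') * (\sum_a p a)
       + theta ^+ 2 * \sum_a p a * v a ord0 ^+ 2.
    by rewrite !mulr_sumr -!big_split/=; apply: eq_bigr => a _; ring.
  rewrite p1 -m'def.
  have v2 : \sum_a p a * v a ord0 ^+ 2 <= s2 + (2 * b + 1) * e.
    rewrite -(mean_finite_map P mPhi (fun a => v a ord0 ^+ 2)).
    apply: (@le_trans _ _ (\int[P]_x (g x ^+ 2 + (2 * b + 1) * e))).
      apply: mean_le => [||x]; first exact: (bv (fun a => v a ord0 ^+ 2)).
        by apply: bmfD; [exact: bmf_sqr|exact: bmf_cst].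
      rewrite -lerBlDl subr_sqr (le_trans (ler_norm _))// normrM.
      have gv : `|v (Phi x) ord0 + g x| <= 2 * b.
        by rewrite (le_trans (ler_normD _ _))// mulr2n mulrDl mul1r lerD.
      apply: le_trans (ler_pM _ _ (vg ord0 x) gv) _ => //; lra.
    by rewrite meanD ?mean_cst ?lerD2r//; [exact: bmf_sqr|exact: bmf_cst].
  apply: le_trans (expR_ge1Dx _).
  have := ler_wpM2l (sqr_ge0 theta) v2; have := sqr_ge0 (theta * m'); lra.
apply: (@le_trans _ _ (expR c * expR (theta ^+ 2 * (s2 + (2 * b + 1) * e)) ^+ n)).
  rewrite ler_wpM2l ?expR_ge0// lerXn2r ?nnegrE ?expR_ge0//.
  by apply: sumr_ge0 => a _; rewrite mulr_ge0 ?expR_ge0.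
rewrite -expRM_natl -expRD ler_expR /c -mulrDr.
rewrite (_ : 2 * (n%:R * theta ^+ 2 * s2) = n%:R * (2 * (theta ^+ 2 * s2))); last by ring.
rewrite ler_wpM2l//.
rewrite -(real_normK (num_real theta)) -/t.
have := ler_wpM2l (ltW t0) e2; lra.
Qed.

End Mgf.

(** * Finite classes *)

Section Process.
Context d d' (T : measurableType d) (Omega : measurableType d') (R : realType).
Context (Pr : probability Omega R) (P : probability T R).
Context (n : nat) (X : 'I_n -> {RV Pr >-> T}).
Hypothesis iidX : iid_sample P X.
Hypothesis n_gt0 : (0 < n)%N.

Let sn : R := Num.sqrt n%:R.
Let G (f : T -> R) w := empirical_process P X f w.

Lemma sn_gt0 : 0 < sn.
Proof. by rewrite sqrtr_gt0 ltr0n. Qed.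

Lemma sn2 : sn * sn = n%:R.
Proof. by rewrite -expr2 sqr_sqrtr. Qed.

(** The usual log-sum-exp bound on a finite maximum, with the logarithm replaced by its tangent at
    [expR L]: y <= L - 1 + exp(y - L). The majorant is then affine in the sum [V] of exponentials,
    and only the mean of [V] is needed. The factor 2 in front of the cardinality counts the two
    signs. *)
Lemma finite_majorant (I : finType) (g : I -> T -> R) (b s H : R) :
  (forall i, measurable_fun setT (g i)) -> (forall i x, `|g i x| <= b) ->
  0 < b -> 0 < s -> (forall i, \int[P]_x g i x ^+ 2 <= s ^+ 2) ->
  1 <= H -> 2 * #|I|%:R <= expR H ->
  exists U : Omega -> R, [/\ bmf U, forall w, 0 <= U w,
    forall i w, `|G (g i) w| <= U w &
    \int[Pr]_w U w <= 6 * b * H / sn + 3 * s * Num.sqrt H].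
Proof.
move=> mg gb b0 s0 gs H1 IH.
have bg i : bmf (g i) by split => //; exists b.
have sn0 := sn_gt0; have H0 : 0 < H by lra.
set r := Num.sqrt H; have r0 : 0 < r by rewrite sqrtr_gt0.
have rr : r * r = H by rewrite -expr2 sqr_sqrtr ?ltW.
(* The first entry keeps [th * (2 * b)] within the range 1/3 of [mgf_le]; the second is the optimal
   parameter for the Gaussian part. *)
pose th := Num.min (6 * b)^-1 (r / (sn * s)).
have th0 : 0 < th by rewrite lt_min invr_gt0 divr_gt0 ?mulr_gt0.
pose S i w := \sum_(j < n) (g i (X j w) - \int[P]_x g i x).
have bS i : bmf (S i) by exact: bmf_centered_sum.
pose L := H + 2 * (n%:R * th ^+ 2 * s ^+ 2).
have L1 : 1 <= L by rewrite /L (le_trans H1)// lerDl mulr_ge0// mulr_ge0 ?sqr_ge0// mulr_ge0 ?sqr_ge0.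
pose V w := \sum_i (expR (th * S i w) + expR ((- th) * S i w)).
have bV : bmf V.
  by apply: bmf_sum => i; apply: bmfD; apply/bmf_expR/bmfZ.
have V0 w : 0 <= V w by apply: sumr_ge0 => i _; rewrite addr_ge0 ?expR_ge0.
have c0 : 0 < (expR L)^-1 by rewrite invr_gt0 expR_gt0.
have a0 : 0 < (th * sn)^-1 by rewrite invr_gt0 mulr_gt0.
exists (fun w => (th * sn)^-1 * ((L - 1) + (expR L)^-1 * V w)); split.
- by apply/bmfZ/bmfD; [exact: bmf_cst|exact: bmfZ].
- by move=> w; rewrite mulr_ge0 ?(ltW a0)// addr_ge0 ?subr_ge0// mulr_ge0 ?(ltW c0).
- move=> i w; rewrite /G /empirical_process -/sn -/(S i w) normrM gtr0_norm ?invr_gt0//.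
  rewrite invfM -[leRHS]mulrA [leRHS]mulrCA ler_wpM2l ?invr_ge0 ?(ltW sn0)//.
  rewrite ler_pdivlMl//.
  have : expR (th * `|S i w|) <= V w.
    rewrite /V (bigD1 i)//= -[leLHS]addr0; apply: lerD; last first.
      by apply: sumr_ge0 => j _; rewrite addr_ge0 ?expR_ge0.
    by case: (ger0P (S i w)) => _; rewrite ?lerDl ?expR_ge0// mulrN -mulNr lerDr expR_ge0.
  move=> eV; have := expR_ge1Dx (th * `|S i w| - L); rewrite expRD expRN.
  have : expR (th * `|S i w|) * (expR L)^-1 <= (expR L)^-1 * V w.
    by rewrite mulrC ler_wpM2l// ltW.
  by move: (expR _ * _) (_ * V w) => x y; lra.
have mgfU : \int[Pr]_w V w <= expR L.
  have -> : \int[Pr]_w V w = \sum_i (\int[Pr]_w expR (th * S i w) + \int[Pr]_w expR (- th * S i w)).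
    rewrite /V; elim: (index_enum I) => [|i l IHl].
      by under eq_Rintegral do rewrite big_nil; rewrite mean_cst big_nil.
    under eq_Rintegral do rewrite big_cons.
    rewrite big_cons -IHl meanD//.
    + by rewrite meanD//; apply/bmf_expR/bmfZ.
    + by apply: bmfD; apply/bmf_expR/bmfZ.
    + by apply: bmf_sum => j; apply: bmfD; apply/bmf_expR/bmfZ.
  apply: (@le_trans _ _ (\sum_(i in I) 2 * expR (2 * (n%:R * th ^+ 2 * s ^+ 2)))).
    apply: ler_sum => i _; rewrite mulr2n mulrDl mul1r.
    have thb : `|th| * (2 * b) <= 3^-1.
      rewrite gtr0_norm//; have : th <= (6 * b)^-1 by rewrite ge_min lexx.
      move/(ler_wpM2r (ltW b0)); rewrite invfM mulfVK ?gt_eqF//; lra.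
    have s20 : 0 < s ^+ 2 by rewrite exprn_gt0.
    apply: lerD; first by apply: (mgf_le iidX (b := b)); rewrite ?gt_eqF.
    rewrite -[th ^+ 2]sqrrN.
    by apply: (mgf_le iidX (b := b)); rewrite ?oppr_eq0 ?gt_eqF ?normrN.
  rewrite sumr_const -[_ *+ #|I|]mulr_natl mulrA [_ * 2]mulrC /L expRD.
  by rewrite ler_wpM2r ?expR_ge0.
rewrite meanZ; last by apply: bmfD; [exact: bmf_cst|exact: bmfZ].
rewrite meanD ?mean_cst ?meanZ//; [|exact: bmf_cst|exact: bmfZ].
apply: (@le_trans _ _ ((th * sn)^-1 * L)).
  rewrite ler_wpM2l ?(ltW a0)//.
  have : (expR L)^-1 * \int[Pr]_w V w <= 1 by rewrite ler_pdivrMl ?expR_gt0// mulr1.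
  lra.
rewrite /L mulrDr.
have -> : (th * sn)^-1 * (2 * (n%:R * th ^+ 2 * s ^+ 2)) = 2 * sn * s ^+ 2 * th.
  by rewrite -sn2; field; rewrite !gt_eqF.
have t1 : 2 * sn * s ^+ 2 * th <= 2 * s * r.
  have : th <= r / (sn * s) by rewrite ge_min lexx orbT.
  rewrite ler_pdivlMr ?mulr_gt0// => le1.
  have := ler_wpM2l (ltW s0) le1; lra.
have t2 : (th * sn)^-1 * H <= 6 * b * H / sn + s * r.
  have ti : th^-1 <= 6 * b + sn * s / r.
    rewrite /th minEle; case: ifP => _; first by rewrite invrK lerDl divr_ge0 ?mulr_ge0 ?ltW.
    by rewrite invf_div lerDr mulr_ge0// ltW.
  have HH : 0 <= H / sn by rewrite divr_ge0// ltW.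
  have -> : (th * sn)^-1 * H = th^-1 * (H / sn) by field; rewrite !gt_eqF.
  rewrite (le_trans (ler_wpM2r HH ti))//.
  by rewrite le_eqVlt; apply/orP; left; apply/eqP; rewrite -rr; field; rewrite !gt_eqF.
lra.
Qed.

End Process.

(** * Chaining with bracketing *)

Section Chaining.
Context d d' (T : measurableType d) (Omega : measurableType d') (R : realType).
Context (Pr : probability Omega R) (P : probability T R).
Context (n : nat) (X : 'I_n -> {RV Pr >-> T}).
Hypothesis iidX : iid_sample P X.
Hypothesis n_gt0 : (0 < n)%N.

Let sn : R := Num.sqrt n%:R.
Let G (f : T -> R) w := empirical_process P X f w.

Let sn_gt0 : 0 < sn := sn_gt0 R n_gt0.

Lemma empirical_processD f g w : bmf f -> bmf g ->
  G (fun x => f x + g x) w = G f w + G g w.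
Proof.
move=> bf bg; rewrite /G /empirical_process -mulrDr -big_split/=; congr (_ * _).
by apply: eq_bigr => i _; rewrite meanD//; ring.
Qed.

(** A function [h] outside any finite family is controlled through a dominating [D] inside one: sums
    are monotone, and passing between the centrings costs at most the mean of [D]. *)
Lemma empirical_process_dominated h D w : bmf h -> bmf D ->
  (forall x, 0 <= h x <= D x) -> `|G h w| <= `|G D w| + sn * \int[P]_x D x.
Proof.
move=> bh bD hD; set m := \int[P]_x D x.
have hm : 0 <= \int[P]_x h x <= m.
  rewrite mean_ge0 => [|x]; last by have /andP[] := hD x.
  by apply: mean_le => // x; have /andP[] := hD x.
have m0 : 0 <= sn^-1 * (\sum_(i < n) m) = true /\ sn^-1 * (\sum_(i < n) m) = sn * m.
  rewrite sumr_const card_ord -[_ *+ n]mulr_natl -(@sn2 R n) -/sn; split; last first.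
    by field; rewrite gt_eqF.
  case/andP: hm => h0 hm; rewrite mulr_ge0 ?invr_ge0 ?(ltW sn_gt0)//.
  by rewrite !mulr_ge0 ?(ltW sn_gt0)// (le_trans h0).
have up : G h w <= G D w + sn * m.
  rewrite -m0.2 /G /empirical_process -/sn -mulrDr ler_wpM2l ?invr_ge0 ?(ltW sn_gt0)//.
  rewrite -big_split/=; apply: ler_sum => i _; have := hD (X i w).
  by move: hm => /andP[? ?] /andP[? ?]; rewrite -/m; lra.
have lo : - (sn * m) <= G h w.
  rewrite -m0.2 -mulrN -sumrN /G /empirical_process -/sn ler_wpM2l ?invr_ge0 ?(ltW sn_gt0)//.
  apply: ler_sum => i _; have := hD (X i w).
  by move: hm => /andP[? ?] /andP[? ?]; lra.
have := ler_norm (G D w); have := normr_ge0 (G D w); rewrite ler_norml; lra.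
Qed.

Lemma expected_sup_le F (U : Omega -> R) B : bmf U -> (forall w, 0 <= U w) ->
  (forall f, F f -> forall w, `|G f w| <= U w) -> \int[Pr]_w U w <= B ->
  (expected_sup P X F <= B%:E)%E.
Proof.
move=> bU U0 FU UB; apply: (@le_trans _ _ (\int[Pr]_w (U w)%:E)%E); last first.
  by rewrite (EFin_mean Pr bU) lee_fin.
apply: ereal_inf_lbound; exists (EFin \o U) => //; split => [|w|w].
- by apply/measurable_EFinP; case: bU.
- by rewrite lee_fin.
- by apply: ge_ereal_sup => _ [f Ff <-]; rewrite lee_fin FU.
Qed.

(* [eps] and [t] bound the L2 and L1 sizes of the brackets [l, l + D], and [h]
   the logarithm of their number. *)
Definition bracketed (F : set (T -> R)) (eps t h : R) :=
  exists (N : nat) (l D : 'I_N -> T -> R),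
  [/\ forall i, [/\ bmf (l i), bmf (D i) & forall x, 0 <= D i x <= 2],
      forall i, \int[P]_x D i x ^+ 2 <= eps ^+ 2 /\ \int[P]_x D i x <= t,
      forall f, F f -> exists i, forall x, 0 <= f x - l i x <= D i x &
      N%:R <= expR h].

Context (F : set (T -> R)) (eps t h H : nat -> R).
Hypothesis F_meas : forall f, F f -> measurable_fun setT f.
Hypothesis F_le1 : forall f, F f -> forall x, `|f x| <= 1.
Hypothesis F_sq : forall f, F f -> \int[P]_x f x ^+ 2 <= eps 0%N ^+ 2.
Hypothesis eps_gt0 : forall k, 0 < eps k.
Hypothesis t_ge0 : forall k, 0 <= t k.
Hypothesis epsS_le : forall k, eps k.+1 <= eps k.
Hypothesis F_bracketed : forall k, bracketed F (eps k) (t k) (h k).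
Hypothesis H_ge : forall k, 1 + \sum_(j < k.+1) h j <= H k.
Hypothesis H_ge1 : forall k, 1 <= H k.
Hypothesis H_le : forall k, H k <= H k.+1.

Let r k := Num.sqrt (H k).
(** The entropy of the next level appears because the links leaving level k are indexed by brackets
    of levels k and k + 1 together: [a k * H k.+1 / sn] equals [eps k * r k.+1]. *)
Let a k := sn * eps k / r k.+1.

Lemma r_gt0 k : 0 < r k.
Proof. by rewrite sqrtr_gt0 (lt_le_trans ltr01). Qed.

Lemma r2 k : H k = r k * r k.
Proof. by rewrite -expr2 sqr_sqrtr// (le_trans ler01). Qed.

Lemma r_le k : r k <= r k.+1.
Proof. by rewrite ler_sqrt// (le_trans ler01). Qed.

Lemma a_gt0 k : 0 < a k.
Proof. by rewrite !mulr_gt0 ?invr_gt0 ?r_gt0. Qed.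

Lemma bmf_class f : F f -> bmf f.
Proof. by move=> Ff; split; [exact: F_meas|exists 1; exact: F_le1]. Qed.

(* [l] and [D] are the lower end and the width of an intersection of brackets of
   levels up to [k]; [b] marks the points where no width exceeded its threshold. *)
Record chain_state (k : nat) (l D : T -> R) (b : T -> bool) : Prop := ChainState {
  st_l : bmf l;
  st_D : bmf D;
  st_D_itv : forall x, 0 <= D x <= 2;
  st_b : measurable_fun setT b;
  st_bD : forall x, b x -> D x <= a k;
  st_D_sq : \int[P]_x D x ^+ 2 <= eps k ^+ 2;
  st_D_t : \int[P]_x D x <= t k }.

(** At level 0 the lower ends give 18 and 6, the cut part 12 and 3, and its mean 1: hence 30 and 10.
    Passing to the next level costs 9 for the links and 6 + 3 for the cut part, in units of
    [eps k * r k.+1]; with the 10 already charged to level k this makes 28. *)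
Definition chain_bound k : R :=
  30 * H 0%N / sn + 28 * \sum_(j < k) eps j * r j.+1 + 10 * (eps k * r k.+1).

(** What is controlled is f minus its unresolved remainder [(f - l i) * b i], which lives where all
    widths so far stayed below their thresholds. *)
Definition chained k := exists (I : finType) (l D : I -> T -> R) (b : I -> T -> bool)
    (U : Omega -> R),
  [/\ forall i, chain_state k (l i) (D i) (b i),
      #|I|%:R <= expR (\sum_(j < k.+1) h j),
      bmf U /\ (forall w, 0 <= U w),
      \int[Pr]_w U w <= chain_bound k &
      forall f, F f -> exists i, (forall x, 0 <= f x - l i x <= D i x) /\
        forall w, `|G (fun x => f x - (f x - l i x) * (b i x)%:R) w| <= U w].

Lemma card_entropy (I : finType) k : #|I|%:R <= expR (\sum_(j < k.+1) h j) ->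
  2 * #|I|%:R <= expR (H k).
Proof.
move=> Ik; have e2 : 2 <= expR 1 :> R by have := expR_ge1Dx (1 : R); lra.
apply: (@le_trans _ _ (expR (1 + \sum_(j < k.+1) h j))); last by rewrite ler_expR.
by rewrite expRD ler_pM.
Qed.

(* Chebyshev on the set where the bracket is too wide to be kept. *)
Lemma mean_cut (D : T -> R) (b b' : T -> bool) k : bmf D -> measurable_fun setT b ->
  measurable_fun setT b' -> (forall x, 0 <= D x) ->
  \int[P]_x D x ^+ 2 <= eps k ^+ 2 -> (forall x, b x -> ~~ b' x -> a k <= D x) ->
  sn * \int[P]_x (D x * (b x && ~~ b' x)%:R) <= eps k * r k.+1.
Proof.
move=> bD mb mb' D0 Dsq cut.
have a0 := a_gt0 k.
have bc : bmf (fun x => (b x && ~~ b' x)%:R : R).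
  apply: bmf_bool; apply: measurable_and => //; exact: measurableT_comp mb'.
have le1 : \int[P]_x (D x * (b x && ~~ b' x)%:R) <= (a k)^-1 * eps k ^+ 2.
  apply: (@le_trans _ _ (\int[P]_x ((a k)^-1 * D x ^+ 2))).
    apply: mean_le => [||x]; [exact: bmfM|exact/bmfZ/bmf_sqr|].
    case: (boolP (b x)) => [bx|_]; last by rewrite mulr0 mulr_ge0 ?sqr_ge0// invr_ge0 ltW.
    case: (boolP (b' x)) => [_|b'x]; first by rewrite mulr0 mulr_ge0 ?sqr_ge0// invr_ge0 ltW.
    by rewrite mulr1 ler_pdivlMl// expr2 ler_wpM2r// cut.
  by rewrite meanZ ?ler_wpM2l ?invr_ge0 ?(ltW a0)//; exact: bmf_sqr.
apply: le_trans (ler_wpM2l (ltW sn_gt0) le1) _; rewrite le_eqVlt; apply/orP; left; apply/eqP.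
rewrite /a; field; rewrite !gt_eqF ?r_gt0//.
Qed.

Lemma measurable_negb (b : T -> bool) : measurable_fun setT b ->
  measurable_fun setT (fun x => ~~ b x).
Proof. exact: measurableT_comp. Qed.

Lemma majorant_level (I : finType) (g : I -> T -> R) (c s : R) k :
  (forall i, bmf (g i)) -> (forall i x, `|g i x| <= c) -> 0 < c -> 0 < s ->
  (forall i, \int[P]_x g i x ^+ 2 <= s ^+ 2) ->
  #|I|%:R <= expR (\sum_(j < k.+1) h j) ->
  exists U : Omega -> R, [/\ bmf U, forall w, 0 <= U w,
    forall i w, `|G (g i) w| <= U w &
    \int[Pr]_w U w <= 6 * c * H k / sn + 3 * s * r k].
Proof.
move=> bg gc c0 s0 gs Ik; apply: (finite_majorant iidX n_gt0) => //.
  by move=> i; case: (bg i).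
exact: card_entropy.
Qed.

Lemma chained0 : chained 0%N.
Proof.
have [N [l0 [D [lD Dsize FlD Nh]]]] := F_bracketed 0%N.
pose ne i := `[< exists2 f, F f & forall x, 0 <= f x - l0 i x <= D i x >].
(* The lower end of a bracket containing no member of the class has no useful bound; it is replaced
   by 0 so that the next estimates hold for every index. *)
pose l i x := if ne i then l0 i x else 0.
pose b i x := D i x <= a 0%N.
have card0 : #|'I_N|%:R <= expR (\sum_(j < 1) h j) by rewrite card_ord big_ord1.
have bl i : bmf (l i).
  rewrite /l; case: (ne i); last exact: bmf_cst.
  by have [] := lD i.
have bD i : bmf (D i) by have [] := lD i.
have D0 i x : 0 <= D i x by have [_ _ /(_ x)/andP[]] := lD i.
have D2 i x : D i x <= 2 by have [_ _ /(_ x)/andP[]] := lD i.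
have mb i : measurable_fun setT (b i).
  by apply: measurable_fun_ler; [case: (bD i)|exact: measurable_cst].
have e0 := eps_gt0 0%N.
(* Write l as f - (f - l) with a member f of the bracket: l^2 <= 2 f^2 + 2 D^2 and |l| <= 1 + 2. *)
have lsq i : \int[P]_x l i x ^+ 2 <= (2 * eps 0%N) ^+ 2.
  rewrite /l; case: (boolP (ne i)) => [/asboolP[f Ff fl]|_]; last first.
    by rewrite expr0n/= mean_cst sqr_ge0.
  have bf := bmf_class Ff; have [bl0 _ _] := lD i.
  apply: (@le_trans _ _ (\int[P]_x (2 * f x ^+ 2 + 2 * D i x ^+ 2))).
    apply: mean_le => [||x]; [exact: bmf_sqr|apply: bmfD; exact/bmfZ/bmf_sqr|].
    have /andP[r0 rD] := fl x.
    have : (f x - l0 i x) ^+ 2 <= D i x ^+ 2 by rewrite lerXn2r ?nnegrE.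
    have := sqr_ge0 (f x + (f x - l0 i x)); move: (D i x ^+ 2) => y; lra.
  rewrite meanD ?meanZ; try exact/bmf_sqr; try exact/bmfZ/bmf_sqr.
  have := F_sq Ff; have := (Dsize i).1; rewrite exprMn; lra.
have l3 i x : `|l i x| <= 3.
  rewrite /l; case: (boolP (ne i)) => [/asboolP[f Ff fl]|_]; last by rewrite normr0.
  have := F_le1 Ff x; have := D2 i x; move: (fl x) => /andP[? ?].
  by rewrite !ler_norml => ? /andP[? ?]; apply/andP; split; lra.
have [U1 [bU1 U10 lU1 EU1]] := majorant_level bl l3 (ltr0n _ 3) (mulr_gt0 (ltr0n _ 2) e0) lsq card0.
pose g i x := D i x * (true && ~~ b i x)%:R.
have bg i : bmf (g i) by apply: bmfM => //; apply/bmf_bool/measurable_negb.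
have g2 i x : `|g i x| <= 2.
  rewrite /g ger0_norm ?mulr_ge0//.
  by case: (~~ b i x); rewrite ?mulr1 ?mulr0.
have gsq i : \int[P]_x g i x ^+ 2 <= eps 0%N ^+ 2.
  apply: le_trans (Dsize i).1; apply: mean_le => [||x]; try exact: bmf_sqr.
  by rewrite /g; case: (~~ b i x); rewrite ?mulr1// mulr0 expr0n/= sqr_ge0.
have [U2 [bU2 U20 gU2 EU2]] := majorant_level bg g2 (ltr0n _ 2) e0 gsq card0.
pose c := eps 0%N * r 1.
have c0 : 0 <= c by rewrite mulr_ge0// ltW// r_gt0.
exists 'I_N, l, D, b, (fun w => U1 w + U2 w + c); split => //.
- by move=> i; split => //; [move=> x; rewrite D0 D2|have [] := Dsize i|have [] := Dsize i].
- split; first by apply: bmfD; [exact: bmfD|exact: bmf_cst].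
  by move=> w; rewrite !addr_ge0.
- rewrite meanD ?meanD ?mean_cst//; [|exact: bmfD|exact: bmf_cst].
  rewrite /chain_bound big_ord0 mulr0 addr0 -/c.
  have : eps 0%N * r 0%N <= c by rewrite ler_wpM2l ?r_le// ltW.
  have : 0 < H 0%N / sn by rewrite divr_gt0// (lt_le_trans ltr01).
  move: EU1 EU2; rewrite -!mulrA; move: (H 0%N / sn) => z; rewrite -/sn; lra.
- move=> f Ff; have [i fi] := FlD f Ff; exists i.
  have nei : ne i by apply/asboolP; exists f.
  have fli x : 0 <= f x - l i x <= D i x by rewrite /l nei.
  split => // w.
  have bf := bmf_class Ff.
  have br : bmf (fun x => (f x - l i x) * (true && ~~ b i x)%:R).
    by apply: bmfM; [exact: bmfB|exact/bmf_bool/measurable_negb].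
  have -> : (fun x => f x - (f x - l i x) * (b i x)%:R) =
      (fun x => l i x + (f x - l i x) * (true && ~~ b i x)%:R).
    by apply/funext => x; case: (b i x) => /=; ring.
  rewrite empirical_processD// -addrA (le_trans (ler_normD _ _))// lerD//.
  have dom x : 0 <= (f x - l i x) * (true && ~~ b i x)%:R <= g i x.
    have /andP[r0 rD] := fli x.
    by rewrite /g mulr_ge0//= ler_wpM2r.
  apply: le_trans (empirical_process_dominated w br (bg i) dom) _.
  apply: lerD => //; apply: (@mean_cut (D i) (fun=> true) (b i) 0%N) => //.
    by have [] := Dsize i.
  by move=> x _; rewrite -ltNge => /ltW.
Qed.

Lemma chainedS k : chained k -> chained k.+1.
Proof.
move=> [I [l [D [b [U [st cardI [bU U0] EU FU]]]]]].
have [N [l' [D' [lD' Dsize' FlD' Nh]]]] := F_bracketed k.+1.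
pose J := (I * 'I_N)%type.
have cardJ : #|{: J}|%:R <= expR (\sum_(j < k.+2) h j).
  by rewrite card_prod card_ord natrM big_ord_recr/= expRD ler_pM.
pose lm (j : J) x := Num.max (l j.1 x) (l' j.2 x).
pose Dm (j : J) x := Num.min (D j.1 x) (D' j.2 x).
pose bm (j : J) x := b j.1 x && (Dm j x <= a k.+1).
have bl i := st_l (st i); have bD i := st_D (st i).
have bl' i : bmf (l' i) by have [] := lD' i.
have bD' i : bmf (D' i) by have [] := lD' i.
have D0 i x : 0 <= D i x by have /andP[] := st_D_itv (st i) x.
have D2 i x : D i x <= 2 by have /andP[] := st_D_itv (st i) x.
have D0' i x : 0 <= D' i x by have [_ _ /(_ x)/andP[]] := lD' i.
have blm j : bmf (lm j) by exact: bmf_max.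
have bDm j : bmf (Dm j) by exact: bmf_min.
have Dm0 j x : 0 <= Dm j x by rewrite le_min D0 D0'.
have mb i := st_b (st i).
have mc j : measurable_fun setT (fun x => Dm j x <= a k.+1).
  by apply: measurable_fun_ler; [case: (bDm j)|exact: measurable_cst].
have mbm j : measurable_fun setT (bm j) by exact: measurable_and.
have ek := eps_gt0 k; have ek1 := eps_gt0 k.+1; have ak := a_gt0 k.
have Dmsq j : \int[P]_x Dm j x ^+ 2 <= eps k.+1 ^+ 2.
  apply: le_trans (Dsize' j.2).1; apply: mean_le => [||x]; try exact: bmf_sqr.
  by rewrite lerXn2r ?nnegrE// ge_min lexx orbT.
(* The link between the two lower ends. Truncation at the old width bounds it also for pairs of
   brackets without a common member; when a member exists, [lm - l] is at most [D] already. *)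
pose g1 j x := Num.min (lm j x - l j.1 x) (D j.1 x) * (b j.1 x)%:R.
have bg1 j : bmf (g1 j).
  by apply: bmfM; [apply: bmf_min => //; exact: bmfB|exact/bmf_bool].
have g1_itv j x : 0 <= g1 j x <= D j.1 x * (b j.1 x)%:R.
  rewrite /g1 mulr_ge0//=; last by rewrite le_min D0 subr_ge0 le_max lexx.
  by rewrite ler_wpM2r// ge_min lexx orbT.
have g1a j x : `|g1 j x| <= a k.
  have /andP[p0 pD] := g1_itv j x; rewrite ger0_norm// (le_trans pD)//.
  case: (boolP (b j.1 x)) => bx; last by rewrite mulr0 ltW.
  by rewrite mulr1 (st_bD (st j.1)).
have g1sq j : \int[P]_x g1 j x ^+ 2 <= eps k ^+ 2.
  apply: le_trans (st_D_sq (st j.1)); apply: mean_le => [||x]; try exact: bmf_sqr.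
  have /andP[p0 pD] := g1_itv j x; rewrite lerXn2r ?nnegrE// (le_trans pD)//.
  by case: (b _ _); rewrite ?mulr1// mulr0.
have [U1 [bU1 U10 gU1 EU1]] := majorant_level bg1 g1a ak ek g1sq cardJ.
pose g2 j x := Dm j x * (b j.1 x && ~~ (Dm j x <= a k.+1))%:R.
have bg2 j : bmf (g2 j).
  apply: bmfM => //; apply: bmf_bool; apply: measurable_and => //.
  exact: measurable_negb.
have g2a j x : `|g2 j x| <= a k.
  rewrite /g2 ger0_norm ?mulr_ge0//.
  case: (boolP (b j.1 x)) => bx; last by rewrite mulr0 ltW.
  apply: (@le_trans _ _ (D j.1 x)); last by rewrite (st_bD (st j.1)).
  by case: (~~ _); rewrite ?mulr1 ?mulr0// /Dm ge_min lexx.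
have g2sq j : \int[P]_x g2 j x ^+ 2 <= eps k.+1 ^+ 2.
  apply: le_trans (Dmsq j); apply: mean_le => [||x]; try exact: bmf_sqr.
  by rewrite /g2; case: (_ && _); rewrite ?mulr1// mulr0 expr0n/= sqr_ge0.
have [U2 [bU2 U20 gU2 EU2]] := majorant_level bg2 g2a ak ek1 g2sq cardJ.
pose c := eps k.+1 * r k.+2.
have c0 : 0 <= c by rewrite mulr_ge0// ltW// r_gt0.
exists J, lm, Dm, bm, (fun w => U w + U1 w + U2 w + c); split => //.
- move=> j; split => //.
  + by move=> x; rewrite Dm0 /Dm ge_min D2.
  + by move=> x /andP[].
  + apply: le_trans (Dsize' j.2).2; apply: mean_le => // x.
    by rewrite ge_min lexx orbT.
- split; first by apply: bmfD; [apply: bmfD => //; exact: bmfD|exact: bmf_cst].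
  by move=> w; rewrite !addr_ge0.
- rewrite !meanD ?mean_cst//; do ?[exact: bmfD|exact: bmf_cst|apply: bmfD => //].
  have akH : 6 * a k * H k.+1 / sn = 6 * (eps k * r k.+1).
    by rewrite r2 /a; field; rewrite !gt_eqF ?r_gt0.
  move: EU EU1 EU2; rewrite akH /chain_bound big_ord_recr/= -/c.
  have : eps k.+1 * r k.+1 <= eps k * r k.+1 by rewrite ler_wpM2r// ltW// r_gt0.
  by move: (30 * _ / _) (\sum_(j < _) _) => z y; lra.
- move=> f Ff; have [i [fi fU]] := FU f Ff; have [i' fi'] := FlD' f Ff.
  exists (i, i').
  have bf := bmf_class Ff.
  have fm x : 0 <= f x - lm (i, i') x <= Dm (i, i') x.
    have /andP[p1 p2] := fi x; have /andP[p3 p4] := fi' x; rewrite /lm /Dm/=.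
    rewrite subr_ge0 ge_max -!(subr_ge0 _ (f x)) p1 p3/= le_min.
    apply/andP; split; [apply: le_trans p2|apply: le_trans p4];
      by rewrite lerD2l lerN2 le_max lexx ?orbT.
  split => // w.
  pose old x := f x - (f x - l i x) * (b i x)%:R.
  pose cut x := (f x - lm (i, i') x) * (b i x && ~~ (Dm (i, i') x <= a k.+1))%:R.
  have bold : bmf old.
    by apply: bmfB => //; apply: bmfM; [exact: bmfB|exact: bmf_bool].
  have bcut : bmf cut.
    apply: bmfM; [exact: bmfB|apply: bmf_bool; apply: measurable_and => //].
    exact: measurable_negb (mc (i, i')).
  (* The old remainder is the link, plus the part cut where the new width exceeds its threshold,
     plus the new remainder. *)
  have -> : (fun x => f x - (f x - lm (i, i') x) * (bm (i, i') x)%:R) =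
      (fun x => (old x + g1 (i, i') x) + cut x).
    apply/funext => x; rewrite /old /g1 /cut /bm min_l.
      move: (lm (i, i') x) (Dm (i, i') x <= a k.+1) => u c'.
      by case: (b i x) => /=; case: c' => /=; ring.
    have /andP[p1 p2] := fm x; have /andP[p3 p4] := fi x.
    by move: p1 p2 p3 p4; rewrite /= /Dm /=; move: (lm _ _) => *; lra.
  rewrite empirical_processD//; last exact: bmfD.
  rewrite empirical_processD// -[U w + _ + _ + _]addrA; apply: le_trans (ler_normD _ _) _.
  apply: lerD.
    by rewrite (le_trans (ler_normD _ _))// lerD ?gU1// fU.
  have dom x : 0 <= cut x <= g2 (i, i') x.
    have /andP[p1 p2] := fm x.
    by rewrite /cut /g2 mulr_ge0//= ler_wpM2r.
  apply: le_trans (empirical_process_dominated w bcut (bg2 (i, i')) dom) _.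
  apply: lerD => //; apply: (@mean_cut (Dm (i, i')) (b i) (fun x => Dm (i, i') x <= a k.+1)) => //.
  by move=> x _; rewrite -ltNge => /ltW.
Qed.

(** The last remainder lies between 0 and [D i * b i], so it costs one more finite class and sqrt n
    times the mean of [D i]. This is where the L1 size [t m] enters. *)
Lemma expected_sup_chaining m : (expected_sup P X F <=
  (30 * H 0%N / sn + 28 * \sum_(j < m.+1) eps j * r j.+1 + sn * t m)%:E)%E.
Proof.
have [I [l [D [b [U [st cardI [bU U0] EU FU]]]]]] : chained m.
  by elim: m => [|m IH]; [exact: chained0|exact: chainedS].
pose g i x := D i x * (b i x)%:R.
have D0 i x : 0 <= D i x by have /andP[] := st_D_itv (st i) x.
have bg i : bmf (g i) by apply: bmfM; [exact: st_D (st i)|exact/bmf_bool/st_b/(st i)].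
have ga i x : `|g i x| <= a m.
  rewrite /g ger0_norm ?mulr_ge0//.
  case: (boolP (b i x)) => bx; last by rewrite mulr0 ltW// a_gt0.
  by rewrite mulr1 (st_bD (st i)).
have gsq i : \int[P]_x g i x ^+ 2 <= eps m ^+ 2.
  apply: le_trans (st_D_sq (st i)); apply: mean_le => [||x].
  - exact: bmf_sqr.
  - exact: bmf_sqr (st_D (st i)).
  - by rewrite /g; case: (b _ _); rewrite ?mulr1// mulr0 expr0n/= sqr_ge0.
have [U1 [bU1 U10 gU1 EU1]] := majorant_level bg ga (a_gt0 m) (eps_gt0 m) gsq cardI.
have c0 : 0 <= sn * t m by rewrite mulr_ge0 ?t_ge0// ltW.
apply: (@expected_sup_le F (fun w => U w + U1 w + sn * t m)).
- by apply: bmfD; [exact: bmfD|exact: bmf_cst].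
- by move=> w; rewrite !addr_ge0.
- move=> f Ff w; have [i [fi fU]] := FU f Ff.
  have bf := bmf_class Ff; have bl := st_l (st i).
  pose old x := f x - (f x - l i x) * (b i x)%:R.
  pose rest x := (f x - l i x) * (b i x)%:R.
  have brest : bmf rest by apply: bmfM; [exact: bmfB|exact/bmf_bool/st_b/(st i)].
  have bold : bmf old by exact: bmfB.
  have -> : f = (fun x => old x + rest x).
    by apply/funext => x; rewrite /old /rest; ring.
  rewrite empirical_processD// -addrA (le_trans (ler_normD _ _))// lerD ?fU//.
  have dom x : 0 <= rest x <= g i x.
    have /andP[p1 p2] := fi x.
    by rewrite /rest /g mulr_ge0//= ler_wpM2r.
  apply: le_trans (empirical_process_dominated w brest (bg i) dom) _.
  rewrite lerD ?gU1// ler_wpM2l ?(ltW sn_gt0)//.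
  apply: le_trans (st_D_t (st i)); apply: mean_le => // [|x]; first exact: st_D (st i).
  by rewrite /g; case: (b _ _); rewrite ?mulr1// mulr0.
- rewrite !meanD ?mean_cst//; do ?[exact: bmfD|exact: bmf_cst].
  have amH : 6 * a m * H m / sn <= 6 * (eps m * r m.+1).
    have -> : 6 * a m * H m / sn = 6 * (eps m * r m * (r m / r m.+1)).
      by rewrite r2 /a; field; rewrite !gt_eqF ?r_gt0.
    rewrite ler_pM2l// (le_trans (ler_piMr _ _))//.
    + by rewrite mulr_ge0 ?ltW ?r_gt0.
    + by rewrite ler_pdivrMr ?r_gt0// mul1r r_le.
    + by rewrite ler_wpM2l ?r_le// ltW.
  have em : eps m * r m <= eps m * r m.+1 by rewrite ler_wpM2l ?r_le// ltW.
  have em0 : 0 <= eps m * r m.+1 by rewrite mulr_ge0// ltW// r_gt0.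
  move: EU EU1; rewrite /chain_bound big_ord_recr/=.
  by move: (30 * _ / _) (\sum_(j < _) _) => z y; lra.
Qed.

End Chaining.

(** * Polynomial entropy *)

Section PowRFacts.
Context (R : realType).
Implicit Types x y r : R.

Lemma le0_ger_powR r x y : r <= 0 -> 0 < x -> x <= y -> y `^ r <= x `^ r.
Proof.
move=> r0 x0 xy; have y0 := lt_le_trans x0 xy.
rewrite -[r]opprK powRN [leRHS]powRN lef_pV2 ?posrE ?powR_gt0//.
by apply: ge0_ler_powR; rewrite ?nnegrE ?oppr_ge0// ltW.
Qed.

Lemma powR_ge1 r x : 0 < x <= 1 -> r <= 0 -> 1 <= x `^ r.
Proof. by move=> x1 r0; rewrite -(powRr0 x); exact: ger_powR. Qed.

Lemma sqrt_powR x r : 0 <= x -> Num.sqrt (x `^ r) = x `^ (r / 2).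
Proof. by move=> x0; rewrite -powR12_sqrt ?powR_ge0// -powRrM. Qed.

Lemma geometric_sum_le (x : nat -> R) (k : R) m : 0 <= k -> k < 1 -> (forall j, 0 <= x j) ->
  (forall j, x j.+1 = k * x j) -> \sum_(j < m) x j <= x 0%N / (1 - k).
Proof.
move=> k0 k1 x0 xS; rewrite ler_pdivlMr ?subr_gt0//.
have -> : (\sum_(j < m) x j) * (1 - k) = x 0%N - x m.
  elim: m => [|m IH]; first by rewrite big_ord0 mul0r subrr.
  by rewrite big_ord_recr/= mulrDl IH xS; ring.
by rewrite gerBl.
Qed.

Lemma geometric_sum_le_last (x : nat -> R) (k : R) m : 0 <= k -> k < 1 -> (forall j, 0 <= x j) ->
  (forall j, x j = k * x j.+1) -> \sum_(j < m.+1) x j <= x m / (1 - k).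
Proof.
move=> k0 k1 x0 xS; rewrite ler_pdivlMr ?subr_gt0//.
elim: m => [|m IH]; first by rewrite big_ord_recr big_ord0/= add0r ler_piMr// gerBl.
rewrite big_ord_recr/= mulrDl (le_trans (lerD IH (lexx _)))// xS.
by rewrite mulrBr mulr1 mulrC addrC subrK.
Qed.

End PowRFacts.

(** * Chaining along dyadic scales *)

Section EntropyRate.
Context (R : realType) (a K u : R).
Hypothesis a_gt0 : 0 < a.
Hypothesis a_neq1 : a != 1.
Hypothesis K_gt0 : 0 < K.
Hypothesis u_ge1 : 1 <= u.

(** Halving the scale divides the entropy by [rho], so the entropies up to a level sum to at most
    the last one over [1 - rho]; [B] adds room for the summand 1. *)
Let rho : R := 2 `^ (- (2 * a)).
Let B : R := 1 + K / (1 - rho).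

Lemma rho_itv : 0 < rho < 1.
Proof.
rewrite /rho powR_gt0//= powRN invf_lt1 ?powR_gt0//.
by rewrite -[ltLHS](powRr0 2) /powR pnatr_eq0/= ltr_expR ltr_pM2r ?mulr_gt0// ln_gt0// ltr1n.
Qed.

Lemma B_ge1 : 1 <= B.
Proof. by have /andP[_ r1] := rho_itv; rewrite lerDl divr_ge0 ?(ltW K_gt0)// subr_ge0 ltW. Qed.

Let eps (s : R) k := s / 2 ^+ k.

Lemma eps_gt0 s k : 0 < s -> 0 < eps s k.
Proof. by move=> s0; rewrite divr_gt0// exprn_gt0. Qed.

Lemma epsS s k : eps s k = 2 * eps s k.+1.
Proof. by rewrite /eps exprS; field; rewrite expf_neq0. Qed.

Lemma eps_le s k : 0 < s -> eps s k <= s.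
Proof. by move=> s0; rewrite ler_pdivrMr ?exprn_gt0// ler_peMr ?(ltW s0)// exprn_ege1// ler1n. Qed.

Lemma entropy_sum_le s k : 0 < s -> s <= 1 ->
  1 + \sum_(j < k.+1) K * eps s j `^ (- (2 * a)) <= B * eps s k `^ (- (2 * a)).
Proof.
move=> s0 s1; have /andP[r0 r1] := rho_itv.
have e1 : 1 <= eps s k `^ (- (2 * a)).
  apply: powR_ge1; last by rewrite oppr_le0 mulr_ge0// ltW.
  by rewrite eps_gt0//= (le_trans (eps_le k s0)).
rewrite /B [leRHS]mulrDl mul1r lerD// -mulrA [_^-1 * _]mulrC mulrA.
apply: (@geometric_sum_le_last _ (fun j => K * eps s j `^ (- (2 * a)))) => //; first exact: ltW.
  by move=> j; rewrite mulr_ge0 ?powR_ge0// ltW.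
move=> j; rewrite epsS powRM// ?(ltW (eps_gt0 _ s0))//; rewrite -/rho; ring.
Qed.

Lemma sqrt_entropy s k : 0 < s ->
  Num.sqrt (B * eps s k `^ (- (2 * a))) = Num.sqrt B * eps s k `^ (- a).
Proof.
move=> s0; rewrite sqrtrM ?(le_trans ler01 B_ge1)// sqrt_powR ?(ltW (eps_gt0 _ s0))//.
by congr (_ * _ `^ _); field.
Qed.

Lemma chain_sum_le s m : 0 < s ->
  \sum_(j < m.+1) eps s j * Num.sqrt (B * eps s j.+1 `^ (- (2 * a))) =
  Num.sqrt B * 2 `^ a * \sum_(j < m.+1) eps s j `^ (1 - a).
Proof.
move=> s0; rewrite mulr_sumr; apply: eq_bigr => j _.
have ej := eps_gt0 j s0; have ej1 := eps_gt0 j.+1 s0.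
rewrite sqrt_entropy//.
have -> : eps s j `^ (1 - a) = eps s j / eps s j `^ a.
  by rewrite powRB; [rewrite powRr1// ltW|rewrite (gt_eqF ej) implybT].
have -> : eps s j.+1 `^ (- a) = 2 `^ a * (eps s j `^ a)^-1.
  by rewrite [in RHS]epsS powRM ?(ltW ej1)// powRN; field; rewrite !gt_eqF ?powR_gt0.
by ring.
Qed.

Lemma exists_small_eps s c : 0 < s -> 0 < c -> exists m, eps s m <= c.
Proof.
move=> s0 c0; exists (Num.truncn (s / c)).+1.
rewrite ler_pdivrMr ?exprn_gt0// mulrC -ler_pdivrMr//.
apply: le_trans (ltW (Num.Theory.truncnS_gt _)) _.
by rewrite -natrX ler_nat ltnW// ltn_expl.
Qed.

Section Sample.
Context d d' (T : measurableType d) (Omega : measurableType d').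
Context (Pr : probability Omega R) (P : probability T R).
Context (n : nat) (X : 'I_n -> {RV Pr >-> T}) (F : set (T -> R)) (s : R).
Hypothesis n_gt0 : (0 < n)%N.
Hypothesis s_gt0 : 0 < s.
Hypothesis s_le1 : s <= 1.
Hypothesis iidX : iid_sample P X.
Hypothesis F_meas : forall f, F f -> measurable_fun setT f.
Hypothesis F_le1 : forall f, F f -> forall x, `|f x| <= 1.
Hypothesis F_sq : forall f, F f -> \int[P]_x f x ^+ 2 <= s ^+ 2.
Hypothesis F_bracketed : forall e, 0 < e <= 1 ->
  bracketed P F e (e `^ u) (K * e `^ (- (2 * a))).

Lemma expected_sup_levels m : (expected_sup P X F <=
  (30 * B * (n%:R `^ (- (1 / 2)) * s `^ (- (2 * a))) +
   28 * (Num.sqrt B * 2 `^ a) * \sum_(j < m.+1) eps s j `^ (1 - a) +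
   Num.sqrt n%:R * eps s m `^ u)%:E)%E.
Proof.
have e01 k : 0 < eps s k <= 1 by rewrite eps_gt0//= (le_trans (eps_le k s_gt0)).
have eS k : eps s k.+1 <= eps s k.
  by have /andP[ek _] := e01 k.+1; rewrite (epsS s k); lra.
have B1 := B_ge1.
have H1 k : 1 <= B * eps s k `^ (- (2 * a)).
  rewrite (le_trans B1)// ler_peMr ?(le_trans ler01)//.
  by apply: powR_ge1 => //; rewrite oppr_le0 mulr_ge0// ltW.
have := @expected_sup_chaining _ _ _ _ _ _ _ _ X iidX n_gt0 F (eps s)
  (fun k => eps s k `^ u) (fun k => K * eps s k `^ (- (2 * a))) (fun k => B * eps s k `^ (- (2 * a))).
move=> /(_ F_meas F_le1)-/(_ _ _ _ eS _ _ H1 _ m) chain.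
apply: le_trans (chain _ _ _ _ _ _) _ => {chain}.
- by move=> f Ff; rewrite /eps expr0 divr1; exact: F_sq.
- by move=> k; case/andP: (e01 k).
- by move=> k; exact: powR_ge0.
- by move=> k; exact: F_bracketed.
- by move=> k; exact: entropy_sum_le.
- move=> k; rewrite ler_wpM2l ?(le_trans ler01)//.
  by apply: le0_ger_powR; rewrite ?oppr_le0 ?mulr_ge0 ?(ltW a_gt0)//; case/andP: (e01 k.+1).
rewrite lee_fin chain_sum_le// /eps expr0 divr1 [n%:R `^ _]powRN mul1r powR12_sqrt//.
by rewrite le_eqVlt; apply/orP; left; apply/eqP; ring.
Qed.

End Sample.

(** For [a < 1] the links decrease geometrically and the first one dominates, so the chain can go on
    until the L1 remainder is negligible. *)
Lemma entropy_chaining_lt1 : a < 1 -> exists C : R, 0 < C /\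
  forall d d' (T : measurableType d) (Omega : measurableType d')
    (Pr : probability Omega R) (P : probability T R)
    n (X : 'I_n -> {RV Pr >-> T}) (F : set (T -> R)) (s : R),
  (0 < n)%N -> 0 < s -> s <= 1 -> iid_sample P X ->
  (forall f, F f -> measurable_fun setT f) ->
  (forall f, F f -> forall x, `|f x| <= 1) ->
  (forall f, F f -> \int[P]_x f x ^+ 2 <= s ^+ 2) ->
  (forall e, 0 < e <= 1 -> bracketed P F e (e `^ u) (K * e `^ (- (2 * a)))) ->
  (expected_sup P X F <=
    (C * (s `^ (1 - a) + n%:R `^ (- (1 / 2)) * s `^ (- (2 * a))))%:E)%E.
Proof.
move=> a1; pose k : R := (2 `^ (1 - a))^-1.
have k0 : 0 < k by rewrite invr_gt0 powR_gt0.
have k1 : k < 1.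
  rewrite invf_lt1 ?powR_gt0// -[ltLHS](powRr0 2) /powR pnatr_eq0/= ltr_expR.
  by rewrite ltr_pM2r ?subr_gt0// ln_gt0// ltr1n.
have B0 : 0 < B by rewrite (lt_le_trans ltr01 B_ge1).
pose C1 := 28 * (Num.sqrt B * 2 `^ a) / (1 - k).
have C10 : 0 < C1 by rewrite divr_gt0 ?subr_gt0// !mulr_gt0 ?sqrtr_gt0 ?powR_gt0.
exists (30 * B + C1 + 1); split; first by rewrite !addr_gt0// mulr_gt0.
move=> d d' T Omega Pr P n X F s n0 s0 s1 iidX Fm F1 F2 Fb.
have sn0 : 0 < Num.sqrt n%:R :> R by rewrite sqrtr_gt0 ltr0n.
have sa0 : 0 < s `^ (1 - a) by rewrite powR_gt0.
have [m hm] := exists_small_eps s0 (divr_gt0 sa0 sn0).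
apply: le_trans (expected_sup_levels n0 s0 s1 iidX Fm F1 F2 Fb m) _.
have em0 := eps_gt0 m s0.
have lastm : Num.sqrt n%:R * eps s m `^ u <= s `^ (1 - a).
  rewrite mulrC -ler_pdivlMr//; apply: le_trans hm.
  by apply: ge1r_powR => //; rewrite em0/= (le_trans (eps_le m s0)).
have sum : \sum_(j < m.+1) eps s j `^ (1 - a) <= s `^ (1 - a) / (1 - k).
  have -> : s = eps s 0 by rewrite /eps expr0 divr1.
  rewrite {2}/eps expr0 divr1.
  apply: (@geometric_sum_le _ (fun j => eps s j `^ (1 - a))); rewrite ?(ltW k0)// => j.
    exact: powR_ge0.
  by rewrite [in RHS]epsS powRM ?(ltW (eps_gt0 _ s0))// /k mulKf// gt_eqF ?powR_gt0.
have D0 : 0 <= 28 * (Num.sqrt B * 2 `^ a) by rewrite mulr_ge0// mulr_ge0 ?powR_ge0.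
set D := 28 * (Num.sqrt B * 2 `^ a) in C1 C10 D0 *.
have DS : D * \sum_(j < m.+1) eps s j `^ (1 - a) <= C1 * s `^ (1 - a).
  by rewrite (le_trans (ler_wpM2l D0 sum))// /C1 mulrA mulrAC.
set y := n%:R `^ (- (1 / 2)) * s `^ (- (2 * a)).
have y0 : 0 <= y by rewrite mulr_ge0 ?powR_ge0.
have By : 0 <= B * s `^ (1 - a) by exact: ltW (mulr_gt0 B0 sa0).
have Cy : 0 <= C1 * y by rewrite mulr_ge0 ?(ltW C10).
rewrite lee_fin; move: lastm DS; move: (D * _) (Num.sqrt _ * _) => z w; lra.
Qed.

(** For [a > 1] the links increase geometrically and the last one dominates, so the stopping level
    has to be balanced against the L1 remainder. *)
Lemma entropy_chaining_gt1 : 1 < a -> exists C : R, 0 < C /\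
  forall d d' (T : measurableType d) (Omega : measurableType d')
    (Pr : probability Omega R) (P : probability T R)
    n (X : 'I_n -> {RV Pr >-> T}) (F : set (T -> R)) (s : R),
  (0 < n)%N -> 0 < s -> s <= 1 -> iid_sample P X ->
  (forall f, F f -> measurable_fun setT f) ->
  (forall f, F f -> forall x, `|f x| <= 1) ->
  (forall f, F f -> \int[P]_x f x ^+ 2 <= s ^+ 2) ->
  (forall e, 0 < e <= 1 -> bracketed P F e (e `^ u) (K * e `^ (- (2 * a)))) ->
  (expected_sup P X F <=
    (C * (n%:R `^ ((a - 1) / (2 * (a - 1 + u))) + s `^ (1 - a)
          + n%:R `^ (- (1 / 2)) * s `^ (- (2 * a))))%:E)%E.
Proof.
move=> a1; pose k : R := 2 `^ (1 - a).
have k0 : 0 < k by rewrite powR_gt0.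
have k1 : k < 1.
  rewrite -[ltRHS](powRr0 2) /k /powR pnatr_eq0/= ltr_expR.
  by rewrite ltr_pM2r ?subr_lt0// ln_gt0// ltr1n.
have B0 : 0 < B by rewrite (lt_le_trans ltr01 B_ge1).
pose C0 := 28 * (Num.sqrt B * 2 `^ a) / (1 - k).
have C00 : 0 < C0 by rewrite divr_gt0 ?subr_gt0// !mulr_gt0 ?sqrtr_gt0 ?powR_gt0.
pose C1 := C0 / k.
have C10 : 0 < C1 by rewrite divr_gt0.
have C01 : C0 <= C1 by rewrite ler_pdivlMr// ler_piMr// ltW.
exists (30 * B + C1 + 1); split; first by rewrite !addr_gt0// mulr_gt0.
move=> d d' T Omega Pr P n X F s n0 s0 s1 iidX Fm F1 F2 Fb.
have n0' : 0 < n%:R :> R by rewrite ltr0n.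
pose v := a - 1 + u; have v0 : 0 < v by rewrite /v; have := u_ge1; lra.
(* The scale solving g^(1-a) = sqrt n * g^u; [r] is the common value. *)
pose g : R := n%:R `^ (- (2 * v)^-1); have g0 : 0 < g by rewrite powR_gt0.
pose r : R := n%:R `^ ((a - 1) / (2 * v)).
have gr : g `^ (1 - a) = r by rewrite /g /r -powRrM; congr (_ `^ _); field; rewrite gt_eqF.
have gu : Num.sqrt n%:R * g `^ u = r.
  rewrite -powR12_sqrt// /g /r -powRrM -powRD ?(gt_eqF n0') ?implybT//.
  by congr (_ `^ _); rewrite /v; field; rewrite gt_eqF// -/v.
(* Take the first level below [g]. Either it is level 0, with scale [s], or its scale exceeds
   [g / 2]; these cases produce the two summands of [em]. *)
have exm : exists m, eps s m <= g := exists_small_eps s0 g0.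
case: (ex_minnP exm) => m hm mmin.
apply: le_trans (expected_sup_levels n0 s0 s1 iidX Fm F1 F2 Fb m) _.
have em0 := eps_gt0 m s0.
have lastm : Num.sqrt n%:R * eps s m `^ u <= r.
  rewrite -gu ler_wpM2l//.
  apply: ge0_ler_powR; rewrite ?nnegrE ?(ltW em0) ?(ltW g0)//.
  exact: le_trans ler01 u_ge1.
have sum : \sum_(j < m.+1) eps s j `^ (1 - a) <= eps s m `^ (1 - a) / (1 - k).
  apply: (@geometric_sum_le_last _ (fun j => eps s j `^ (1 - a))); rewrite ?(ltW k0)// => j.
    exact: powR_ge0.
  by rewrite [in LHS]epsS powRM ?(ltW (eps_gt0 _ s0)).
have em : eps s m `^ (1 - a) <= s `^ (1 - a) + r / k.
  clear lastm sum em0; case: m hm mmin => [|m] hm mmin.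
    by rewrite /eps expr0 divr1 lerDl divr_ge0 ?powR_ge0.
  have gm : g < eps s m by rewrite ltNge; apply/negP => /mmin; rewrite ltnn.
  apply: (@le_trans _ _ (r / k)); last by rewrite lerDr powR_ge0.
  rewrite -gr ler_pdivlMr// mulrC /k -powRM ?(ltW (eps_gt0 _ s0))//.
  rewrite -epsS; apply: le0_ger_powR => //; last exact: ltW.
  by rewrite subr_le0 ltW.
have D0 : 0 <= 28 * (Num.sqrt B * 2 `^ a) by rewrite mulr_ge0// mulr_ge0 ?powR_ge0.
set D := 28 * (Num.sqrt B * 2 `^ a) in C0 C00 C1 C10 C01 D0 *.
have DS : D * \sum_(j < m.+1) eps s j `^ (1 - a) <= C0 * s `^ (1 - a) + C1 * r.
  apply: (@le_trans _ _ (C0 * eps s m `^ (1 - a))).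
    by rewrite (le_trans (ler_wpM2l D0 sum))// /C0 mulrA mulrAC.
  by rewrite (le_trans (ler_wpM2l (ltW C00) em))// mulrDr lerD2l /C1 mulrA mulrAC.
rewrite lee_fin -/v -/r.
set y := n%:R `^ (- (1 / 2)) * s `^ (- (2 * a)); set x := s `^ (1 - a) in DS *.
have y0 : 0 <= y by rewrite mulr_ge0 ?powR_ge0.
have x0 : 0 <= x by exact: powR_ge0.
have r0 : 0 <= r by exact: powR_ge0.
have Bx : 0 <= B * x by rewrite mulr_ge0 ?(ltW B0).
have Br : 0 <= B * r by rewrite mulr_ge0 ?(ltW B0).
have Cy : 0 <= C1 * y by rewrite mulr_ge0 ?(ltW C10).
have Cx : C0 * x <= C1 * x by rewrite ler_wpM2r.
move: lastm DS; move: (D * _) (Num.sqrt _ * _) => z w; lra.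
Qed.

End EntropyRate.

(** * From bracketing numbers to brackets *)

Section Conversion.
Context d (T : measurableType d) (R : realType) (P : probability T R).

Lemma bmf_powR (D : T -> R) p : 0 <= p -> bmf D -> (forall x, 0 <= D x) ->
  bmf (fun x => D x `^ p).
Proof.
move=> p0 [mD [B DB]] D0; split.
  exact: (measurableT_comp (measurable_powR p)).
exists (B `^ p) => x; rewrite ger0_norm ?powR_ge0//.
have DxB : D x <= B := le_trans (ler_norm _) (DB x).
by apply: ge0_ler_powR; rewrite ?nnegrE// (le_trans (D0 x)).
Qed.

(** The difference [g] of bracket ends may be unbounded; the estimate is transferred to a bounded
    [D] below its absolute value, which stands for the clipped width. *)
Lemma mean_powR_le_Lp (g D : T -> R) p c : 1 <= p -> 0 <= c -> measurable_fun setT g ->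
  (Lp_norm P p g <= c%:E)%E -> bmf D -> (forall x, 0 <= D x) ->
  (forall x, D x <= `|g x|) -> \int[P]_x D x `^ p <= c `^ p.
Proof.
move=> p1 c0 mg gc bD D0 Dg.
have p0 : 0 <= p := le_trans ler01 p1.
have pn0 : p != 0 by rewrite gt_eqF// (lt_le_trans ltr01).
rewrite -lee_fin -(EFin_mean P (bmf_powR p0 bD D0)) -poweR_EFin.
have gE x : (`|(EFin \o g) x| `^ p = (`|g x| `^ p)%:E)%E by rewrite -poweR_EFin.
apply: (@le_trans _ _ (\int[P]_x (`|(EFin \o g) x| `^ p))%E).
  apply: ge0_le_integral => // [x _||| x _].
  - by rewrite lee_fin powR_ge0.
  - by apply/measurable_EFinP; case: (bmf_powR p0 bD D0).
  - under eq_fun do rewrite gE.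
    apply/measurable_EFinP; apply: (measurableT_comp (measurable_powR p)).
    exact: measurableT_comp.
  - rewrite gE lee_fin; apply: ge0_ler_powR; rewrite ?nnegrE//.
rewrite -poweR_Lnorm//; apply: gt0_ler_poweR => //.
- by rewrite in_itv/= leey Lnorm_ge0.
- by rewrite in_itv/= leey lee_fin c0.
Qed.

(** Compare [x] with [c]. Integrated, this replaces Hoelder's inequality at the price of a factor
    2. *)
Lemma powR_split_le (x c r p : R) : 0 <= x -> 0 < c -> 0 < r -> r <= p ->
  x `^ r <= c `^ r + x `^ p * c `^ (r - p).
Proof.
move=> x0 c0 r0 rp; have [xc|cx] := leP x c.
  rewrite -[leLHS]addr0 lerD ?mulr_ge0 ?powR_ge0//.
  by apply: ge0_ler_powR; rewrite ?nnegrE// ltW.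
have xp : 0 < x := lt_trans c0 cx.
apply: (@le_trans _ _ (x `^ p * c `^ (r - p))); last by rewrite lerDr powR_ge0.
have {1}-> : x `^ r = x `^ p * x `^ (r - p).
  by rewrite -powRD ?(gt_eqF xp) ?implybT//; congr (_ `^ _); ring.
by rewrite ler_wpM2l ?powR_ge0//; apply: le0_ger_powR => //; [rewrite subr_le0|exact: ltW].
Qed.

Lemma mean_powR_interpolation (D : T -> R) (c r p : R) : bmf D -> (forall x, 0 <= D x) ->
  0 < c -> 0 < r -> r <= p -> \int[P]_x D x `^ p <= c `^ p ->
  \int[P]_x D x `^ r <= 2 * c `^ r.
Proof.
move=> bD D0 c0 r0 rp Dp; have p0 : 0 <= p by rewrite ltW// (lt_le_trans r0).
have bp := bmf_powR p0 bD D0.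
apply: (@le_trans _ _ (\int[P]_x (c `^ r + c `^ (r - p) * D x `^ p))).
  apply: mean_le => [||x]; first exact: bmf_powR (ltW r0) bD D0.
    by apply: bmfD; [exact: bmf_cst|exact: bmfZ].
  by rewrite [_ * D x `^ _]mulrC powR_split_le.
rewrite meanD ?mean_cst ?meanZ//; [|exact: bmf_cst|exact: bmfZ].
rewrite mulr2n mulrDl mul1r lerD2l (le_trans (ler_wpM2l (powR_ge0 _ _) Dp))//.
by rewrite -powRD ?(gt_eqF c0) ?implybT// subrK.
Qed.

(** The origin of the exponent min p 2: for p <= 2 the bound D <= 2 gives D^2 <= 2 D^p, and for p >
    2 the L2 size is interpolated from the L_p size. *)
Lemma mean_sqr_le_min (D : T -> R) (c p : R) : bmf D -> (forall x, 0 <= D x <= 2) ->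
  0 < c -> 1 <= p -> \int[P]_x D x `^ p <= c `^ p ->
  \int[P]_x D x ^+ 2 <= 2 * c `^ (Num.min p 2).
Proof.
move=> bD D02 c0 p1 Dp.
have D0 x : 0 <= D x by have /andP[] := D02 x.
have p0 : 0 <= p := le_trans ler01 p1.
have eD x : D x ^+ 2 = D x `^ 2 by rewrite powR_mulrn.
have [p2|p2] := leP p 2; last first.
  under eq_Rintegral do rewrite eD.
  by apply: (mean_powR_interpolation (p := p)) => //; exact: ltW.
apply: (@le_trans _ _ (\int[P]_x (2 * D x `^ p))).
  apply: mean_le => [||x]; [exact: bmf_sqr|exact/bmfZ/bmf_powR|].
  have [->|Dx0] := eqVneq (D x) 0.
    by rewrite expr0n/= mulr_ge0// powR_ge0.
  rewrite eD -[2 in leLHS](subrK p) powRD; last by rewrite Dx0 implybT.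
  rewrite ler_wpM2r ?powR_ge0// -[leRHS]powRr1//.
  have /andP[_ D2] := D02 x.
  apply: (@le_trans _ _ (2 `^ (2 - p))).
    by apply: ge0_ler_powR; rewrite ?nnegrE ?subr_ge0.
  by apply: ler_powR; rewrite ?ler1n//; lra.
by rewrite meanZ; [rewrite ler_wpM2l|exact: bmf_powR].
Qed.

Lemma unit_bounded_classP (F : set (T -> R)) : unit_bounded_class F ->
  (forall f, F f -> measurable_fun setT f) /\ (forall f, F f -> forall x, `|f x| <= 1).
Proof.
move=> uF; split=> f /uF[mf f1] // x.
rewrite -lee_fin; apply: le_trans f1; apply: ereal_sup_ubound.
by exists x.
Qed.

(** Some admissible N lies below exp h + 1, and for h >= 0 this is at most exp(h + 1). *)
Lemma bracketing_number_lt (F : set (T -> R)) (eps h : R) norm : 0 <= h ->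
  (lne (bracketing_number eps F norm) <= h%:E)%E ->
  exists (N : nat) (l u : 'I_N -> T -> R),
  [/\ N%:R <= expR (h + 1),
      forall i, measurable_fun setT (l i) /\ measurable_fun setT (u i),
      forall i, (norm (u i \- l i)%R < eps%:E)%E &
      forall f, F f -> exists i, forall x, l i x <= f x <= u i x].
Proof.
move=> h0 lh.
have lt : (bracketing_number eps F norm < (expR h + 1)%:E)%E.
  case E : (bracketing_number eps F norm) lh => [b||] lh; [|by []|exact: ltNyr].
  (* The number is 0 for the empty class, where its logarithm is minus infinity. *)
  have [b0|b0] := leP b 0.
    by rewrite lte_fin (le_lt_trans b0)// addr_gt0 ?expR_gt0.
  rewrite lte_fin; have : b <= expR h.
    by move: lh; rewrite lne_EFin// lee_fin => lh; rewrite -[b]lnK ?posrE// ler_expR.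
  lra.
have [_ [N [l [u [mlu sz cov]]] <-] Nlt] := ereal_inf_lt lt.
exists N, l, u; split => //.
have h1 : 1 <= expR h by rewrite -expR0 ler_expR.
have e2 : 2 <= expR 1 :> R by have := expR_ge1Dx (1 : R); lra.
move: Nlt; rewrite lte_fin expRD => Nlt.
have : expR h * 2 <= expR h * expR 1 by rewrite ler_wpM2l// expR_ge0.
lra.
Qed.

Lemma clip_dist (x y : R) : `|Num.max (-1) (Num.min 1 x) - Num.max (-1) (Num.min 1 y)| <= `|x - y|.
Proof.
rewrite ler_norml; have := ler_norm (x - y); have := ler_norm (y - x); rewrite distrC.
by rewrite !minEle !maxEle; do ![case: ifPn]; rewrite -?ltNge => *; apply/andP; split; lra.
Qed.

(* The brackets are clipped to [-1, 1]; those meeting the class keep covering it. *)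
Lemma entropy_bracketed (F : set (T -> R)) (p alpha L : R) : 1 <= p -> 0 < alpha -> 0 < L ->
  unit_bounded_class F -> bracketing_entropy_ub P F p alpha L ->
  let q := Num.min p 2 in let a := alpha / q in
  forall e, 0 < e <= 1 ->
  bracketed P F e (e `^ (2 / q)) ((L * 2 `^ (2 * a) + 1) * e `^ (- (2 * a))).
Proof.
move=> p1 al0 L0 /unit_bounded_classP[mF F1] entF q a e /andP[e0 e1].
have q1 : 1 <= q by rewrite le_min p1 ler1n.
have q2 : q <= 2 by rewrite ge_min lexx orbT.
have q0 : 0 < q by rewrite (lt_le_trans ltr01).
have a0 : 0 < a by rewrite divr_gt0.
have p0 : 0 <= p := le_trans ler01 p1.
have e20 : 0 < e / 2 by rewrite divr_gt0.
(* With L_p size [eps] the mean square is at most 2 eps^q = e^2 / 2, and the mean at most 2 eps <=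
   e^(2/q) because 2/q >= 1. *)
pose eps : R := (e / 2) `^ (2 / q); have eps0 : 0 < eps by rewrite powR_gt0.
have epsa : eps `^ (- alpha) = 2 `^ (2 * a) * e `^ (- (2 * a)).
  rewrite /eps -powRrM powRM ?invr_ge0 ?(ltW e0)//.
  rewrite mulrC -[2^-1]powR_inv1// -powRrM; congr (_ `^ _ * _ `^ _); rewrite /a; field; exact: lt0r_neq0.
have h0 : 0 <= L * eps `^ (- alpha) by rewrite mulr_ge0 ?powR_ge0// ltW.
have [N [l [u [Nh mlu sz cov]]]] := bracketing_number_lt h0 (entF _ eps0).
pose clip x : R := Num.max (-1) (Num.min 1 x).
have clip_itv x : -1 <= clip x <= 1.
  by rewrite /clip minEle maxEle; do ![case: ifPn]; rewrite -?ltNge => *; apply/andP; split; lra.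
have bclip (g : T -> R) : measurable_fun setT g -> bmf (fun x => clip (g x)).
  move=> mg; split; last by exists 1 => x; rewrite ler_norml clip_itv.
  apply: measurable_maxr; first exact: measurable_cst.
  by apply: measurable_minr => //; exact: measurable_cst.
(* A covering pair need not satisfy l <= u everywhere; the absolute value keeps the width
   nonnegative. *)
pose D i x := `|clip (u i x) - clip (l i x)|.
have bD i : bmf (D i).
  by apply: bmf_norm; apply: bmfB; apply: bclip; case: (mlu i).
have D02 i x : 0 <= D i x <= 2.
  rewrite normr_ge0 /D ler_norml; have := clip_itv (u i x); have := clip_itv (l i x).
  by move=> /andP[? ?] /andP[? ?] /=; apply/andP; split; lra.
have D0 i x : 0 <= D i x by have /andP[] := D02 i x.
have Dp i : \int[P]_x D i x `^ p <= eps `^ p.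
  apply: (@mean_powR_le_Lp (u i \- l i)) => //; first exact: ltW.
  - by case: (mlu i) => ? ?; exact: measurable_funB.
  - exact: ltW (sz i).
  - by move=> x; exact: clip_dist.
exists N, (fun i x => clip (l i x)), D; split.
- by move=> i; split => //; apply: bclip; case: (mlu i).
- move=> i; split.
    apply: le_trans (mean_sqr_le_min (bD i) (D02 i) eps0 p1 (Dp i)) _.
    rewrite -/q /eps -powRrM mulfVK ?gt_eqF// powR_mulrn ?(ltW e20)// expr_div_n.
    have := sqr_ge0 e; lra.
  have := mean_powR_interpolation (bD i) (D0 i) eps0 ltr01 p1 (Dp i).
  under eq_Rintegral do rewrite powRr1//.
  move/le_trans; apply; rewrite powRr1 ?(ltW eps0)//.
  rewrite /eps powRM ?(ltW e0)// mulrCA ger_pMr ?powR_gt0//.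
  rewrite -[2^-1]powR_inv1// -powRrM mulN1r.
  have : 2 `^ (- (2 / q)) <= 2 `^ (- 1) :> R.
    apply: ler_powR; first by rewrite ler1n.
    by rewrite lerN2 ler_pdivlMr// mul1r.
  by rewrite powR_inv1//; lra.
- move=> f Ff; have [i fi] := cov f Ff; exists i => x.
  have /andP[lf fu] := fi x; have := F1 f Ff x; rewrite ler_norml => /andP[f0 f1].
  have lfx : clip (l i x) <= f x by rewrite ge_max f0/= ge_min lf orbT.
  have fux : f x <= clip (u i x) by rewrite le_max le_min f1 fu orbT.
  by rewrite subr_ge0 lfx/= /D ger0_norm ?subr_ge0 ?(le_trans lfx)// lerD2r.
(* The extra 1 in the exponent is absorbed by the negative power of [e], which is at least 1 for
   [e <= 1]. *)
- apply: le_trans Nh _; rewrite ler_expR epsa [leRHS]mulrDl mul1r mulrA lerD2l.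
  by apply: powR_ge1; rewrite ?e0// oppr_le0 mulr_ge0// ltW.
Qed.

End Conversion.

(** * Upper bounds *)

Lemma bracketing_bound_rate_asymp (R : realType) (alpha q : R) :
  0 < alpha -> 0 < q -> q <= 2 -> alpha != q ->
  exists C : R, 0 < C /\ forall n sigma, (0 < n)%N -> 0 < sigma ->
    (bracketing_bound n alpha q sigma <= (C * bracketing_rate n alpha q sigma)%:E)%E /\
    ((bracketing_rate n alpha q sigma)%:E <= C%:E * bracketing_bound n alpha q sigma)%E.
Proof.
move=> al0 q0 q2 aq; have [aq1|qa|aq1] := ltgtP alpha q; last by rewrite aq1 eqxx in aq.
  exists 1; split => // n s n0 s0; rewrite mul1r mul1e /bracketing_rate aq1.
  have elemE g : (epowR (s * (alpha < q)%R%:R + g * (q < alpha)%R%:R) ((q - alpha) / 2)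
     + (n%:R `^ (- (1 / 2)) * s `^ (- alpha) + Num.sqrt n%:R * g)%:E
    = (s `^ ((q - alpha) / 2) + n%:R `^ (- (1 / 2)) * s `^ (- alpha) + Num.sqrt n%:R * g)%:E)%E.
    rewrite aq1 (lt_gtF aq1) mulr1 mulr0 addr0 /epowR gt_eqF//= -EFinD; congr (_%:E); ring.
  split.
    apply: ereal_inf_lbound; exists 0; first by rewrite /= lexx divr_ge0// ltW.
    by rewrite elemE mulr0 addr0.
  apply: le_ereal_inf_tmp => _ [g /= /andP[g0 _] <-].
  by rewrite elemE lee_fin lerDl mulr_ge0.
pose b := (alpha - q) / 2; have b0 : 0 < b by rewrite divr_gt0// subr_gt0.
pose C : R := 2 + 2 `^ b; have C2 : 2 <= C by rewrite lerDl powR_ge0.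
have C0 : 0 < C by rewrite (lt_le_trans _ C2).
exists C; split => // n s n0 s0; rewrite /bracketing_rate (lt_gtF qa).
have n0' : 0 < n%:R :> R by rewrite ltr0n.
pose v := alpha + 2 - q; have v0 : 0 < v by rewrite /v; lra.
pose g : R := n%:R `^ (- v^-1); have g0 : 0 < g by rewrite powR_gt0.
pose r : R := n%:R `^ ((alpha - q) / (2 * v)); rewrite -/v -/r -/b.
set y := n%:R `^ (- (1 / 2)) * s `^ (- alpha).
have y0 : 0 <= y by rewrite mulr_ge0 ?powR_ge0.
have gb : g `^ (- b) = r by rewrite /g /r -powRrM; congr (_ `^ _); rewrite /b; field; rewrite gt_eqF.
have ng : Num.sqrt n%:R * g = r.
  rewrite -powR12_sqrt// /g /r -powRD ?(gt_eqF n0') ?implybT//.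
  by congr (_ `^ _); rewrite /v; field; rewrite gt_eqF// -/v.
have elemE x : 0 < x -> (epowR (s * (alpha < q)%R%:R + x * (q < alpha)%R%:R) ((q - alpha) / 2)
     + (y + Num.sqrt n%:R * x)%:E = (x `^ (- b) + (y + Num.sqrt n%:R * x))%:E)%E.
  move=> x0; rewrite qa (lt_gtF qa) mulr1 mulr0 add0r /epowR gt_eqF//= -EFinD.
  by congr (_ `^ _ + _)%:E; rewrite /b; field.
have sb0 : 0 <= s `^ (- b) by exact: powR_ge0.
have r0 : 0 <= r by exact: powR_ge0.
split.
  pose x := Num.min g (s / 2).
  have x0 : 0 < x by rewrite lt_min g0 divr_gt0.
  apply: (@le_trans _ _ (x `^ (- b) + (y + Num.sqrt n%:R * x))%:E).
    apply: ereal_inf_lbound; exists x; last by rewrite elemE.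
    by rewrite /= (ltW x0) ge_min lexx orbT.
  have nx : Num.sqrt n%:R * x <= r by rewrite -ng ler_wpM2l// ge_min lexx.
  have s2 : (s / 2) `^ (- b) = 2 `^ b * s `^ (- b).
    rewrite powRM ?(ltW s0)// mulrC; congr (_ * _).
    by rewrite -[2^-1]powR_inv1// -powRrM mulN1r opprK.
  have xb : x `^ (- b) <= r + 2 `^ b * s `^ (- b).
    rewrite /x minEle; case: ifP => _; first by rewrite gb lerDl mulr_ge0 ?powR_ge0.
    by rewrite s2 lerDr.
  rewrite lee_fin.
  have : 0 <= 2 `^ b * r by rewrite mulr_ge0 ?powR_ge0.
  have : 0 <= 2 `^ b * y by rewrite mulr_ge0 ?powR_ge0.
  by move: nx xb; rewrite /C; move: (2 `^ b) (x `^ _) (Num.sqrt _ * _) => z w t; lra.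
set rate := r + _ + _.
suff low : ((C^-1 * rate)%:E <= bracketing_bound n alpha q s)%E.
  have -> : rate%:E = (C%:E * (C^-1 * rate)%:E)%E by rewrite -EFinM mulVKf// gt_eqF.
  by rewrite lee_wpmul2l// lee_fin ltW.
apply: le_ereal_inf_tmp => _ [x /= /andP[x0 xs] <-]; rewrite -/y.
(* At gamma = 0 the negative power is infinite by the convention of [epowR]. *)
have [->|xn0] := eqVneq x 0.
  by rewrite (lt_gtF qa) mulr0 mul0r addr0 /epowR eqxx/= ltr_pdivrMr// mul0r subr_lt0 qa/= leey.
have xp : 0 < x by rewrite lt_neqAle eq_sym xn0.
rewrite elemE//.
have sx : s `^ (- b) <= x `^ (- b).
  by apply: le0_ger_powR => //; [rewrite oppr_le0 ltW|lra].
have rx : r <= x `^ (- b) + Num.sqrt n%:R * x.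
  have [xg|gx] := leP x g.
    by rewrite -gb -[leLHS]addr0 lerD ?mulr_ge0// le0_ger_powR// oppr_le0 ltW.
  by rewrite -ng -[leLHS]add0r lerD ?powR_ge0// ler_wpM2l// ltW.
rewrite lee_fin ler_pdivrMl// /rate.
have nx0 : 0 <= Num.sqrt n%:R * x by rewrite mulr_ge0.
have xb0 : 0 <= x `^ (- b) by exact: powR_ge0.
move: rx sx nx0 xb0; move: (x `^ _) (Num.sqrt _ * _) => z w rx sx w0 z0.
have : 2 * (z + (y + w)) <= C * (z + (y + w)) by rewrite ler_wpM2r// !addr_ge0.
lra.
Qed.

Lemma bracketed_subset d (T : measurableType d) (R : realType) (P : probability T R)
    (F F' : set (T -> R)) e t h : F' `<=` F -> bracketed P F e t h -> bracketed P F' e t h.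
Proof.
move=> FF [N [l [D [lD sz cov Nh]]]]; exists N, l, D; split => // f /FF; exact: cov.
Qed.

Section UpperRates.
Context (R : realType).

Lemma natr_powR_ge1 n (r : R) : (0 < n)%N -> 0 <= r -> 1 <= n%:R `^ r.
Proof. by move=> n0 r0; rewrite -[leLHS](powRr0 n%:R); apply: ler_powR => //; rewrite ler1n. Qed.

Lemma natr_powRN_le1 n (r : R) : (0 < n)%N -> 0 <= r -> n%:R `^ (- r) <= 1.
Proof. by move=> n0 r0; rewrite powRN invf_le1 ?natr_powR_ge1// powR_gt0// ltr0n. Qed.

(** An L_p bound sigma gives the L2 bound sqrt 2 * sigma^(q/2), capped at 1 since |f| <= 1. Chaining
    from that scale, with a = alpha/q and u = 2/q, produces the stated powers of sigma. *)
Lemma expected_sup_le_rate (p alpha L : R) : 1 <= p -> 0 < alpha ->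
  let q := Num.min p 2 in alpha != q -> 0 < L ->
  exists C : R, 0 < C /\
      forall (d d' : measure_display) (T : measurableType d)
        (Omega : measurableType d') (P : probability T R)
        (Pr : probability Omega R) (n : nat) (X : 'I_n -> {RV Pr >-> T})
        (F : set (T -> R)) (sigma : R),
        (0 < n)%N -> 0 < sigma ->
        iid_sample P X -> unit_bounded_class F ->
        (forall f, F f -> (Lp_norm P p f <= sigma%:E)%E) ->
        bracketing_entropy_ub P F p alpha L ->
        (expected_sup P X F <= (C * bracketing_rate n alpha q sigma)%:E)%E.
Proof.
move=> p1 al0 q aq L0.
have q1 : 1 <= q by rewrite le_min p1 ler1n.
have q2 : q <= 2 by rewrite ge_min lexx orbT.
have q0 : 0 < q by rewrite (lt_le_trans ltr01).
pose a := alpha / q; have a0 : 0 < a by rewrite divr_gt0.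
pose K := L * 2 `^ (2 * a) + 1; have K0 : 0 < K by rewrite addr_gt0// mulr_gt0// powR_gt0.
have u1 : 1 <= 2 / q by rewrite ler_pdivlMr// mul1r.
have sq20 : 0 < Num.sqrt 2 :> R by rewrite sqrtr_gt0.
have sq21 : 1 <= Num.sqrt 2 :> R by rewrite -[leLHS]sqrtr1 ler_sqrt ?ler1n.
have classE d (T : measurableType d) (P : probability T R) (F : set (T -> R)) sigma :
    0 < sigma -> unit_bounded_class F ->
    (forall f, F f -> (Lp_norm P p f <= sigma%:E)%E) -> bracketing_entropy_ub P F p alpha L ->
    let s := Num.min 1 (Num.sqrt 2 * sigma `^ (q / 2)) in
    [/\ forall f, F f -> measurable_fun setT f, forall f, F f -> forall x, `|f x| <= 1,
      forall f, F f -> \int[P]_x f x ^+ 2 <= s ^+ 2 &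
      forall e, 0 < e <= 1 -> bracketed P F e (e `^ (2 / q)) (K * e `^ (- (2 * a)))].
  move=> s0 uF FL ent s; have [mF F1] := unit_bounded_classP uF.
  split => //; last exact: entropy_bracketed.
  move=> f Ff; have bf : bmf f by split; [exact: mF|exists 1; exact: F1].
  have f01 x : 0 <= `|f x| <= 2 by rewrite normr_ge0 (le_trans (F1 f Ff x)) ?ler1n.
  rewrite /s minEle; case: ifP => _.
    rewrite expr1n -[leRHS](mean_cst P); apply: mean_le => [||x]; [exact: bmf_sqr|exact: bmf_cst|].
    by rewrite -real_normK ?num_real// expr_le1// F1.
  rewrite exprMn sqr_sqrtr// -powR_mulrn ?powR_ge0// -powRrM mulfVK//.
  have -> : \int[P]_x f x ^+ 2 = \int[P]_x `|f x| ^+ 2.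
    by apply: eq_Rintegral => x _; rewrite real_normK ?num_real.
  apply: (mean_sqr_le_min (bmf_norm bf) f01 s0 p1); apply: (@mean_powR_le_Lp _ _ _ _ f) => //; [exact: ltW|exact: mF|exact: FL|exact: bmf_norm].
have w_le (w r : R) : 0 < w -> r <= 0 -> (Num.sqrt 2 * w) `^ r <= w `^ r.
  by move=> w0 r0; apply: le0_ger_powR => //; rewrite ler_peMl// ltW.
have wE sigma (r : R) : (sigma `^ (q / 2)) `^ r = sigma `^ (q * r / 2).
  by rewrite -powRrM; congr (_ `^ _); ring.
have [alq|qal|/eqP] := ltgtP alpha q; last by rewrite (negbTE aq).
- have a1 : a < 1 by rewrite ltr_pdivrMr// mul1r.
  have aneq1 : a != 1 by rewrite lt_eqF.
  have [C [C0 H]] := entropy_chaining_lt1 a0 K0 u1 a1.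
  exists (C * 4); split; first by rewrite mulr_gt0.
  move=> d d' T Omega P Pr n X F sigma n0 s0 iidX uF FL ent.
  have [mF F1 F2 Fb] := classE d T P F sigma s0 uF FL ent.
  set s := Num.min 1 _ in F2.
  have w0 : 0 < sigma `^ (q / 2) by rewrite powR_gt0.
  have spos : 0 < s by rewrite lt_min ltr01 mulr_gt0.
  have s1 : s <= 1 by rewrite ge_min lexx.
  apply: le_trans (H _ _ _ _ _ _ _ _ _ _ n0 spos s1 iidX mF F1 F2 Fb) _.
  rewrite lee_fin -mulrA ler_pM2l// /bracketing_rate alq.
  have bigw : (Num.sqrt 2 * sigma `^ (q / 2)) `^ (1 - a) <= 2 * sigma `^ ((q - alpha) / 2).
    rewrite powRM ?(ltW w0)// wE.
    have -> : q * (1 - a) / 2 = (q - alpha) / 2 by rewrite /a; field; exact: lt0r_neq0.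
    rewrite ler_wpM2r ?powR_ge0//.
    apply: (@le_trans _ _ (Num.sqrt 2)).
      by apply: ler1_powR => //; rewrite gerBl ltW.
    by rewrite -[leRHS](sqr_sqrtr (ler0n R 2)) expr2 ler_peMl// ltW.
  have neg : n%:R `^ (- (1 / 2)) <= 1 :> R by exact: natr_powRN_le1.
  have nn0 : 0 <= n%:R `^ (- (1 / 2)) :> R by exact: powR_ge0.
  have x0 : 0 <= sigma `^ ((q - alpha) / 2) by exact: powR_ge0.
  have y0 : 0 <= sigma `^ (- alpha) by exact: powR_ge0.
  have smin : s `^ (1 - a) <= 2 * sigma `^ ((q - alpha) / 2).
    apply: le_trans bigw; apply: ge0_ler_powR; rewrite ?nnegrE ?subr_ge0 ?(ltW a1) ?(ltW spos)//.
      by rewrite mulr_ge0 ?ltW.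
    by rewrite ge_min lexx orbT.
  (* When the cap is active this term is at most 1, and so is absorbed by [smin], whose left side is
     then 1. *)
  have t3 : n%:R `^ (- (1 / 2)) * s `^ (- (2 * a)) <=
      n%:R `^ (- (1 / 2)) * sigma `^ (- alpha) + 2 * sigma `^ ((q - alpha) / 2).
    move: smin; rewrite /s minEle; case: ifP => [_|_ _].
      by rewrite !powR1 mulr1 => le1; rewrite (le_trans neg)// (le_trans le1)// lerDr mulr_ge0.
    apply: (@le_trans _ _ (n%:R `^ (- (1 / 2)) * sigma `^ (- alpha))); last by rewrite lerDl mulr_ge0.
    rewrite ler_wpM2l//; apply: le_trans (w_le _ _ w0 _) _; first by rewrite oppr_le0 mulr_ge0// ltW.
    by rewrite wE; have -> : q * - (2 * a) / 2 = - alpha by rewrite /a; field; exact: lt0r_neq0.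
  have z0 : 0 <= n%:R `^ (- (1 / 2)) * sigma `^ (- alpha) by rewrite mulr_ge0.
  lra.
- have a1 : 1 < a by rewrite ltr_pdivlMr// mul1r.
  have [C [C0 H]] := entropy_chaining_gt1 a0 K0 u1 a1.
  exists (C * 3); split; first by rewrite mulr_gt0.
  move=> d d' T Omega P Pr n X F sigma n0 s0 iidX uF FL ent.
  have [mF F1 F2 Fb] := classE d T P F sigma s0 uF FL ent.
  set s := Num.min 1 _ in F2.
  have w0 : 0 < sigma `^ (q / 2) by rewrite powR_gt0.
  have spos : 0 < s by rewrite lt_min ltr01 mulr_gt0.
  have s1 : s <= 1 by rewrite ge_min lexx.
  apply: le_trans (H _ _ _ _ _ _ _ _ _ _ n0 spos s1 iidX mF F1 F2 Fb) _.
  rewrite lee_fin -mulrA ler_pM2l// /bracketing_rate (lt_gtF qal).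
  have -> : (a - 1) / (2 * (a - 1 + 2 / q)) = (alpha - q) / (2 * (alpha + 2 - q)).
    rewrite /a; field; rewrite !gt_eqF//; lra.
  set r := n%:R `^ _.
  have r1 : 1 <= r by apply: natr_powR_ge1 => //; rewrite divr_ge0// ?mulr_ge0//; lra.
  have neg : n%:R `^ (- (1 / 2)) <= 1 :> R by exact: natr_powRN_le1.
  have nn0 : 0 <= n%:R `^ (- (1 / 2)) :> R by exact: powR_ge0.
  have y0 : 0 <= n%:R `^ (- (1 / 2)) * sigma `^ (- alpha) by rewrite mulr_ge0 ?powR_ge0.
  have x0 : 0 <= sigma `^ (- ((alpha - q) / 2)) by exact: powR_ge0.
  have smin : s `^ (1 - a) <= r + sigma `^ (- ((alpha - q) / 2)).
    rewrite /s minEle; case: ifP => _; first by rewrite powR1 (le_trans r1)// lerDl.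
    apply: le_trans (w_le _ _ w0 _) _; first by rewrite subr_le0 ltW.
    rewrite wE; have -> : q * (1 - a) / 2 = - ((alpha - q) / 2) by rewrite /a; field; exact: lt0r_neq0.
    by rewrite lerDr (le_trans ler01).
  have t3 : n%:R `^ (- (1 / 2)) * s `^ (- (2 * a)) <= n%:R `^ (- (1 / 2)) * sigma `^ (- alpha) + r.
    rewrite /s minEle; case: ifP => _.
      by rewrite powR1 mulr1 (le_trans neg)// (le_trans r1)// lerDr.
    apply: (@le_trans _ _ (n%:R `^ (- (1 / 2)) * sigma `^ (- alpha))); last first.
      by rewrite lerDl (le_trans ler01).
    rewrite ler_wpM2l//; apply: le_trans (w_le _ _ w0 _) _; first by rewrite oppr_le0 mulr_ge0// ltW.
    by rewrite wE; have -> : q * - (2 * a) / 2 = - alpha by rewrite /a; field; exact: lt0r_neq0.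
  lra.
Qed.

(** The lower bound on sigma, raised to the power (alpha + 1)/2. It makes n^(-1/2) sigma^(-2 alpha)
    at most a constant times sigma^(1 - alpha). *)
Lemma local_sigma_small (alpha c sigma : R) n : 0 < alpha -> 0 < c -> 0 < sigma ->
  c * n%:R `^ (- (1 / (alpha + 1))) <= sigma ^+ 2 ->
  n%:R `^ (- (1 / 2)) <= c `^ (- ((alpha + 1) / 2)) * sigma `^ (alpha + 1).
Proof.
move=> al0 c0 s0 cs; have al1 : 0 < alpha + 1 by lra.
have -> : n%:R `^ (- (1 / 2)) = (n%:R `^ (- (1 / (alpha + 1)))) `^ ((alpha + 1) / 2) :> R.
  by rewrite -powRrM; congr (_ `^ _); field; exact: lt0r_neq0.
have -> : sigma `^ (alpha + 1) = (sigma ^+ 2) `^ ((alpha + 1) / 2).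
  by rewrite -powR_mulrn ?(ltW s0)// -powRrM; congr (_ `^ _); field.
rewrite powRN ler_pdivlMl ?powR_gt0// -powRM ?powR_ge0 ?(ltW c0)//.
apply: ge0_ler_powR => //; first by rewrite divr_ge0// ltW.
  by rewrite nnegrE mulr_ge0 ?powR_ge0// ltW.
by rewrite nnegrE sqr_ge0.
Qed.

(** For alpha < 1 the L2 brackets correspond to p = 2, hence a = alpha and u = 1. For alpha > 1 the
    L1 brackets at the squared scale correspond to p = 1, hence a = alpha and u = 2, which yields
    the exponent of n in the rate. *)
Lemma expected_sup_le_local_rate (alpha L c : R) : 0 < alpha -> alpha != 1 ->
  0 < L -> 0 < c -> exists C : R, 0 < C /\
      forall (d d' : measure_display) (T : measurableType d)
        (Omega : measurableType d') (P : probability T R)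
        (Pr : probability Omega R) (n : nat) (X : 'I_n -> {RV Pr >-> T})
        (F : set (T -> R)) (sigma : R),
        (0 < n)%N -> 0 < sigma ->
        iid_sample P X -> unit_bounded_class F ->
        local_bracketing_entropy_ub P F alpha L ->
        c * n%:R `^ (- (1 / (alpha + 1))) <= sigma ^+ 2 ->
        (expected_sup P X (local_class P F sigma)
           <= (C * local_rate n alpha sigma)%:E)%E.
Proof.
move=> al0 al1 L0 c0.
pose K := L * 2 `^ (2 * alpha) + 1; have K0 : 0 < K by rewrite addr_gt0// mulr_gt0// powR_gt0.
pose c1 : R := c `^ (- ((alpha + 1) / 2)); have c10 : 0 <= c1 by exact: powR_ge0.
have classE d (T : measurableType d) (P : probability T R) (F : set (T -> R)) sigma (u : R) :
    0 < sigma -> unit_bounded_class F ->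
    (forall e, 0 < e <= 1 -> bracketed P F e (e `^ u) (K * e `^ (- (2 * alpha)))) ->
    let s := Num.min 1 sigma in let F' := local_class P F sigma in
    [/\ forall f, F' f -> measurable_fun setT f, forall f, F' f -> forall x, `|f x| <= 1,
      forall f, F' f -> \int[P]_x f x ^+ 2 <= s ^+ 2 &
      forall e, 0 < e <= 1 -> bracketed P F' e (e `^ u) (K * e `^ (- (2 * alpha)))].
  move=> s0 uF Fb s F'; have [mF F1] := unit_bounded_classP uF.
  have FF : F' `<=` F by move=> f [].
  split; [by move=> f /FF/mF|by move=> f /FF/F1| |by move=> e /Fb; exact: bracketed_subset].
  move=> f [Ff]; have bf : bmf f by split; [exact: mF|exists 1; exact: F1].
  rewrite (EFin_mean P (bmf_sqr bf)) lee_fin => f2.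
  rewrite /s minEle; case: ifP => // _.
  rewrite expr1n -[leRHS](mean_cst P); apply: mean_le => [||x]; [exact: bmf_sqr|exact: bmf_cst|].
  by rewrite -real_normK ?num_real// expr_le1// F1.
have third n sigma : (0 < n)%N -> 0 < sigma -> sigma <= 1 ->
    c * n%:R `^ (- (1 / (alpha + 1))) <= sigma ^+ 2 ->
    n%:R `^ (- (1 / 2)) * sigma `^ (- (2 * alpha)) <= c1 * sigma `^ (1 - alpha).
  move=> n0 s0 s1 cs; apply: le_trans (ler_wpM2r (powR_ge0 _ _) (local_sigma_small al0 c0 s0 cs)) _.
  rewrite -mulrA -powRD ?(gt_eqF s0) ?implybT// le_eqVlt; apply/orP; left; apply/eqP.
  by congr (_ * _ `^ _); ring.
have neg n : (0 < n)%N -> n%:R `^ (- (1 / 2)) <= 1 :> R by move=> n0; exact: natr_powRN_le1.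
have [alq|qal|/eqP] := ltgtP alpha 1; last by rewrite (negbTE al1).
- have [C [C0 H]] := entropy_chaining_lt1 al0 K0 (lexx 1) alq.
  exists (C * (2 + c1)); split; first by rewrite mulr_gt0// (lt_le_trans (ltr0n _ 2))// lerDl.
  move=> d d' T Omega P Pr n X F sigma n0 s0 iidX uF [_ /(_ alq) ent] cs.
  have Fb e : 0 < e <= 1 -> bracketed P F e (e `^ 1) (K * e `^ (- (2 * alpha))).
    have := @entropy_bracketed _ _ _ P F 2 (2 * alpha) L (ler1n _ 2) (mulr_gt0 (ltr0n _ 2) al0) L0 uF ent.
    rewrite /= minxx divff ?pnatr_eq0//.
    have -> : 2 * alpha / 2 = alpha by field.
    by apply.
  have [mF F1 F2 Fb'] := classE d T P F sigma 1 s0 uF Fb.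
  set s := Num.min 1 _ in F2.
  have spos : 0 < s by rewrite lt_min ltr01.
  have s1 : s <= 1 by rewrite ge_min lexx.
  apply: le_trans (H _ _ _ _ _ _ _ _ _ _ n0 spos s1 iidX mF F1 F2 Fb') _.
  rewrite lee_fin -mulrA ler_pM2l//.
  apply: (@le_trans _ _ ((2 + c1) * sigma `^ (1 - alpha))); last first.
    by rewrite ler_wpM2l ?addr_ge0// le_max lexx.
  have x0 : 0 <= sigma `^ (1 - alpha) by exact: powR_ge0.
  have c1x : 0 <= c1 * sigma `^ (1 - alpha) by rewrite mulr_ge0.
  rewrite /s minEle; case: ifPn => [s1'|]; last first.
    by rewrite -ltNge => /ltW s1'; have := third n sigma n0 s0 s1' cs; lra.
  have : 1 <= sigma `^ (1 - alpha).
    by rewrite -[leLHS](powRr0 sigma); apply: ler_powR => //; rewrite subr_ge0 ltW.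
  by have := neg n n0; rewrite !powR1 mulr1; lra.
- have [C [C0 H]] := entropy_chaining_gt1 al0 K0 (ler1n _ 2) qal.
  exists (C * (3 + c1)); split; first by rewrite mulr_gt0// (lt_le_trans (ltr0n _ 3))// lerDl.
  move=> d d' T Omega P Pr n X F sigma n0 s0 iidX uF [/(_ qal) ent _] cs.
  have ent1 : bracketing_entropy_ub P F 1 alpha L.
    move=> e e0; have r0 : 0 < Num.sqrt e by rewrite sqrtr_gt0.
    have := ent _ r0; rewrite sqr_sqrtr ?(ltW e0)//.
    have -> : Num.sqrt e `^ (- (2 * alpha)) = e `^ (- alpha); last by [].
    by rewrite -powR12_sqrt ?(ltW e0)// -powRrM; congr (_ `^ _); field.
  have Fb e : 0 < e <= 1 -> bracketed P F e (e `^ 2) (K * e `^ (- (2 * alpha))).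
    have := @entropy_bracketed _ _ _ P F 1 alpha L (lexx _) al0 L0 uF ent1.
    by rewrite /= min_l ?ler1n// !divr1; apply.
  have [mF F1 F2 Fb'] := classE d T P F sigma 2 s0 uF Fb.
  set s := Num.min 1 _ in F2.
  have spos : 0 < s by rewrite lt_min ltr01.
  have s1 : s <= 1 by rewrite ge_min lexx.
  apply: le_trans (H _ _ _ _ _ _ _ _ _ _ n0 spos s1 iidX mF F1 F2 Fb') _.
  rewrite lee_fin -mulrA ler_pM2l// /local_rate.
  have -> : alpha - 1 + 2 = alpha + 1 by ring.
  set r := n%:R `^ _; set M := Num.max _ _.
  have rM : r <= M by rewrite le_max lexx orbT.
  have xM : sigma `^ (1 - alpha) <= M by rewrite le_max lexx.
  have r1 : 1 <= r by apply: natr_powR_ge1 => //; rewrite divr_ge0 ?mulr_ge0//; lra.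
  have cM : c1 * sigma `^ (1 - alpha) <= c1 * M by rewrite ler_wpM2l.
  have cM0 : 0 <= c1 * M by rewrite mulr_ge0// (le_trans _ rM)// (le_trans ler01).
  rewrite /s minEle; case: ifPn => [s1'|]; last first.
    by rewrite -ltNge => /ltW s1'; have := third n sigma n0 s0 s1' cs; lra.
  by have := neg n n0; rewrite !powR1 mulr1; lra.
Qed.

End UpperRates.

(** * Lower bounds *)

Section Separation.
Context d (T : measurableType d) (R : realType) (P : probability T R).

Definition variance_of (f : T -> R) : R := \int[P]_x (f x - \int[P]_y f y) ^+ 2.

Lemma variance_ofE f : bmf f -> variance_of f = \int[P]_x f x ^+ 2 - (\int[P]_x f x) ^+ 2.
Proof.
move=> bf; rewrite /variance_of; set m := \int[P]_x f x.
transitivity (\int[P]_x ((f x ^+ 2 - (2 * m) * f x) + m ^+ 2)).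
  by apply: eq_Rintegral => x _; ring.
have b1 := bmf_sqr bf; have b2 := bmfZ (2 * m) bf.
rewrite meanD; [|exact: bmfB|exact: bmf_cst].
by rewrite meanB// meanZ// mean_cst -/m; ring.
Qed.

Lemma Lp2_lt (h : T -> R) e : bmf h -> 0 < e -> \int[P]_x h x ^+ 2 < e ^+ 2 ->
  (Lp_norm P 2 h < e%:E)%E.
Proof.
move=> bh e0 he; rewrite ltNge; apply/negP => eN.
have : (e%:E `^ 2 <= Lp_norm P 2 h `^ 2)%E.
  by apply: gt0_ler_poweR => //; rewrite in_itv/= leey ?lee_fin ?(ltW e0)// Lnorm_ge0.
rewrite /Lp_norm poweR_Lnorm ?pnatr_eq0//.
have -> : (\int[P]_x `|(EFin \o h) x| `^ 2 = \int[P]_x (h x ^+ 2)%:E)%E.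
  apply: eq_integral => x _; rewrite -[RHS]/((h x ^+ 2)%:E) -real_normK ?num_real//.
  by rewrite -powR_mulrn// -poweR_EFin.
rewrite (EFin_mean P (bmf_sqr bh)) poweR_EFin lee_fin powR_mulrn ?(ltW e0)//.
by rewrite leNgt he.
Qed.

Lemma mean_le_sqrt (g : T -> R) e : bmf g -> 0 <= e -> \int[P]_x g x ^+ 2 <= e ^+ 2 ->
  `|\int[P]_x g x| <= e.
Proof.
move=> bg e0 ge; rewrite -(ler_pXn2r (n := 2))// ?nnegrE// real_normK ?num_real//.
exact: le_trans (sqr_mean_le P bg) ge.
Qed.

(* Translating the centers by multiples of [e / 8] turns a cover for the
   variance into a cover for the L2 norm, at the cost of a factor 33. *)
Lemma variance_separated (F : set (T -> R)) (e : R) M : unit_bounded_class F -> 0 < e ->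
  ((33 * M.-1)%:R%:E < covering_number (e / 2) (local_class P F e) (Lp_norm P 2))%E ->
  exists f : 'I_M -> T -> R, (forall i, local_class P F e (f i)) /\
    forall i j, i != j -> e ^+ 2 / 5 <= variance_of (fun x => f i x - f j x).
Proof.
move=> uF e0; have [mF F1] := unit_bounded_classP uF.
have bF f : local_class P F e f -> bmf f.
  by move=> [Ff _]; split; [exact: mF|exists 1; exact: F1].
have F2 f : local_class P F e f -> \int[P]_x f x ^+ 2 <= e ^+ 2.
  by move=> Ff; have := Ff.2; rewrite (EFin_mean P (bmf_sqr (bF f Ff))) lee_fin.
elim: M => [_|M IH covM].
  by exists (fun _ _ => 0); split=> -[].
have [f [Ff sep]] : exists f : 'I_M -> T -> R, (forall i, local_class P F e (f i)) /\
    forall i j, i != j -> e ^+ 2 / 5 <= variance_of (fun x => f i x - f j x).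
  by apply: IH; apply: le_lt_trans covM; rewrite lee_fin ler_nat leq_mul2l/= leq_pred.
(* Either the separated family can be enlarged, or it is maximal and the translates of its members
   give too small a cover. *)
have [[g [Fg gsep]]|no] := pselect (exists g, local_class P F e g /\
    forall i, e ^+ 2 / 5 <= variance_of (fun x => g x - f i x)).
  exists (fun i => if unlift ord0 i is Some j then f j else g); split.
    by move=> i; case: (unlift ord0 i).
  move=> i j; case: (unliftP ord0 i) => [i'|] ->; case: (unliftP ord0 j) => [j'|] ->.
  - by rewrite (inj_eq lift_inj); exact: sep.
  - move=> _; have := gsep i'.
    have bh : bmf (fun x => g x - f i' x) by apply: bmfB; exact: bF.
    rewrite !variance_ofE; [|by apply: bmfB; exact: bF|exact: bh].
    have e1 : \int[P]_x (f i' x - g x) ^+ 2 = \int[P]_x (g x - f i' x) ^+ 2.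
      by apply: eq_Rintegral => x _; ring.
    have e2 : \int[P]_x (f i' x - g x) = - \int[P]_x (g x - f i' x).
      by rewrite !meanB ?opprB//; exact: bF.
    by rewrite e1 e2 sqrrN.
  - by move=> _; exact: gsep.
  - by rewrite eqxx.
exfalso; move: covM; apply/negP; rewrite -leNgt /=.
(* The means of two members differ by at most 2e; covering [-2e, 2e] with step e/8 takes 33
   translates. *)
pose c (ja : 'I_M * 'I_33) x : R := f ja.1 x + (ja.2%:R - 16) * (e / 8).
apply: ereal_inf_lbound; exists #|{: 'I_M * 'I_33}|; last first.
  by rewrite card_prod !card_ord mulnC.
exists (fun i => c (enum_val i)); split.
  move=> i; apply: measurable_funD; last exact: measurable_cst.
  by case: (bF _ (Ff (enum_val i).1)).
move=> g Fg; have bg := bF g Fg.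
have [j vj] : exists j, variance_of (fun x => g x - f j x) < e ^+ 2 / 5.
  apply: contrapT => /forallNP nj; apply: no; exists g; split => // i.
  by rewrite leNgt; apply/negP.
have bfj := bF _ (Ff j).
have bh : bmf (fun x => g x - f j x) by exact: bmfB.
have [m mE] : exists m, m = \int[P]_x (g x - f j x) by eexists.
have m2 : - (2 * e) <= m <= 2 * e.
  have := mean_le_sqrt bg (ltW e0) (F2 g Fg); have := mean_le_sqrt bfj (ltW e0) (F2 _ (Ff j)).
  rewrite mE meanB// !ler_norml => /andP[? ?] /andP[? ?]; apply/andP; split; lra.
have e8 : 0 < e / 8 by rewrite divr_gt0.
have [ma mb] := andP m2.
have z0 : 0 <= (m + 2 * e) / (e / 8).
  by apply: divr_ge0; [rewrite -lerBlDr sub0r|exact: ltW].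
pose k := Num.truncn ((m + 2 * e) / (e / 8)).
have /andP[k1 k2] := Num.Theory.truncn_itv z0; rewrite -/k in k1 k2.
have k33 : (k < 33)%N.
  rewrite -(ltr_nat R); apply: le_lt_trans k1 _; rewrite ltr_pdivrMr//.
  lra.
exists (enum_rank (j, Ordinal k33)); rewrite enum_rankK /c /=.
set t := (k%:R - 16) * (e / 8).
have tm : `|m - t| <= e / 8.
  move: k1 k2; rewrite ler_pdivlMr// ltr_pdivrMr// -[k.+1%:R]natr1 /t ler_norml.
  by move: (k%:R : R) => kr k1 k2; apply/andP; split; lra.
have bt : bmf (fun x => g x - f j x - t) by apply: bmfB => //; exact: bmf_cst.
have -> : (g \- (fun x => f j x + t))%R = (fun x => g x - f j x - t).
  by apply/funext => x /=; ring.
apply: Lp2_lt => //; first by rewrite divr_gt0.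
have -> : \int[P]_x (g x - f j x - t) ^+ 2 = variance_of (fun x => g x - f j x) + (m - t) ^+ 2.
  rewrite variance_ofE// -mE.
  transitivity (\int[P]_x (((g x - f j x) ^+ 2 - (2 * t) * (g x - f j x)) + t ^+ 2)).
    by apply: eq_Rintegral => x _; ring.
  have b1 := bmf_sqr bh; have b2 := bmfZ (2 * t) bh.
  rewrite meanD; [|exact: bmfB|exact: bmf_cst].
  by rewrite meanB// meanZ// mean_cst -mE; ring.
(* The constant 1/5 is chosen so that 1/5 + 1/64 < 1/4, the squared radius of the balls. *)
have : (m - t) ^+ 2 <= (e / 8) ^+ 2.
  by rewrite -real_normK ?num_real// ler_pXn2r// ?nnegrE// ltW.
rewrite !expr_div_n; have : 0 < e ^+ 2 by rewrite exprn_gt0.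
move: vj; lra.
Qed.

End Separation.

(** * Rounding a separated family *)

Section DiscreteFamily.
Context d (T : measurableType d) (R : realType) (P : probability T R).

Lemma bmf_finite_map (A : finType) (Phi : T -> A) (g : A -> R) :
  (forall a, measurable (Phi @^-1` [set a])) -> bmf (fun x => g (Phi x)).
Proof.
move=> mPhi; split; first exact: finite_map_measurable.
exists (\sum_a `|g a|) => x; rewrite (bigD1 (Phi x))//= lerDl.
by apply: sumr_ge0.
Qed.

Lemma sqr_close (x y c del : R) : `|x| <= c -> `|y| <= c -> `|x - y| <= del ->
  x ^+ 2 <= y ^+ 2 + 2 * c * del.
Proof.
move=> xc yc xy; rewrite -lerBlDl subr_sqr (le_trans (ler_norm _))// normrM mulrC.
apply: ler_pM => //; rewrite (le_trans (ler_normD _ _))//; lra.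
Qed.

(** After rounding, the functions are centred by their own rounded means, so the centring required
    by the walk estimates is exact; only size and separation are approximate. *)
Lemma discretized_family M (f : 'I_M -> T -> R) (del : R) :
  (forall k, measurable_fun setT (f k)) -> (forall k x, `|f k x| <= 1) -> 0 < del ->
  exists (A : finType) (Phi : T -> A) (v : A -> {ffun 'I_M -> R}), let p := pmf_of P Phi in
  [/\ forall a, measurable (Phi @^-1` [set a]),
      (forall k, \sum_a p a * v a k = 0) /\ (forall a k, `|v a k| <= 2),
      forall k x, `|v (Phi x) k - (f k x - \int[P]_y f k y)| <= 2 * del,
      forall k, \sum_a p a * v a k ^+ 2 <= \int[P]_x f k x ^+ 2 + 2 * del &
      forall j k, variance_of P (fun x => f j x - f k x) <=
        \sum_a p a * (v a j - v a k) ^+ 2 + 32 * del].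
Proof.
move=> mf f1 del0; have bf k : bmf (f k) by split => //; exists 1.
have [A [Phi [g [mPhi gf g1]]]] := @discretize _ _ R M f 1 del mf f1 ler01 del0.
pose p := pmf_of P Phi.
have p0 a : 0 <= p a by exact: pmf_of_ge0.
have p1 : \sum_a p a = 1 by exact: sum_pmf_of.
have [m mE] : exists m : 'I_M -> R, forall k, m k = \sum_a p a * g a k.
  by exists (fun k => \sum_a p a * g a k).
have bg k : bmf (fun x => g (Phi x) k) by exact: (bmf_finite_map (fun a => g a k)).
have mP k : m k = \int[P]_x g (Phi x) k.
  by rewrite mE (mean_finite_map P mPhi (fun a => g a k)).
have m1 k : `|m k| <= 1 by rewrite mP; apply: mean_norm_le.
have mf' k : `|m k - \int[P]_x f k x| <= del.
  by rewrite mP -meanB//; apply: mean_norm_le => [|x]; [exact: bmfB|exact: gf].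
pose v a : {ffun 'I_M -> R} := [ffun k => g a k - m k].
have v2 a k : `|v a k| <= 2.
  rewrite ffunE (le_trans (ler_normB _ _))//.
  by have := g1 a k; have := m1 k; lra.
have vf k x : `|v (Phi x) k - (f k x - \int[P]_y f k y)| <= 2 * del.
  rewrite ffunE; have := gf k x; have := mf' k; rewrite !ler_norml.
  by move=> /andP[? ?] /andP[? ?]; apply/andP; split; lra.
exists A, Phi, v; split => //.
- split => // k; under eq_bigr do rewrite ffunE mulrBr.
  by rewrite sumrB -mE -mulr_suml p1 mul1r subrr.
- move=> k.
  have -> : \sum_a p a * v a k ^+ 2 = \sum_a p a * g a k ^+ 2 - m k ^+ 2.
    transitivity (\sum_a (p a * g a k ^+ 2 - 2 * m k * (p a * g a k) + m k ^+ 2 * p a)).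
      by apply: eq_bigr => a _; rewrite ffunE; ring.
    by rewrite big_split sumrB/= -!mulr_sumr p1 -mE; ring.
  rewrite (le_trans (y := \sum_a p a * g a k ^+ 2)) ?gerBl ?sqr_ge0//.
  rewrite -(mean_finite_map P mPhi (fun a => g a k ^+ 2)).
  apply: (@le_trans _ _ (\int[P]_x (f k x ^+ 2 + 2 * del))).
    apply: mean_le => [||x]; first exact: (bmf_finite_map (fun a => g a k ^+ 2)).
      by apply: bmfD; [exact: bmf_sqr|exact: bmf_cst].
    by have := sqr_close (g1 (Phi x) k) (f1 k x) (gf k x); rewrite mulr1.
  by rewrite meanD ?mean_cst//; [exact: bmf_sqr|exact: bmf_cst].
- move=> j k; rewrite -(mean_finite_map P mPhi (fun a => (v a j - v a k) ^+ 2)).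
  have bh : bmf (fun x => f j x - f k x) by exact: bmfB.
  have bv : bmf (fun x => (v (Phi x) j - v (Phi x) k) ^+ 2).
    exact: (bmf_finite_map (fun a => (v a j - v a k) ^+ 2)).
  rewrite /variance_of; set c := \int[P]_x (f j x - f k x).
  apply: (@le_trans _ _ (\int[P]_x ((v (Phi x) j - v (Phi x) k) ^+ 2 + 32 * del))); last first.
    by rewrite meanD ?mean_cst//; exact: bmf_cst.
  apply: mean_le => [||x]; [|by apply: bmfD => //; exact: bmf_cst|].
    by apply/bmf_sqr/bmfB => //; exact: bmf_cst.
  have cE : c = \int[P]_x f j x - \int[P]_x f k x by rewrite /c meanB.
  have cl : `|(f j x - f k x - c) - (v (Phi x) j - v (Phi x) k)| <= 4 * del.
    rewrite cE; have := vf j x; have := vf k x; rewrite !ler_norml.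
    by move=> /andP[? ?] /andP[? ?]; apply/andP; split; lra.
  have vjk : `|v (Phi x) j - v (Phi x) k| <= 4.
    by rewrite (le_trans (ler_normB _ _))//; have := v2 (Phi x) j; have := v2 (Phi x) k; lra.
  have fjk : `|f j x - f k x - c| <= 4.
    have mj : `|\int[P]_x f j x| <= 1 by exact: mean_norm_le.
    have mk : `|\int[P]_x f k x| <= 1 by exact: mean_norm_le.
    move: (f1 j x) (f1 k x) mj mk; rewrite cE !ler_norml.
    by move=> /andP[? ?] /andP[? ?] /andP[? ?] /andP[? ?]; apply/andP; split; lra.
  by have := sqr_close fjk vjk cl; lra.
Qed.

End DiscreteFamily.

(** * From walks to the expected supremum *)

Section LowerBounds.
Context d d' (T : measurableType d) (Omega : measurableType d') (R : realType).
Context (Pr : probability Omega R) (P : probability T R).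
Context (n : nat) (X : 'I_n -> {RV Pr >-> T}).
Hypothesis iidX : iid_sample P X.
Hypothesis n_gt0 : (0 < n)%N.

Let sn : R := Num.sqrt n%:R.
Let sn_gt0 : 0 < sn := sn_gt0 R n_gt0.

(** Any nonnegative majorant of the supremum dominates the positive part of [low], a measurable
    function of the rounded sample. The observable [phi] is left free below [maxabs]: it is later
    [maxabs] itself or a quadratic form. *)
Lemma expected_sup_ge_walk (F : set (T -> R)) M (f : 'I_M -> T -> R) (A : finType) (Phi : T -> A)
    (v : A -> {ffun 'I_M -> R}) (phi : {ffun 'I_M -> R} -> R) del :
  (forall k, F (f k)) -> (forall a, measurable (Phi @^-1` [set a])) -> 0 <= del ->
  (forall k x, `|v (Phi x) k - (f k x - \int[P]_y f k y)| <= del) ->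
  (forall w, phi (0 + \sum_(i < n) v (Phi (X i w))) <= maxabs (\sum_(i < n) v (Phi (X i w)))) ->
  (((walk n (pmf_of P Phi) v phi 0 - n%:R * del) / sn)%:E <= expected_sup P X F)%E.
Proof.
move=> Ff mPhi del0 vf phiS.
have mPsi := measurable_sample_fiber X mPhi.
pose low w := sn^-1 * (phi (0 + \sum_(i < n) v (Phi (X i w))) - n%:R * del).
have bphi : bmf (fun w => phi (0 + \sum_(i < n) v (Phi (X i w)))).
  have := bmf_finite_map (fun t : n.-tuple A => phi (0 + \sum_(i < n) v (tnth t i))) mPsi.
  congr (bmf _); apply/funext => w; congr (phi (_ + _)).
  by apply: eq_bigr => i _; rewrite tnth_mktuple.
have blow : bmf low by apply/bmfZ/bmfB => //; exact: bmf_cst.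
apply: le_ereal_inf_tmp => _ [U [mU U0 HU] <-].
apply: (@le_trans _ _ (\int[Pr]_w (Num.max 0 (low w))%:E)%E); last first.
  apply: ge0_le_integral => // [w _||w _].
  - by rewrite lee_fin le_max lexx.
  - by apply/measurable_EFinP; case: (bmf_max (bmf_cst _ 0) blow).
  - rewrite maxEle; case: ifP => // _; move: (U0 w) (HU w).
    case: (U w) => [r r0 Hr|_ _|//]; last exact: leey.
    have fr k : `|empirical_process P X (f k) w| <= r.
      by rewrite -lee_fin; apply: le_trans Hr; apply: ereal_sup_ubound; exists (f k).
    rewrite lee_fin /low ler_pdivrMl// lerBlDr (le_trans (phiS w))//.
    apply: maxabs_le => [|k]; first by rewrite addr_ge0 ?mulr_ge0 ?(ltW sn_gt0).
    have GE : sn * empirical_process P X (f k) w = \sum_(i < n) (f k (X i w) - \int[P]_x f k x).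
      by rewrite /empirical_process -/sn mulVKf// gt_eqF.
    rewrite sum_ffunE -[X in `|X|](subrK (sn * empirical_process P X (f k) w)) addrC.
    rewrite (le_trans (ler_normD _ _))// lerD//.
      by rewrite normrM (gtr0_norm sn_gt0) ler_wpM2l// ltW.
    rewrite GE -sumrB (le_trans (ler_norm_sum _ _ _))//.
    rewrite mulr_natl -[n in _ *+ n]card_ord -sumr_const.
    by apply: ler_sum => i _; exact: vf.
have bmax : bmf (fun w => Num.max 0 (low w)) by exact: bmf_max (bmf_cst _ 0) blow.
rewrite (EFin_mean Pr bmax) lee_fin.
apply: (@le_trans _ _ (\int[Pr]_w low w)); last first.
  by apply: mean_le => // w; rewrite le_max lexx orbT.
rewrite /low meanZ; last by apply: bmfB => //; exact: bmf_cst.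
rewrite meanB// ?mean_cst; last exact: bmf_cst.
by rewrite (mean_sample iidX mPhi v phi 0) mulrC.
Qed.

Lemma expected_sup_ge_separated (F : set (T -> R)) M (f : 'I_M -> T -> R) e lam :
  (0 < M)%N -> 0 < e -> unit_bounded_class F -> (forall k, local_class P F e (f k)) ->
  (forall j k, j != k -> e ^+ 2 / 5 <= variance_of P (fun x => f j x - f k x)) ->
  0 < lam -> lam <= 4^-1 -> 16 * 32 <= sn ->
  4 * expR (2 * (n%:R * lam ^+ 2 * e ^+ 2)) <= M%:R ->
  ((lam * sn * e ^+ 2 / (16 * 32))%:E <= expected_sup P X (local_class P F e))%E.
Proof.
move=> M0 e0 uF Ff sep l0 l4 sn_big Mbig; have [mF F1] := unit_bounded_classP uF.
have mf k : measurable_fun setT (f k) by apply: mF; case: (Ff k).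
have f1 k x : `|f k x| <= 1 by apply: F1; case: (Ff k).
have e20 : 0 < e ^+ 2 by rewrite exprn_gt0.
(* The rounding loss [n * (2 * del)] is then exactly half of the walk bound lam n e^2 / 256, which
   comes from [walk_max_ge] with K = 2 e^2 and tau2 = e^2 / 8. *)
pose del := lam * e ^+ 2 / (32 * 32); have del0 : 0 < del.
  by apply: divr_gt0; apply: mulr_gt0; rewrite ?ltr0n.
have dele : del <= e ^+ 2 / (64 * 64).
  by rewrite /del; have := ler_wpM2r (ltW e20) l4; lra.
have [A [Phi [v [mPhi [v0 v2] vf vsq vsep]]]] := @discretized_family _ _ _ P M f del mf f1 del0.
have del2 : 0 <= 2 * del by apply: mulr_ge0 => //; exact: ltW.
have phiS w : maxabs (0 + \sum_(i < n) v (Phi (X i w))) <=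
    maxabs (\sum_(i < n) v (Phi (X i w))) by rewrite add0r.
apply: le_trans (expected_sup_ge_walk Ff mPhi del2 vf phiS).
rewrite lee_fin ler_pdivlMr// lerBrDr.
have wk : lam * n%:R * (e ^+ 2 / 8) / 32 <= walk n (pmf_of P Phi) v (@maxabs R M) 0.
  apply: (@walk_max_ge _ _ _ _ _ lam (2 * e ^+ 2)) => //.
  - by move=> a; exact: pmf_of_ge0.
  - exact: sum_pmf_of.
  - move=> k; apply: le_trans (vsq k) _; have := (Ff k).2.
    have bfk : bmf (f k) by split => //; exists 1; exact: f1.
    by rewrite (EFin_mean P (bmf_sqr bfk)) lee_fin; lra.
  - by rewrite divr_gt0.
  - by move=> j k jk; have := sep j k jk; have := vsep j k; lra.
  - have : 16 * 32 * (e ^+ 2 / 8) <= sn * (e ^+ 2 / 8) by rewrite ler_wpM2r ?divr_ge0 ?(ltW e20).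
    by rewrite -/sn; lra.
  - by rewrite [n%:R * _ * _](_ : _ = 2 * (n%:R * lam ^+ 2 * e ^+ 2))//; ring.
apply: le_trans wk; rewrite /del -(@sn2 R n) -/sn.
by rewrite le_eqVlt; apply/orP; left; apply/eqP; field.
Qed.

(** The difference [L] of the two coordinates of the sum is at most 4n and at most twice [maxabs],
    so [maxabs] dominates L^2 / (8n); the mean of L^2 is n times the one-step variance. The
    resulting bound loses a factor sqrt n, harmless when n is bounded. *)
Lemma expected_sup_ge_pair (F : set (T -> R)) (f : 'I_2 -> T -> R) e :
  0 < e -> unit_bounded_class F -> (forall k, local_class P F e (f k)) ->
  (forall j k, j != k -> e ^+ 2 / 5 <= variance_of P (fun x => f j x - f k x)) ->
  ((e ^+ 2 / 128 / sn)%:E <= expected_sup P X (local_class P F e))%E.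
Proof.
move=> e0 uF Ff sep; have [mF F1] := unit_bounded_classP uF.
have mf k : measurable_fun setT (f k) by apply: mF; case: (Ff k).
have f1 k x : `|f k x| <= 1 by apply: F1; case: (Ff k).
have e20 : 0 < e ^+ 2 by rewrite exprn_gt0.
have n0 : 0 < n%:R :> R by rewrite ltr0n.
have n1 : 1 <= n%:R :> R by rewrite ler1n.
pose del := e ^+ 2 / (32 * 32) / n%:R; have del0 : 0 < del.
  by apply: divr_gt0 n0; apply: divr_gt0 e20 _; apply: mulr_gt0; rewrite ltr0n.
have ndel : n%:R * del = e ^+ 2 / (32 * 32) by rewrite /del mulrC mulfVK ?gt_eqF.
have dele : del <= e ^+ 2 / (32 * 32) by rewrite -ndel ler_peMl// ltW.
have [A [Phi [v [mPhi [v0 v2] vf vsq vsep]]]] := @discretized_family _ _ _ P 2 f del mf f1 del0.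
pose L (u : {ffun 'I_2 -> R}) := u ord0 - u ord_max.
have LD : {morph L : x y / x + y} by move=> x y; rewrite /L !ffunE; ring.
pose phi u := 0 + (8 * n%:R)^-1 * L u ^+ 2.
have del2 : 0 <= 2 * del by apply: mulr_ge0 => //; exact: ltW.
have phiS w : phi (0 + \sum_(i < n) v (Phi (X i w))) <=
    maxabs (\sum_(i < n) v (Phi (X i w))).
  rewrite /phi add0r add0r; set S := \sum_(i < n) _.
  rewrite ler_pdivrMl ?mulr_gt0//.
  have Sn k : `|S k| <= 2 * n%:R.
    rewrite /S sum_ffunE (le_trans (ler_norm_sum _ _ _))//.
    rewrite mulr_natr -[n in _ *+ n]card_ord -sumr_const.
    by apply: ler_sum => i _; exact: v2.
  have LS : `|L S| <= 2 * maxabs S.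
    by rewrite (le_trans (ler_normB _ _))// mulr2n mulrDl mul1r lerD// le_maxabs.
  have L4 : `|L S| <= 4 * n%:R.
    by rewrite (le_trans (ler_normB _ _))//; have := Sn ord0; have := Sn ord_max; lra.
  rewrite -real_normK ?num_real// expr2.
  by apply: le_trans (ler_pM _ _ L4 LS) _ => //; lra.
apply: le_trans (expected_sup_ge_walk Ff mPhi del2 vf phiS).
rewrite lee_fin /phi ler_pM2r ?invr_gt0//.
rewrite (walk_affine v (sum_pmf_of P mPhi) n (fun u => L u ^+ 2)).
rewrite (walk_square n 0 LD (sum_pmf_of P mPhi)); last first.
  by rewrite /L; under eq_bigr do rewrite mulrBr; rewrite sumrB !v0 subrr.
have -> : L 0 = 0 by rewrite /L !ffunE subrr.
have e8 x : (8 * n%:R)^-1 * (n%:R * x) = x / 8 :> R by field; exact: lt0r_neq0.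
rewrite expr0n/= !add0r e8 /L.
have := sep ord0 ord_max isT; have := vsep ord0 ord_max.
have -> : n%:R * (2 * del) = 2 * (e ^+ 2 / (32 * 32)) by rewrite mulrCA ndel.
lra.
Qed.

End LowerBounds.

(** As [H > 1], the truncation of the logarithm at e cannot be what makes the bound hold. *)
Lemma expR_le_of_lne (R : realType) (H : R) (N : \bar R) : 1 < H ->
  (H%:E <= lne (Order.max (expR 1)%:E N))%E -> ((expR H)%:E <= N)%E.
Proof.
move=> H1; rewrite maxElt; case: ifPn => [eN|_]; last first.
  by rewrite lne_EFin ?expR_gt0// expRK lee_fin leNgt H1.
case: N eN => [r|_ _|//]; last exact: leey.
rewrite lte_fin => er; have r0 : 0 < r := lt_trans (expR_gt0 _) er.
by rewrite lne_EFin// !lee_fin => Hr; rewrite -[r]lnK ?posrE// ler_expR.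
Qed.

Lemma expected_sup_subset d d' (T : measurableType d) (Omega : measurableType d') (R : realType)
    (Pr : probability Omega R) (P : probability T R) n (X : 'I_n -> {RV Pr >-> T})
    (F F' : set (T -> R)) : F' `<=` F -> (expected_sup P X F' <= expected_sup P X F)%E.
Proof.
move=> FF; apply: ereal_inf_le_tmp => _ [U [mU U0 HU] <-]; exists U => //; split => // w.
apply: le_trans (HU w); apply: ge_ereal_sup => _ [f /FF Ff <-].
by apply: ereal_sup_ubound; exists f.
Qed.

(** * Choice of scale and tilt *)

Section LowerRate.
Context (R : realType) (alpha L c : R).
Hypothesis al0 : 0 < alpha.
Hypothesis al1 : alpha != 1.
Hypothesis L0 : 0 < L.
Hypothesis c0 : 0 < c.

(** Entropy at least 300 ensures exp H / 33 - 1 >= 4 exp(H / 2), so that enough separated functions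
    exist; [eta ^+ 2 <= c] lets the working scale fit below sigma. *)
Lemma exists_scale : exists eta : R, [/\ 0 < eta <= 1, eta ^+ 2 <= c &
  forall e, 0 < e <= eta -> 300 <= L^-1 * e `^ (- (2 * alpha))].
Proof.
have L3 : 0 < 300 * L := mulr_gt0 (ltr0n R 300) L0.
pose z : R := (300 * L) `^ (- (2 * alpha)^-1); have z0 : 0 < z by rewrite powR_gt0.
pose eta := Num.min 1 (Num.min (Num.sqrt c) z).
have eta0 : 0 < eta by rewrite !lt_min ltr01 sqrtr_gt0 c0.
exists eta; split.
- by rewrite eta0 ge_min lexx.
- rewrite -[leRHS]sqr_sqrtr ?(ltW c0)// lerXn2r ?nnegrE ?(ltW eta0)//.
  by rewrite !ge_min lexx orbT.
- move=> e /andP[e0 ee]; rewrite ler_pdivlMl// mulrC.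
  have <- : z `^ (- (2 * alpha)) = 300 * L.
    rewrite /z -powRrM mulrNN mulVf ?powRr1 ?(ltW L3)//.
    by rewrite gt_eqF// mulr_gt0.
  apply: le0_ger_powR => //; first by rewrite oppr_le0 mulr_ge0// ltW.
  by rewrite (le_trans ee)// !ge_min lexx !orbT.
Qed.

Lemma expected_sup_ge_local_rate : exists C : R, 0 < C /\
      forall (d d' : measure_display) (T : measurableType d)
        (Omega : measurableType d') (P : probability T R)
        (Pr : probability Omega R) (n : nat) (X : 'I_n -> {RV Pr >-> T})
        (F : set (T -> R)) (sigma : R),
        (0 < n)%N -> 0 < sigma -> (alpha < 1 -> sigma <= 1) ->
        iid_sample P X -> unit_bounded_class F ->
        local_covering_entropy_lb P F alpha L ->
        c * n%:R `^ (- (1 / (alpha + 1))) <= sigma ^+ 2 ->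
        ((C * local_rate n alpha sigma)%:E
           <= expected_sup P X (local_class P F sigma))%E.
Proof.
have [eta [/andP[eta0 eta1] etac etaH]] := exists_scale.
have a1 : 0 < alpha + 1 by rewrite addr_gt0.
pose c1 : R := c `^ (- ((alpha + 1) / 2)); have c10 : 0 < c1 by rewrite powR_gt0.
pose c2 := Num.max 1 c1; have c20 : 0 < c2 by rewrite lt_max ltr01.
pose c3 := Num.max 1 (Num.max (c1 `^ ((1 - alpha) / (alpha + 1))) (eta `^ (1 - alpha))).
have c30 : 0 < c3 by rewrite lt_max ltr01.
have sL0 : 0 < Num.sqrt L by rewrite sqrtr_gt0.
(* The first entry bounds n lam^2 e^2 by a quarter of the entropy; the second ensures lam <= 1/4. *)
pose kap := Num.min (2 * Num.sqrt L)^-1 (eta `^ (alpha + 1) / (4 * c2)).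
have kap0 : 0 < kap by rewrite lt_min invr_gt0 divr_gt0 ?mulr_gt0 ?powR_gt0.
pose k1 := kap * eta `^ (1 - alpha) / (16 * 32).
have p512 : 0 < 16 * 32 :> R by rewrite mulr_gt0 ?ltr0n.
have k10 : 0 < k1.
  by apply: divr_gt0 p512; apply: mulr_gt0 kap0 _; exact: powR_gt0.
pose k2 := eta ^+ 2 / 128 / (16 * 32) / (16 * 32 * c2).
have k20 : 0 < k2.
  apply: divr_gt0; last exact: mulr_gt0.
  apply: divr_gt0 p512; apply: divr_gt0; last by rewrite ltr0n.
  exact: exprn_gt0.
exists (Num.min k1 k2 / c3); split; first by rewrite divr_gt0// lt_min k10.
move=> d d' T Omega P Pr n X F sigma n0 s0 s1 iidX uF ent cs.
have n0' : 0 < n%:R :> R by rewrite ltr0n.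
set sn : R := Num.sqrt n%:R; have sn0 : 0 < sn by rewrite sqrtr_gt0.
pose z : R := n%:R `^ (- (2 * (alpha + 1))^-1); have z0 : 0 < z by rewrite powR_gt0.
have small := local_sigma_small al0 c0 s0 cs; rewrite -/c1 in small.
have snE : n%:R `^ (- (1 / 2)) = sn^-1 :> R.
  by rewrite powRN mul1r powR12_sqrt.
have nE : n%:R `^ ((alpha - 1) / (2 * (alpha + 1))) = z `^ (1 - alpha).
  by rewrite /z -powRrM; congr (_ `^ _); field; exact: lt0r_neq0.
(* For alpha < 1 the class is tested at its own scale, where the power of sigma dominates. For alpha
   > 1 smaller functions fluctuate more, and the scale is n^(-1/(2(alpha+1))), which up to the
   factor [eta] is still below sigma. *)
have [s [s_gt0 s_le1 es sa rate_s]] : exists s : R, [/\ 0 < s, s <= 1, eta * s <= sigma,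
    s `^ (- (alpha + 1)) <= c2 * sn & local_rate n alpha sigma <= c3 * s `^ (1 - alpha)].
  have [alt|agt|/eqP] := ltgtP alpha 1; last by rewrite (negbTE al1).
    exists sigma; split => //; first exact: s1.
    - by rewrite ler_piMl// ltW.
    - rewrite powRN -[leLHS]mul1r ler_pdivrMr ?powR_gt0//.
      have c12 : c1 <= c2 by rewrite le_max lexx orbT.
      apply: (@le_trans _ _ (sn * (c1 * sigma `^ (alpha + 1)))).
        by rewrite -ler_pdivrMl// mulr1 -snE.
      by rewrite mulrCA mulrA ler_wpM2r ?powR_ge0// ler_wpM2r// ltW.
    - rewrite /local_rate ge_max; apply/andP; split.
        by rewrite ler_peMl ?powR_ge0// le_max lexx.
      have -> : n%:R `^ ((alpha - 1) / (2 * (alpha + 1))) =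
          (n%:R `^ (- (1 / 2))) `^ ((1 - alpha) / (alpha + 1)) :> R.
        by rewrite -powRrM; congr (_ `^ _); field; exact: lt0r_neq0.
      apply: (@le_trans _ _ ((c1 * sigma `^ (alpha + 1)) `^ ((1 - alpha) / (alpha + 1)))).
        apply: ge0_ler_powR; rewrite ?nnegrE ?powR_ge0//.
          by rewrite divr_ge0 ?subr_ge0 ?ltW.
        by rewrite mulr_ge0 ?powR_ge0// ltW.
      rewrite powRM ?powR_ge0 ?(ltW c10)// -powRrM.
      have -> : (alpha + 1) * ((1 - alpha) / (alpha + 1)) = 1 - alpha by field; exact: lt0r_neq0.
      by rewrite ler_wpM2r ?powR_ge0// !le_max lexx orbT.
  have ezs : eta * z <= sigma.
    rewrite -(ler_pXn2r (n := 2))// ?nnegrE ?mulr_ge0 ?(ltW eta0) ?(ltW z0) ?(ltW s0)//.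
    apply: le_trans cs; rewrite exprMn.
    have -> : z ^+ 2 = n%:R `^ (- (1 / (alpha + 1))).
      rewrite -powR_mulrn ?(ltW z0)// /z -powRrM; congr (_ `^ _); field; exact: lt0r_neq0.
    by rewrite ler_wpM2r// powR_ge0.
  exists z; split => //.
  - by apply: natr_powRN_le1 => //; rewrite invr_ge0 mulr_ge0// ltW.
  - have -> : z `^ (- (alpha + 1)) = sn.
      rewrite /sn -powR12_sqrt// /z -powRrM; congr (_ `^ _); field; exact: lt0r_neq0.
    by rewrite ler_peMl ?(ltW sn0)// le_max lexx.
  - rewrite /local_rate nE ge_max; apply/andP; split; last first.
      by rewrite ler_peMl ?powR_ge0// le_max lexx.
    apply: (@le_trans _ _ ((eta * z) `^ (1 - alpha))).
      apply: le0_ger_powR; [by rewrite subr_le0 ltW|exact: mulr_gt0|by []].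
    rewrite powRM ?(ltW eta0) ?(ltW z0)//.
    by rewrite ler_wpM2r ?powR_ge0// !le_max lexx !orbT.
have sa0 : 0 < s `^ (1 - alpha) by rewrite powR_gt0.
apply: (@le_trans _ _ (Num.min k1 k2 * s `^ (1 - alpha))%:E).
  have m0 : 0 <= Num.min k1 k2 by rewrite le_min (ltW k10) (ltW k20).
  by rewrite lee_fin -mulrA ler_wpM2l// ler_pdivrMl.
pose e := eta * s; have e0 : 0 < e by rewrite mulr_gt0.
have ee : e <= eta by rewrite ler_piMr// ltW.
have sub : local_class P F e `<=` local_class P F sigma.
  move=> f [Ff f2]; split => //; apply: le_trans f2 _.
  by rewrite lee_fin lerXn2r ?nnegrE ?(ltW e0) ?(ltW s0).
apply: (@le_trans _ _ (expected_sup P X (local_class P F e))); last exact: expected_sup_subset.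
pose H := L^-1 * e `^ (- (2 * alpha)).
have H3 : 300 <= H by apply: etaH; rewrite e0.
have cov : ((expR H)%:E <= covering_number (e / 2) (local_class P F e) (Lp_norm P 2))%E.
  by apply: expR_le_of_lne (ent e e0); rewrite -/H; lra.
have ea : e `^ (1 - alpha) = eta `^ (1 - alpha) * s `^ (1 - alpha).
  by rewrite powRM// ltW.
(* The tilting argument requires sqrt n >= 512; below that n is bounded and two functions
   suffice. *)
have [sn5|sn5] := leP (16 * 32 : R) sn.
- pose y := expR (H / 2).
  have y1 : 151 <= y by have := expR_ge1Dx (H / 2); rewrite -/y; lra.
  have yy : expR H = y * y by rewrite /y -expRD; congr expR; field.
  pose M := Num.truncn (expR H / 33).
  have /andP[M1 M2] := Num.Theory.truncn_itv (divr_ge0 (expR_ge0 H) (ler0n R 33)).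
  rewrite -/M yy in M1 M2.
  have My : 4 * y <= M%:R.
    move: M2; rewrite -[M.+1%:R]natr1; move: (M%:R : R) => m; nra.
  have M0 : (0 < M)%N by rewrite -(ltr_nat R); lra.
  have MN : ((33 * M.-1)%:R%:E < covering_number (e / 2) (local_class P F e) (Lp_norm P 2))%E.
    apply: lt_le_trans cov; rewrite lte_fin yy.
    apply: (@lt_le_trans _ _ (33 * M%:R)); last by rewrite mulrC -ler_pdivlMr.
    by rewrite natrM ltr_pM2l// ltr_nat prednK.
  have [f [Ff sep]] := variance_separated uF e0 MN.
  (* The largest tilt, up to [kap], that M = exp H / 33 functions allow: n lam^2 e^2 is of the order
     of the entropy, and lam sqrt n e^2 = kap e^(1 - alpha) is the rate. *)
  pose lam := kap * e `^ (- (alpha + 1)) / sn.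
  have lam0 : 0 < lam by rewrite divr_gt0 ?mulr_gt0 ?powR_gt0.
  have lam4 : lam <= 4^-1.
    rewrite ler_pdivrMr//.
    have kle : kap <= eta `^ (alpha + 1) / (4 * c2) by rewrite ge_min lexx orbT.
    apply: le_trans (ler_wpM2r (powR_ge0 _ _) kle) _.
    have -> : e `^ (- (alpha + 1)) = (eta `^ (alpha + 1))^-1 * s `^ (- (alpha + 1)).
      by rewrite powRM ?ltW// powRN.
    have -> : eta `^ (alpha + 1) / (4 * c2) * ((eta `^ (alpha + 1))^-1 * s `^ (- (alpha + 1)))
        = s `^ (- (alpha + 1)) / c2 / 4.
      by field; rewrite !gt_eqF ?powR_gt0.
    rewrite mulrC ler_pM2l ?invr_gt0// ler_pdivrMr// mulrC; exact: sa.
  have lame : n%:R * lam ^+ 2 * e ^+ 2 = kap ^+ 2 * e `^ (- (2 * alpha)).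
    have -> : e `^ (- (2 * alpha)) = (e `^ (- (alpha + 1))) ^+ 2 * e ^+ 2.
      rewrite -!powR_mulrn ?powR_ge0 ?(ltW e0)// -powRrM -powRD ?(gt_eqF e0) ?implybT//.
      by congr (_ `^ _); ring.
    rewrite /lam -(@sn2 R n) -/sn; field; exact: lt0r_neq0.
  have kap2 : kap ^+ 2 <= (4 * L)^-1.
    have kle : kap <= (2 * Num.sqrt L)^-1 by rewrite ge_min lexx.
    have -> : (4 * L)^-1 = ((2 * Num.sqrt L)^-1) ^+ 2.
      by rewrite exprVn exprMn sqr_sqrtr ?(ltW L0)//; congr (_ * _)^-1; ring.
    apply: lerXn2r => //; rewrite nnegrE; first exact: ltW.
    by rewrite invr_ge0 mulr_ge0// ltW.
  have expM : 4 * expR (2 * (n%:R * lam ^+ 2 * e ^+ 2)) <= M%:R.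
    apply: le_trans My; rewrite ler_pM2l// ler_expR lame.
    have := ler_wpM2r (powR_ge0 e (- (2 * alpha))) kap2.
    have -> : (4 * L)^-1 * e `^ (- (2 * alpha)) = H / 4 by rewrite /H invfM; ring.
    lra.
  apply: le_trans (expected_sup_ge_separated iidX n0 M0 e0 uF Ff sep lam0 lam4 sn5 expM).
  rewrite lee_fin -/sn.
  have -> : lam * sn * e ^+ 2 / (16 * 32) = k1 * s `^ (1 - alpha).
    have -> : k1 * s `^ (1 - alpha) = kap * e `^ (1 - alpha) / (16 * 32).
      by rewrite /k1 ea; field.
    rewrite /lam.
    have -> : e `^ (1 - alpha) = e `^ (- (alpha + 1)) * e ^+ 2.
      rewrite -powR_mulrn ?(ltW e0)// -powRD ?(gt_eqF e0) ?implybT//.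
      by congr (_ `^ _); ring.
    by field; exact: lt0r_neq0.
  by rewrite ler_wpM2r ?(ltW sa0)// ge_min lexx.
- have MN : ((33 * 2.-1)%:R%:E < covering_number (e / 2) (local_class P F e) (Lp_norm P 2))%E.
    apply: lt_le_trans cov; rewrite lte_fin.
    by have := expR_ge1Dx H; rewrite muln1; lra.
  have [f [Ff sep]] := variance_separated uF e0 MN.
  apply: le_trans (expected_sup_ge_pair iidX n0 e0 uF Ff sep).
  rewrite lee_fin -/sn.
  apply: (@le_trans _ _ (k2 * s `^ (1 - alpha))).
    by rewrite ler_wpM2r ?(ltW sa0)// ge_min lexx orbT.
  have s2 : s `^ (1 - alpha) = s ^+ 2 * s `^ (- (alpha + 1)).
    rewrite -powR_mulrn ?(ltW s_gt0)// -powRD ?(gt_eqF s_gt0) ?implybT//.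
    by congr (_ `^ _); ring.
  have s5 : s `^ (- (alpha + 1)) <= 16 * 32 * c2.
    by rewrite (le_trans sa)// mulrC ler_wpM2r// ltW.
  have -> : k2 * s `^ (1 - alpha) = (e ^+ 2 / 128) * ((16 * 32)^-1 * (s `^ (- (alpha + 1)) / (16 * 32 * c2))).
    by rewrite s2 /k2 /e; field; exact: lt0r_neq0.
  rewrite ler_wpM2l ?divr_ge0 ?sqr_ge0//.
  apply: (@le_trans _ _ ((16 * 32)^-1)).
    by rewrite ler_piMr// ler_pdivrMr ?mulr_gt0// mul1r.
  by rewrite lef_pV2 ?posrE// ltW.
Qed.

End LowerRate.

Theorem theorem2p1 (R : realType) :
  (* (1) *)
  (forall p alpha : R, 1 <= p -> 0 < alpha ->
    let q := Num.min p 2 in alpha != q ->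
    (forall L : R, 0 < L -> exists C : R, 0 < C /\
      forall (d d' : measure_display) (T : measurableType d)
        (Omega : measurableType d') (P : probability T R)
        (Pr : probability Omega R) (n : nat) (X : 'I_n -> {RV Pr >-> T})
        (F : set (T -> R)) (sigma : R),
        (0 < n)%N -> 0 < sigma ->
        iid_sample P X -> unit_bounded_class F ->
        (forall f, F f -> (Lp_norm P p f <= sigma%:E)%E) ->
        bracketing_entropy_ub P F p alpha L ->
        (expected_sup P X F
           <= C%:E * bracketing_bound n alpha q sigma)%E) /\
    (exists C : R, 0 < C /\
      forall (n : nat) (sigma : R), (0 < n)%N -> 0 < sigma ->
        (bracketing_bound n alpha q sigma
           <= (C * bracketing_rate n alpha q sigma)%:E)%E /\
        ((bracketing_rate n alpha q sigma)%:E
           <= C%:E * bracketing_bound n alpha q sigma)%E)) /\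
  (* (2) *)
  (forall alpha : R, 0 < alpha -> alpha != 1 ->
    forall L c : R, 0 < L -> 0 < c -> exists C : R, 0 < C /\
      forall (d d' : measure_display) (T : measurableType d)
        (Omega : measurableType d') (P : probability T R)
        (Pr : probability Omega R) (n : nat) (X : 'I_n -> {RV Pr >-> T})
        (F : set (T -> R)) (sigma : R),
        (0 < n)%N -> 0 < sigma ->
        iid_sample P X -> unit_bounded_class F ->
        local_bracketing_entropy_ub P F alpha L ->
        c * n%:R `^ (- (1 / (alpha + 1))) <= sigma ^+ 2 ->
        (expected_sup P X (local_class P F sigma)
           <= (C * local_rate n alpha sigma)%:E)%E) /\
  (* (3) *)
  (forall alpha : R, 0 < alpha -> alpha != 1 ->
    forall L c : R, 0 < L -> 0 < c -> exists C : R, 0 < C /\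
      forall (d d' : measure_display) (T : measurableType d)
        (Omega : measurableType d') (P : probability T R)
        (Pr : probability Omega R) (n : nat) (X : 'I_n -> {RV Pr >-> T})
        (F : set (T -> R)) (sigma : R),
        (0 < n)%N -> 0 < sigma -> (alpha < 1 -> sigma <= 1) ->
        iid_sample P X -> unit_bounded_class F ->
        local_bracketing_entropy_ub P F alpha L ->
        local_covering_entropy_lb P F alpha L ->
        c * n%:R `^ (- (1 / (alpha + 1))) <= sigma ^+ 2 ->
        ((C * local_rate n alpha sigma)%:E
           <= expected_sup P X (local_class P F sigma))%E).
Proof.
split; [|split].
- move=> p alpha p1 al0 q aq.
  have q0 : 0 < q by rewrite lt_min (lt_le_trans ltr01 p1)/=.
  have q2 : q <= 2 by rewrite ge_min lexx orbT.
  have [C2 [C20 asymp]] := bracketing_bound_rate_asymp al0 q0 q2 aq.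
  split; last by exists C2.
  move=> L L0; have [C1 [C10 up]] := expected_sup_le_rate p1 al0 aq L0.
  exists (C1 * C2); split; first exact: mulr_gt0.
  move=> d d' T Omega P Pr n X F sigma n0 s0 iidX uF FL ent.
  apply: le_trans (up _ _ _ _ _ _ _ _ _ _ n0 s0 iidX uF FL ent) _.
  rewrite EFinM EFinM -muleA lee_wpmul2l ?lee_fin ?(ltW C10)//.
  by have [] := asymp n sigma n0 s0.
- by move=> alpha al0 al1 L c L0 c0; exact: expected_sup_le_local_rate.
- move=> alpha al0 al1 L c L0 c0.
  have [C [C0 lo]] := expected_sup_ge_local_rate al0 al1 L0 c0.
  exists C; split => // d d' T Omega P Pr n X F sigma n0 s0 s1 iidX uF _ ent cs.
  exact: lo.
Qed.
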